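(* Let $N>0$ be an integer. There is a rational function $R\in\mathbb{Q}(X_1(N))$ such that for each real point $s\in X_1(N)(\mathbb{R})$ which is not a cusp, we have $$R(s)=\frac{2\pi\, D_{0,q(s)}(P(s))}{\Omega^+(s)}.$$
   Context: Let $\Gamma_1(N)=\left\{\begin{pmatrix}a&b\\c&d\end{pmatrix}\in SL_2(\mathbb{Z}) : \begin{pmatrix}a&b\\c&d\end{pmatrix}\equiv\begin{pmatrix}1&*\\0&1\end{pmatrix}\bmod N\right\}$, and let $X_1(N)$ be the corresponding modular curve, a projective curve over $\mathbb{Q}$ such that $X_1(N)\otimes\mathbb{C}$ contains $\Gamma_1(N)\backslash H$ ($H$ the upper half plane) as an affine open subset. For each non-cuspidal $s\in X_1(N)$ there is a corresponding elliptic curve $E(s)$ with a point $P(s)$ of order $N$, both defined over $\mathbb{Q}(s)$. A nonzero holomorphic differential $\omega(s)$ on $E(s)$, varying algebraically in $s$ (over $\mathbb{Q}$; i.e. the triples $(E(s),\omega(s),P(s))$ are the fibres of an algebraic family over the non-cuspidal part of $X_1(N)$, defined over $\mathbb{Q}$), is fixed. The function $D_0$: for $z\in\mathbb{C}$, $z\neq 1$, set $D_0(z)=\operatorname{Im}\bigl(z/(1-z)\bigr)=\operatorname{Im}\bigl(1/(1-z)\bigr)$, and set $D_0(1)=0$. For $0<|q|<1$ and $z\in\mathbb{C}^\times$ set $D_{0,q}(z)=\sum_{n\in\mathbb{Z}}D_0(zq^n)$; this depends only on the class of $z$ in $\mathbb{C}^\times/q^{\mathbb{Z}}$. The quantities attached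 to $s$: let $s$ be a non-cuspidal real point, so that $E=E(s)$, $\omega=\omega(s)$ and $P=P(s)$ are defined over $\mathbb{R}$. The real period is $\Omega^+(s)=\int_{E(\mathbb{R})^\circ}\omega>0$, where $E(\mathbb{R})^\circ$ is the identity component of $E(\mathbb{R})$, oriented so that the integral is positive (if $E$ is $y^2=f(x)$ with $f$ a monic cubic and $\omega=dx/(2y)$, then $\Omega^+=\int_\gamma^\infty dx/\sqrt{f(x)}$ with $\gamma$ the largest real root of $f$). Choose an isomorphism $(E(\mathbb{C}),\omega)\cong(\mathbb{C}/L,du)$, with $L$ a lattice in $\mathbb{C}$ and $u$ the coordinate on $\mathbb{C}$, for which the real structure on $E$ corresponds to complex conjugation, and write $L=\mathbb{Z}v_1+\mathbb{Z}v_2$ with $v_1=\Omega^+(s)$ and $\tau=v_2/v_1$, $\operatorname{Im}\tau>0$. Put $q(s)=e^{2\pi i\tau}$, which is real with $0<|q(s)|<1$. The map $u\mapsto e^{2\pi i u/v_1}$ induces an isomorphism $E(\mathbb{C})\cong\mathbb{C}^\times/q(s)^{\mathbb{Z}}$, and $D_{0,q(s)}(P(s))$ denotes the value of $D_{0,q(s)}$ at the image of $P(s)$ under this isomorphism. *)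

(* Defs.v *)
From mathcomp Require Import all_boot all_order all_algebra.
From mathcomp Require Import all_classical all_reals all_analysis.
From mathcomp Require Import complex.
From mathcomp Require Import -(notations) mpoly.

Set Implicit Arguments.
Unset Strict Implicit.
Unset Printing Implicit Defensive.

Import Order.TTheory GRing.Theory Num.Theory numFieldNormedType.Exports.
Local Open Scope ring_scope.
Local Open Scope complex_scope.
Local Open Scope classical_set_scope.

(* ---- Weierstrass curves, their group law, differentials ---- *)

(* y^2 + a1 x y + a3 y = x^3 + a2 x^2 + a4 x + a6 *)
Record weierstrass (T : Type) :=
  Weierstrass { wa1 : T; wa2 : T; wa3 : T; wa4 : T; wa6 : T }.

Definition wmap (S T : Type) (f : S -> T) (E : weierstrass S) : weierstrass T :=
  Weierstrass (f (wa1 E)) (f (wa2 E)) (f (wa3 E)) (f (wa4 E)) (f (wa6 E)).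

Definition wb2 (K : numFieldType) (E : weierstrass K) : K :=
  wa1 E ^+ 2 + 4 * wa2 E.
Definition wb4 (K : numFieldType) (E : weierstrass K) : K :=
  2 * wa4 E + wa1 E * wa3 E.
Definition wb6 (K : numFieldType) (E : weierstrass K) : K :=
  wa3 E ^+ 2 + 4 * wa6 E.
Definition wb8 (K : numFieldType) (E : weierstrass K) : K :=
  wa1 E ^+ 2 * wa6 E + 4 * wa2 E * wa6 E - wa1 E * wa3 E * wa4 E
  + wa2 E * wa3 E ^+ 2 - wa4 E ^+ 2.
Definition wdisc (K : numFieldType) (E : weierstrass K) : K :=
  - wb2 E ^+ 2 * wb8 E - 8 * wb4 E ^+ 3 - 27 * wb6 E ^+ 2
  + 9 * wb2 E * wb4 E * wb6 E.

(* [None] is the point at infinity. *)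
Definition ecpoint (T : Type) := option (T * T).

Definition on_curve (K : numFieldType) (E : weierstrass K) (P : ecpoint K)
  : Prop :=
  if P is Some (x, y) then
    y ^+ 2 + wa1 E * x * y + wa3 E * y
    = x ^+ 3 + wa2 E * x ^+ 2 + wa4 E * x + wa6 E
  else True.

Definition ecadd (K : numFieldType) (E : weierstrass K) (P Q : ecpoint K)
  : ecpoint K :=
  match P, Q with
  | None, _ => Q
  | _, None => P
  | Some (x1, y1), Some (x2, y2) =>
    if (x1 == x2) && (y1 + y2 + wa1 E * x2 + wa3 E == 0) then None
    else
      let l :=
        if x1 == x2 then
          (3 * x1 ^+ 2 + 2 * wa2 E * x1 + wa4 E - wa1 E * y1)
          / (2 * y1 + wa1 E * x1 + wa3 E)
        else (y2 - y1) / (x2 - x1) in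
      let nu := y1 - l * x1 in
      let x3 := l ^+ 2 + wa1 E * l - wa2 E - x1 - x2 in
      Some (x3, - (l + wa1 E) * x3 - nu - wa3 E)
  end.

Definition ecmul (K : numFieldType) (E : weierstrass K) (m : nat)
  (P : ecpoint K) : ecpoint K := iter m (ecadd E P) None.

Definition has_order (K : numFieldType) (E : weierstrass K) (N : nat)
  (P : ecpoint K) : Prop :=
  [/\ on_curve E P, ecmul E N P = None
    & forall m, (0 < m < N)%N -> ecmul E m P <> None].

(* A triple (E, omega, P), with omega = c dx / (2 y + a1 x + a3), c = [tdiff].
   An elliptic curve over an affine base whose Hodge bundle is trivialised by
   a differential has a global Weierstrass equation, so the families below lose
   no generality. *)
Record triple (T : Type) :=
  Triple { tcurve : weierstrass T; tdiff : T; tpoint : ecpoint T }.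

Definition ecpoint_map (S T : Type) (f : S -> T) : ecpoint S -> ecpoint T :=
  omap (fun p => (f p.1, f p.2)).

Definition good_triple (K : numFieldType) (N : nat) (t : triple K) : Prop :=
  [/\ wdisc (tcurve t) != 0, tdiff t != 0 & has_order (tcurve t) N (tpoint t)].

(* ---- Complex uniformization ---- *)

Definition lattice (R : realType) (v1 v2 : R[i]) : set R[i] :=
  [set u | exists m n : int, u = m%:~R * v1 + n%:~R * v2].

Definition xcoord (K : numFieldType) (P : ecpoint K) : K :=
  if P is Some p then p.1 else 0.
Definition ycoord (K : numFieldType) (P : ecpoint K) : K :=
  if P is Some p then p.2 else 0.

(* complex differentiability at a point of the complex plane *)
Definition holo_at (R : realType) (f : R[i] -> R[i]) (u : R[i]) : Prop :=
  derivable (f : R[i]^o -> R[i]^o) (u : R[i]^o) 1.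

Definition cderive (R : realType) (f : R[i] -> R[i]) (u : R[i]) : R[i] :=
  'D_(1 : R[i]^o) (f : R[i]^o -> R[i]^o) (u : R[i]^o).

(* [phi] induces an isomorphism (C/L, du) -> (E(C), c dx/(2y + a1 x + a3)),
   L = Z v1 + Z v2.  Analyticity at the points of L follows from analyticity
   elsewhere, as [phi] is a homomorphism. *)
Definition uniformizes (R : realType) (E : weierstrass R[i]) (c v1 v2 : R[i])
  (phi : R[i] -> ecpoint R[i]) : Prop :=
  [/\ forall u, on_curve E (phi u),
      forall Q, on_curve E Q -> exists u, phi u = Q,
      forall u u', phi (u + u') = ecadd E (phi u) (phi u'),
      forall u, phi u = None <-> lattice v1 v2 u
    & forall u, ~ lattice v1 v2 u ->
      [/\ holo_at (fun w => xcoord (phi w)) u,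
          holo_at (fun w => ycoord (phi w)) u
        & c * cderive (fun w => xcoord (phi w)) u
          = 2 * ycoord (phi u) + wa1 E * xcoord (phi u) + wa3 E]].

(* ---- The real period and D_{0,q} ---- *)

(* Substituting y -> y - (a1 x + a3)/2 turns the equation into y^2 = f(x) with
   f the monic cubic below, and the differential into c dx/(2y). *)
Definition wcubic (K : numFieldType) (E : weierstrass K) (x : K) : K :=
  x ^+ 3 + wb2 E / 4 * x ^+ 2 + wb4 E / 2 * x + wb6 E / 4.

(* The identity component is traversed twice over x >= gamma, gamma being the
   largest real root, which cancels the factor 1/2 in c dx/(2y). *)
Definition real_period (R : realType) (E : weierstrass R) (c : R) : R :=
  let gamma := sup [set x : R | wcubic E x = 0] in
  `|c| * Rintegral (@lebesgue_measure R) `]gamma, +oo[%classic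
           (fun x => (Num.sqrt (wcubic E x))^-1).

Definition cexp (R : realType) (z : R[i]) : R[i] :=
  let: x +i* y := z in (expR x)%:C * (cos y +i* sin y).

Definition D0 (R : realType) (z : R[i]) : R :=
  if z == 1 then 0 else complex.Im (z / (1 - z)).

(* the sum over n in Z, split into n >= 0 and n < 0 *)
Definition D0q (R : realType) (q z : R[i]) : R :=
  limn (series (fun n : nat => D0 (z * q ^+ n)))
  + limn (series (fun n : nat => D0 (z * q ^- n.+1))).

(* ---- Projective varieties over Q and their rational functions ---- *)

Definition homogeneous (n d : nat) (p : mpoly n rat) : Prop :=
  p \is ishomog1 d (@mdeg n).

Definition evalQ (K : numFieldType) (n : nat) (p : mpoly n rat)
  (v : 'I_n -> K) : K := meval v (map_mpoly ratr p).

Record qvariety (n : nat) := QVariety {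
  equations : seq (mpoly n.+1 rat);
  equations_homogeneous : forall p, p \in equations ->
    exists d, homogeneous d p }.

(* homogeneous coordinates of a K-point *)
Definition kpoint (K : numFieldType) (n : nat) (X : qvariety n)
  (v : 'I_n.+1 -> K) : Prop :=
  (exists i, v i != 0) /\ (forall p, p \in equations X -> evalQ p v = 0).

Definition same_point (K : numFieldType) (n : nat) (v w : 'I_n.+1 -> K)
  : Prop := exists2 a : K, a != 0 & forall i, w i = a * v i.

Definition vanishes_on (R : realType) (n : nat) (X : qvariety n)
  (p : mpoly n.+1 rat) : Prop :=
  forall v : 'I_n.+1 -> R[i], kpoint X v -> evalQ p v = 0.

Definition geom_irreducible (R : realType) (n : nat) (X : qvariety n) : Prop :=
  forall f g : mpoly n.+1 R[i],
    (forall v, kpoint X v -> meval v f * meval v g = 0) ->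
    (forall v, kpoint X v -> meval v f = 0)
    \/ (forall v, kpoint X v -> meval v g = 0).

(* tangent space, at v, of the affine cone over X with its reduced structure *)
Definition cone_tangent (R : realType) (n : nat) (X : qvariety n)
  (v w : 'I_n.+1 -> R[i]) : Prop :=
  forall p, vanishes_on R X p ->
    \sum_(i < n.+1) evalQ (mderiv i p) v * w i = 0.

(* The tangent space of the cone always contains the line spanned by v. *)
Definition smooth_curve (R : realType) (n : nat) (X : qvariety n) : Prop :=
  forall v : 'I_n.+1 -> R[i], kpoint X v ->
    exists w, forall t, cone_tangent X v t ->
      exists a b : R[i], forall i, t i = a * v i + b * w i.

(* A rational function over Q is represented by a quotient of two forms of the
   same degree; [ratfun_eq] is equality in the function field. *)
Record ratfun (R : realType) (n : nat) (X : qvariety n) := RatFun {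
  rnum : mpoly n.+1 rat;
  rden : mpoly n.+1 rat;
  rdeg : nat;
  rnum_homogeneous : homogeneous rdeg rnum;
  rden_homogeneous : homogeneous rdeg rden;
  rden_neq0 : ~ vanishes_on R X rden }.

Definition ratfun_eq (R : realType) (n : nat) (X : qvariety n)
  (f g : ratfun R X) : Prop :=
  vanishes_on R X (rnum f * rden g - rnum g * rden f).

(* f is regular at the K-point v and f(v) = r *)
Definition ratfun_at (R : realType) (n : nat) (X : qvariety n) (f : ratfun R X)
  (K : numFieldType) (v : 'I_n.+1 -> K) (r : K) : Prop :=
  exists g : ratfun R X,
    [/\ ratfun_eq f g, evalQ (rden g) v != 0
      & r = evalQ (rnum g) v / evalQ (rden g) v].

(* ---- Modular curves ---- *)

Definition Gamma1 (N : nat) : set 'M[int]_2 :=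
  [set g | [/\ \det g = 1, (g ord0 ord0 = 1 %[mod N])%Z,
              (g ord_max ord0 = 0 %[mod N])%Z
            & (g ord_max ord_max = 1 %[mod N])%Z]].

Definition moebius (R : realType) (g : 'M[int]_2) (tau : R[i]) : R[i] :=
  ((g ord0 ord0)%:~R * tau + (g ord0 ord_max)%:~R)
  / ((g ord_max ord0)%:~R * tau + (g ord_max ord_max)%:~R).

Definition upper_half (R : realType) : set R[i] :=
  [set tau | 0 < complex.Im tau].

Definition elliptic_point (R : realType) (N : nat) (tau : R[i]) : Prop :=
  exists2 g, Gamma1 N g & [/\ g <> 1, g <> - 1 & moebius g tau = tau].

(* A smooth projective curve over Q whose complex points are Gamma_1(N)\H and
   finitely many cusps; the rational structure is pinned down by
   [universal_family].  [mparam] gives holomorphic homogeneous coordinates of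
   the point of the curve attached to tau. *)
Record modular_curve (R : realType) (N : nat) := ModularCurve {
  mdim : nat;
  mvar : qvariety mdim;
  mparam : R[i] -> 'I_mdim.+1 -> R[i];
  mvar_irreducible : geom_irreducible R mvar;
  mvar_smooth : smooth_curve R mvar;
  mparam_point : forall tau, upper_half tau -> kpoint mvar (mparam tau);
  mparam_holo : forall tau i, upper_half tau ->
    holo_at (fun t => mparam t i) tau;
  mparam_orbits : forall tau tau', upper_half tau -> upper_half tau' ->
    same_point (mparam tau) (mparam tau')
    <-> exists2 g, Gamma1 N g & tau' = moebius g tau;
  mcusps_finite : exists (k : nat) (cusp : 'I_k -> 'I_mdim.+1 -> R[i]),
    forall v, kpoint mvar v ->
      (exists2 tau, upper_half tau & same_point (mparam tau) v)
      \/ (exists j, same_point (cusp j) v) }.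

Arguments mparam {R N} _ _ _.

Definition noncuspidal (R : realType) (N : nat) (X : modular_curve R N)
  (v : 'I_(mdim X).+1 -> R[i]) : Prop :=
  exists2 tau, upper_half tau & same_point (mparam X tau) v.

Arguments noncuspidal {R N} _ _.

(* t is the fibre at the K-point v of the triple F over the function field,
   F having good reduction at v *)
Definition fibre (R : realType) (N : nat) (n : nat) (X : qvariety n)
  (F : triple (ratfun R X)) (K : numFieldType) (v : 'I_n.+1 -> K)
  (t : triple K) : Prop :=
  let at_v (f : ratfun R X) (r : K) := ratfun_at f v r in
  [/\ [/\ at_v (wa1 (tcurve F)) (wa1 (tcurve t)),
          at_v (wa2 (tcurve F)) (wa2 (tcurve t)),
          at_v (wa3 (tcurve F)) (wa3 (tcurve t)),
          at_v (wa4 (tcurve F)) (wa4 (tcurve t))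
        & at_v (wa6 (tcurve F)) (wa6 (tcurve t))],
      at_v (tdiff F) (tdiff t),
      match tpoint F, tpoint t with
      | None, None => True
      | Some (fx, fy), Some (x, y) => at_v fx x /\ at_v fy y
      | _, _ => False
      end
    & good_triple N t].

(* The fibre over the class of tau is (C/(Z + Z tau), 1/N).  A family with this
   property cannot exist around a point where (E, P) has more automorphisms than
   +-1, i.e. around an elliptic point; Gamma_1(N) has some only for N <= 3. *)
Definition universal_family (R : realType) (N : nat) (X : modular_curve R N)
  (F : triple (ratfun R (mvar X))) : Prop :=
  forall tau, upper_half tau -> ~ elliptic_point N tau ->
    exists2 t : triple R[i], fibre N F (mparam X tau) t
      & exists (c : R[i]) (phi : R[i] -> ecpoint R[i]),
          [/\ c != 0, uniformizes (tcurve t) c 1 tau phi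
            & phi (N%:R^-1) = tpoint t].

(* Main.v *)
(* Write the fibre as [C / (Z + Z tau)] and put [z = exp (2 pi i u)].  Up to
   the factor [2 pi], [D_{0,q}(z)] is the real part of the Lambert series [xi],
   an odd function with [xi (u + 1) = xi u] and [xi (u + tau) = xi u - 2 pi i].
   The derivative of [xi] has the same double pole as [- x / c ^ 2] along the
   uniformization, so by Liouville's theorem the two differ by a constant.
   Differentiating the addition law of the curve then gives
     [xi (u + w) = xi u + xi w + (slope (phi u) (phi w) + a1 / 2) / c],
   where [slope] is the slope of the line through the two points.  Summing over
   [w = u, 2 u, ..., (N - 2) u] when [u] has order [N], and using
   [xi ((N - 1) u) = - xi u - 2 pi i n], yields
     [2 pi D_{0,q} / Omega = - (1 / (N c)) sum_k (slope (P) (k P) + a1 / 2)],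
   which is a rational function of the coordinates of the universal triple. *)
Require Import Defs.
From mathcomp Require Import all_boot all_order all_algebra.
From mathcomp Require Import all_classical all_reals all_analysis.
From mathcomp Require Import complex.
From mathcomp Require Import -(notations) mpoly.
From mathcomp Require Import zify ring lra.
Import Order.TTheory GRing.Theory Num.Theory numFieldNormedType.Exports.
Set Implicit Arguments.
Unset Strict Implicit.
Unset Printing Implicit Defensive.
Local Open Scope ring_scope.
Local Open Scope complex_scope.
Local Open Scope classical_set_scope.

(** * Complex differentiability *)

(** Reality is what makes the formula exact. The multiple of [2 pi i] picked up at a torsion point
    is unknown but purely imaginary, whereas at a real point the slopes, [c] and the period are
    real: taking real parts removes the former and keeps the latter. For the answer to be one
    rational function, regular at every point considered, the same formulas must compute [k P] in
    all fibres. Exact order [N] ensures this: [k P] and [P] have different abscissas for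
    [1 < k < N - 1], so the tangent serves only for [2 P], chords serve for all later multiples, and
    no denominator vanishes in a fibre. The analysis uses neither contour integrals nor Laurent
    series, only mean value estimates along segments and a second derivative test. Poles are
    therefore compared through explicit bounds [O(v ^ 2)] instead of expansions. For [N = 1] the
    point is at infinity, where [xi] has a pole; there [D_{0,q}] vanishes because [q] is real. *)

Section Calculus.
Variable K : numFieldType.
Implicit Types (f g : K -> K) (u v w : K).

Definition ccont f u : Prop := {for u, continuous f}.

(* Caratheodory's form of differentiability turns the usual rules into
   continuity statements and ring identities. *)
Definition cder f u (l : K) : Prop :=
  exists g, [/\ forall v, f v = f u + g v * (v - u), ccont g u & g u = l].

Lemma ccontP f u : ccont f u <->
  forall e : K, 0 < e ->
    exists2 d : K, 0 < d & forall v, `|v - u| < d -> `|f v - f u| < e.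
Proof.
split=> [/cvgrPdist_lt h e /h|h].
  move=> /nbhs_ballP[d /= d0 hd]; exists d => // v uv.
  by rewrite distrC; apply: hd; rewrite /ball /= distrC.
apply/(@cvgrPdist_lt K K^o K (nbhs u) _ f (f u)) => e /h[d d0 hd].
apply/nbhs_ballP; exists d => //= v.
by rewrite /ball /= distrC => /hd; rewrite distrC.
Qed.

Lemma ccont_cst k u : ccont (fun=> k) u.
Proof. exact: cst_continuous. Qed.
Lemma ccont_id u : ccont id u.
Proof. by move=> A. Qed.
Lemma ccontD f g u : ccont f u -> ccont g u -> ccont (fun v => f v + g v) u.
Proof. exact: continuousD. Qed.
Lemma ccontN f u : ccont f u -> ccont (fun v => - f v) u.
Proof. exact: continuousN. Qed.
Lemma ccontM f g u : ccont f u -> ccont g u -> ccont (fun v => f v * g v) u.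
Proof. exact: continuousM. Qed.
Lemma ccontV f u : f u != 0 -> ccont f u -> ccont (fun v => (f v)^-1) u.
Proof. exact: continuousV. Qed.
Lemma ccont_comp f g u : ccont f u -> ccont g (f u) -> ccont (fun v => g (f v)) u.
Proof. exact: continuous_comp. Qed.

Lemma ccont_near f g u (d : K) : 0 < d ->
  (forall v, `|v - u| < d -> f v = g v) -> ccont f u -> ccont g u.
Proof.
move=> d0 fg /ccontP cf; apply/ccontP => e /cf[d' d'0 hd].
have uu : f u = g u by apply: fg; rewrite subrr normr0.
have [dd|dd] := real_leP (gtr0_real d0) (gtr0_real d'0).
- exists d => // v uv; rewrite -fg // -uu; apply: hd; exact: lt_le_trans uv dd.
- exists d' => // v uv; rewrite -fg -?uu; first exact: hd.
  exact: lt_trans uv dd.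
Qed.

Lemma cder_eq f u l l' : cder f u l -> l = l' -> cder f u l'.
Proof. by move=> ? <-. Qed.

Lemma cder_ccont f u l : cder f u l -> ccont f u.
Proof.
move=> [g [fE cg _]].
have /(@ccont_near _ f u 1) : ccont (fun v => f u + g v * (v - u)) u.
  apply: ccontD; first exact: ccont_cst.
  apply: ccontM => //; apply: ccontD; [exact: ccont_id|exact: ccont_cst].
by apply=> // v _; rewrite -fE.
Qed.

Lemma cder_cst k u : cder (fun=> k) u 0.
Proof.
by exists (fun=> 0); split=> // [v|]; [rewrite mul0r addr0|exact: ccont_cst].
Qed.

Lemma cder_id u : cder id u 1.
Proof.
by exists (fun=> 1); split=> // [v|]; [rewrite mul1r addrC subrK|exact: ccont_cst].
Qed.

Lemma cderD f g u l m : cder f u l -> cder g u m ->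
  cder (fun v => f v + g v) u (l + m).
Proof.
move=> [a [fE ca <-]] [b [gE cb <-]]; exists (fun v => a v + b v); split=> //.
- by move=> v; rewrite fE gE; ring.
- exact: ccontD.
Qed.

Lemma cderN f u l : cder f u l -> cder (fun v => - f v) u (- l).
Proof.
move=> [a [fE ca <-]]; exists (fun v => - a v); split=> //.
- by move=> v; rewrite fE; ring.
- exact: ccontN.
Qed.

Lemma cderB f g u l m : cder f u l -> cder g u m ->
  cder (fun v => f v - g v) u (l - m).
Proof. by move=> df dg; apply: cderD => //; exact: cderN. Qed.

Lemma cderM f g u l m : cder f u l -> cder g u m ->
  cder (fun v => f v * g v) u (l * g u + f u * m).
Proof.
move=> df dg; have cg := cder_ccont dg.
move: df dg => [a [fE ca <-]] [b [gE cb <-]].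
exists (fun v => a v * g v + f u * b v); split=> //.
- by move=> v; rewrite fE gE; ring.
- by apply: ccontD; apply: ccontM => //; exact: ccont_cst.
Qed.

Lemma cderZ k f u l : cder f u l -> cder (fun v => k * f v) u (k * l).
Proof.
by move=> df; apply: cder_eq (cderM (cder_cst k u) df) _; rewrite mul0r add0r.
Qed.

Lemma cder_comp f g u l m : cder f u l -> cder g (f u) m ->
  cder (fun v => g (f v)) u (m * l).
Proof.
move=> df; have cf := cder_ccont df.
move: df => [a [fE ca <-]] [b [gE cb <-]].
exists (fun v => b (f v) * a v); split=> //.
- by move=> v; rewrite gE -mulrA; congr (_ + _ * _); rewrite fE; ring.
- by apply: ccontM => //; exact: ccont_comp.
Qed.

Lemma cder_inv u : u != 0 -> cder (fun v => v^-1) u (- u ^- 2).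
Proof.
move=> u0.
(* With [0^-1 = 0], the factorisation at [v = 0] forces the value [u ^- 2]. *)
exists (fun v => if v == 0 then u ^- 2 else - (v^-1 * u^-1)); split.
- by move=> v; case: eqVneq => [->|v0]; [rewrite invr0|]; field; rewrite ?u0.
- have : ccont (fun v => - (v^-1 * u^-1)) u.
    apply/ccontN/ccontM; last exact: ccont_cst.
    by apply: (@ccontV id) => //; exact: ccont_id.
  apply: (ccont_near (d := `|u|)); first by rewrite normr_gt0.
  move=> v; case: eqVneq => // ->.
  by rewrite sub0r normrN ltxx.
- by rewrite (negPf u0); field; rewrite u0.
Qed.

Lemma cderV f u l : f u != 0 -> cder f u l ->
  cder (fun v => (f v)^-1) u (- l / f u ^+ 2).
Proof.
move=> fu df; apply: cder_eq (cder_comp df (cder_inv fu)) _.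
by rewrite mulNr mulrC mulNr.
Qed.

Lemma cder_div f g u l m : g u != 0 -> cder f u l -> cder g u m ->
  cder (fun v => f v / g v) u ((l * g u - f u * m) / g u ^+ 2).
Proof.
move=> gu df dg; apply: cder_eq (cderM df (cderV gu dg)) _.
by field; rewrite gu.
Qed.

Lemma cder_shift f u a l : cder f (u + a) l -> cder (fun v => f (v + a)) u l.
Proof.
move=> df; rewrite -[l]mulr1; apply: (@cder_comp (fun v => v + a)) => //.
by apply: cder_eq (cderD (cder_id u) (cder_cst a u)) _; rewrite addr0.
Qed.

Lemma cder_rev f u a l : cder f (a - u) l -> cder (fun v => f (a - v)) u (- l).
Proof.
move=> df; rewrite -mulrN1; apply: (@cder_comp (fun v => a - v)) => //.
by apply: cder_eq (cderB (cder_cst a u) (cder_id u)) _; rewrite sub0r.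
Qed.

Lemma cder_near f g u l (d : K) : 0 < d ->
  (forall v, `|v - u| < d -> f v = g v) -> cder f u l -> cder g u l.
Proof.
move=> d0 fg [a [fE ca <-]].
have uu : f u = g u by apply: fg; rewrite subrr normr0.
(* The factorisation must hold for every [v], so outside the disc the difference quotient of [g]
   takes over. *)
exists (fun v => if `|v - u| < d then a v else (g v - g u) / (v - u)); split.
- move=> v; case: ifPn => [vu|]; first by rewrite -fg // fE uu.
  have [->|vu _] := eqVneq v u; first by rewrite subrr normr0 d0.
  by field; rewrite subr_eq0.
- by apply: ccont_near d0 _ ca => v ->.
- by rewrite subrr normr0 d0.
Qed.

Lemma cderP f u l : cder f u l <->
  forall e : K, 0 < e -> exists2 d : K, 0 < d & forall v, `|v - u| < d ->
    `|f v - f u - l * (v - u)| <= e * `|v - u|.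
Proof.
split=> [[g [fE /ccontP cg <-]] e /cg[d d0 hd]|h].
  exists d => // v vu; rewrite fE (_ : _ - _ - _ = (g v - g u) * (v - u)).
    by rewrite normrM ler_wpM2r // ltW // hd.
  by ring.
exists (fun v => if v == u then l else (f v - f u) / (v - u)); split.
- move=> v; case: eqVneq => [->|vu]; first by rewrite subrr mulr0 addr0.
  by field; rewrite subr_eq0.
- apply/ccontP => e e0.
  have [d d0 hd] := h (e / 2) (divr_gt0 e0 (ltr0n _ 2)).
  exists d => // v vu; rewrite eqxx; case: eqVneq => [_|nvu].
    by rewrite subrr normr0.
  have nz : v - u != 0 by rewrite subr_eq0.
  have np : 0 < `|v - u| by rewrite normr_gt0.
  rewrite -(ltr_pM2r np) -normrM mulrBl divfK //.
  apply: le_lt_trans (hd _ vu) _; rewrite ltr_pM2r //.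
  by rewrite gtr_pMr // invf_lt1 // ltr1n.
- by rewrite eqxx.
Qed.

(** Over an arbitrary [numFieldType], this bridge serves for functions of a real variable and of a
    complex one alike. *)
Lemma cder_isderive f u l : cder f u l <-> is_derive u 1 f l.
Proof.
split=> [/cderP h|[df dv]]; last first.
  have {df} df : (fun h => h^-1 *: ((f \o shift u) (h *: 1) - f u)) @ 0^' --> l.
    by rewrite -dv.
  apply/cderP => e e0; have := (@cvgrPdist_le K K^o K 0^' (dnbhs_filter _) _ _).1 df e e0.
  rewrite near_withinE near_simpl => hn; have [d /= d0 hd] := (nbhs_ballP _ _).1 hn.
  exists d => // v vu.
  have [->|nvu] := eqVneq v u; first by rewrite !subrr mulr0 subr0 normr0 mulr0.
  have nz : v - u != 0 by rewrite subr_eq0.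
  have := hd (v - u); rewrite /ball /= sub0r normrN => /(_ vu nz).
  rewrite [_ *: 1]mulr1 subrK distrC => hh.
  rewrite (_ : _ - _ = ((v - u)^-1 *: (f v - f u) - l) * (v - u)).
    by rewrite normrM ler_wpM2r.
  by rewrite [_ *: _]mulrC mulrBl divfK.
have cv : (fun h => h^-1 *: ((f \o shift u) (h *: 1) - f u)) @ 0^' --> l.
  apply/(@cvgrPdist_le K K^o K 0^' (dnbhs_filter _)) => e e0; have [d d0 hd] := h e e0.
  rewrite near_withinE; apply/nbhs_ballP; exists d => //= t.
  rewrite /ball /= sub0r normrN => td t0.
  have := hd (t + u); rewrite addrK => /(_ td).
  rewrite [t *: 1]mulr1 distrC => hh.
  rewrite -(ler_pM2r (_ : 0 < `|t|)) ?normr_gt0 // -normrM mulrBl.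
  by rewrite [_ *: _]mulrC divfK.
split; first by apply/cvg_ex; exists l.
exact: cvg_lim cv.
Qed.

Lemma cder_unique f u l m : cder f u l -> cder f u m -> l = m.
Proof.
by move=> /cder_isderive[_ <-] /cder_isderive[_ <-].
Qed.

End Calculus.

Notation cn := (@Normc.normc _).
Notation Re := complex.Re.
Notation Im := complex.Im.

(** * The complex modulus and the mean value inequality *)

Section ComplexNorm.
Variable R : realType.
Local Notation C := R[i].
Implicit Types (f g : C -> C) (u v w z : C).

Lemma normrE z : `|z| = (cn z)%:C. Proof. by []. Qed.
Lemma cn_ge0 z : 0 <= cn z. Proof. by case: z => a b; exact: sqrtr_ge0. Qed.
Lemma cnM z w : cn (z * w) = cn z * cn w. Proof. exact: Normc.normcM. Qed.
Lemma cnV z : cn z^-1 = (cn z)^-1. Proof. exact: Normc.normcV. Qed.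
Lemma cn0 : cn (0 : C) = 0. Proof. exact: Normc.normc0. Qed.
Lemma cn1 : cn (1 : C) = 1. Proof. exact: Normc.normc1. Qed.
Lemma cnN z : cn (- z) = cn z. Proof. exact: normcN. Qed.
Lemma cnD z w : cn (z + w) <= cn z + cn w. Proof. exact: le_normcD. Qed.
Lemma cn_eq0 z : (cn z == 0) = (z == 0).
Proof. by apply/eqP/eqP => [/Normc.eq0_normc//|->]; rewrite cn0. Qed.
Lemma cn_gt0 z : (0 < cn z) = (z != 0).
Proof. by rewrite lt_neqAle cn_ge0 andbT eq_sym cn_eq0. Qed.
Lemma cnB z w : cn (z - w) = cn (w - z).
Proof. by rewrite -cnN opprB. Qed.
Lemma cnX z n : cn (z ^+ n) = cn z ^+ n.
Proof. by elim: n => [|n IH]; rewrite ?expr0 ?cn1 // !exprS cnM IH. Qed.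
Lemma cnR (x : R) : cn x%:C = `|x|.
Proof. by rewrite /= expr0n addr0 sqrtr_sqr. Qed.
Lemma cn_nat n : cn (n%:R : C) = n%:R.
Proof. by rewrite -(rmorph_nat (real_complex R)) cnR ger0_norm. Qed.
Lemma cn_sqr z : cn z ^+ 2 = Re z ^+ 2 + Im z ^+ 2.
Proof. by case: z => a b /=; rewrite sqr_sqrtr // addr_ge0 ?sqr_ge0. Qed.
Lemma cn_triB z w : cn z - cn w <= cn (z - w).
Proof. by rewrite lerBlDr -[X in cn X <= _](subrK w); exact: cnD. Qed.
Lemma cn_conj z : cn z^* = cn z.
Proof. by case: z => a b /=; rewrite sqrrN. Qed.

Lemma ReD z w : Re (z + w) = Re z + Re w. Proof. by case: z; case: w. Qed.
Lemma ImD z w : Im (z + w) = Im z + Im w. Proof. by case: z; case: w. Qed.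
Lemma ReN z : Re (- z) = - Re z. Proof. by case: z. Qed.
Lemma ImN z : Im (- z) = - Im z. Proof. by case: z. Qed.
Lemma ReZ (x : R) z : Re (x%:C * z) = x * Re z.
Proof. by case: z => a b /=; rewrite mul0r subr0. Qed.
Lemma ImZ (x : R) z : Im (x%:C * z) = x * Im z.
Proof. by case: z => a b /=; rewrite mul0r addr0. Qed.
Lemma Re_sum n (F : nat -> C) : Re (\sum_(k < n) F k) = \sum_(k < n) Re (F k).
Proof. by elim: n => [|n IH]; rewrite ?big_ord0 // !big_ord_recr ReD IH. Qed.
Lemma Im_sum n (F : nat -> C) : Im (\sum_(k < n) F k) = \sum_(k < n) Im (F k).
Proof. by elim: n => [|n IH]; rewrite ?big_ord0 // !big_ord_recr ImD IH. Qed.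
Lemma cn_sum n (F : nat -> C) : cn (\sum_(k < n) F k) <= \sum_(k < n) cn (F k).
Proof.
elim: n => [|n IH]; first by rewrite !big_ord0 cn0.
by rewrite !big_ord_recr; apply: le_trans (cnD _ _) _; rewrite lerD2r.
Qed.

Lemma Re_le_cn z : `|Re z| <= cn z.
Proof.
rewrite -(@ler_pXn2r _ 2) ?nnegrE ?cn_ge0 // cn_sqr real_normK ?num_real //.
by rewrite lerDl sqr_ge0.
Qed.
Lemma Im_le_cn z : `|Im z| <= cn z.
Proof.
rewrite -(@ler_pXn2r _ 2) ?nnegrE ?cn_ge0 // cn_sqr real_normK ?num_real //.
by rewrite lerDr sqr_ge0.
Qed.
Lemma cn_le_ReIm z : cn z <= `|Re z| + `|Im z|.
Proof.
rewrite -(@ler_pXn2r _ 2) ?nnegrE ?cn_ge0 ?addr_ge0 // cn_sqr sqrrD.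
by rewrite !real_normK ?num_real // lerD2r lerDl mulrn_wge0 // mulr_ge0.
Qed.

Lemma cposP (e : C) : 0 < e -> exists2 x : R, 0 < x & e = x%:C.
Proof.
case: e => a b; rewrite ltcE /= => /andP[/eqP -> a0].
by exists a.
Qed.

Lemma ccontcP f u : ccont f u <->
  forall e : R, 0 < e ->
    exists2 d : R, 0 < d & forall v, cn (v - u) < d -> cn (f v - f u) < e.
Proof.
split=> [/ccontP h e e0|h].
  have [|d /cposP[x x0 ->] hd] := h e%:C; first by rewrite ltcR.
  by exists x => // v vu; have := hd v; rewrite !normrE !ltcR; exact.
apply/ccontP => _ /cposP[e e0 ->]; have [d d0 hd] := h e e0.
by exists d%:C; rewrite ?ltcR // => v; rewrite !normrE !ltcR; exact: hd.
Qed.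

Lemma cdercP f u l : cder f u l <->
  forall e : R, 0 < e -> exists2 d : R, 0 < d &
    forall v, cn (v - u) < d -> cn (f v - f u - l * (v - u)) <= e * cn (v - u).
Proof.
split=> [/cderP h e e0|h].
  have [|d /cposP[x x0 ->] hd] := h e%:C; first by rewrite ltcR.
  exists x => // v vu; have := hd v.
  by rewrite !normrE ltcR -rmorphM lecR; exact.
apply/cderP => _ /cposP[e e0 ->]; have [d d0 hd] := h e e0.
exists d%:C; rewrite ?ltcR // => v.
by rewrite !normrE ltcR -rmorphM lecR; exact: hd.
Qed.

Lemma cder_nearc f g u l (d : R) : 0 < d ->
  (forall v, cn (v - u) < d -> f v = g v) -> cder f u l -> cder g u l.
Proof.
move=> d0 fg; apply: (@cder_near _ _ _ _ _ d%:C); rewrite ?ltcR //.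
by move=> v; rewrite normrE ltcR; exact: fg.
Qed.

(** Restricting to a line and taking a real part reduces complex estimates to one real variable;
    [al] selects the direction in which values are measured. *)
Lemma cder_line f u w (t : R) l (al : C) : cder f (u + t%:C * w) l ->
  is_derive t 1 (fun s : R => Re (al * f (u + s%:C * w))) (Re (al * l * w)).
Proof.
move=> df; apply/cder_isderive/cderP => e e0.
(* The added [1] keeps the denominators positive when [al] or [w] is zero. *)
have K0 : 0 < cn al * cn w + 1 by rewrite ltr_wpDl // mulr_ge0 // cn_ge0.
have W0 : 0 < cn w + 1 by rewrite ltr_wpDl // cn_ge0.
have [d d0 hd] := (cdercP _ _ _).1 df (e / (cn al * cn w + 1)) (divr_gt0 e0 K0).
exists (d / (cn w + 1)); first exact: divr_gt0.
move=> s st.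
rewrite (_ : _ - _ - _ = Re (al * (f (u + s%:C * w) - f (u + t%:C * w)
   - l * (u + s%:C * w - (u + t%:C * w))))); last first.
  rewrite [RHS](_ : _ = Re (al * f (u + s%:C * w) + - (al * f (u + t%:C * w)) +
     - ((s - t)%:C * (al * l * w)))).
    by rewrite !ReD !ReN ReZ [Re _ * _]mulrC.
  by congr Re; rewrite rmorphB; ring.
have sw : u + s%:C * w - (u + t%:C * w) = (s - t)%:C * w by rewrite rmorphB; ring.
apply: le_trans (Re_le_cn _) _; rewrite cnM.
have := hd (u + s%:C * w); rewrite sw cnM cnR => hh.
have /hh {}hh : `|s - t| * cn w < d.
  apply: le_lt_trans (_ : _ <= `|s - t| * (cn w + 1)) _.
    by rewrite ler_wpM2l // lerDl.
  by rewrite -ltr_pdivlMr.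
apply: le_trans (ler_wpM2l (cn_ge0 al) hh) _.
rewrite [X in X <= _](_ : _ = (cn al * cn w) / (cn al * cn w + 1) * (e * `|s - t|)).
  apply: ler_piMl; first by rewrite mulr_ge0 // ltW.
  by rewrite ler_pdivrMr // mul1r lerDl.
by ring.
Qed.

Lemma ccont_line f u w (t : R) (al : C) : ccont f (u + t%:C * w) ->
  {for t, continuous (fun s : R => Re (al * f (u + s%:C * w)))}.
Proof.
move=> cf; apply/ccontP => e e0.
have K0 : 0 < cn al + 1 by rewrite ltr_wpDl // cn_ge0.
have W0 : 0 < cn w + 1 by rewrite ltr_wpDl // cn_ge0.
have [d d0 hd] := (ccontcP _ _).1 cf (e / (cn al + 1)) (divr_gt0 e0 K0).
exists (d / (cn w + 1)); first exact: divr_gt0.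
move=> s st; rewrite -ReN -ReD -mulrBr.
apply: le_lt_trans (Re_le_cn _) _; rewrite cnM.
have /hd hh : cn (u + s%:C * w - (u + t%:C * w)) < d.
  rewrite (_ : _ - _ = (s - t)%:C * w); last by rewrite rmorphB; ring.
  rewrite cnM cnR; apply: le_lt_trans (_ : _ <= `|s - t| * (cn w + 1)) _.
    by rewrite ler_wpM2l // lerDl.
  by rewrite -ltr_pdivlMr.
apply: le_lt_trans (_ : _ <= (cn al + 1) * cn (f (u + s%:C * w) - f (u + t%:C * w))) _.
  by rewrite ler_wpM2r ?cn_ge0 // lerDl.
by rewrite mulrC -ltr_pdivlMr.
Qed.

(** With [al] the conjugate of [f w - f u], the real part of [al * (f w - f u)] is the squared
    modulus, so the real mean value theorem on the segment suffices. Only continuity is asked at the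
    endpoints, which lets a segment start at a puncture. *)
Lemma cmean_value f df u w (M : R) :
  (forall t : R, 0 <= t <= 1 -> ccont f (u + t%:C * (w - u))) ->
  (forall t : R, 0 < t < 1 -> cder f (u + t%:C * (w - u)) (df (u + t%:C * (w - u)))) ->
  (forall t : R, 0 < t < 1 -> cn (df (u + t%:C * (w - u))) <= M) ->
  cn (f w - f u) <= M * cn (w - u).
Proof.
move=> cf hd hM; set al := (f w - f u)^*.
have h01 (x : R) : (x \in `]0, 1[%R) = (0 < x < 1) by rewrite in_itv.
have [s||s] := @MVT R (fun s => Re (al * f (u + s%:C * (w - u))))
   (fun s => Re (al * df (u + s%:C * (w - u)) * (w - u))) 0 1 ltr01.
- by rewrite h01 => /hd ds; exact: cder_line.
- apply: continuous_in_subspaceT => y /set_mem.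
  by rewrite /= in_itv /= => y01; apply: ccont_line; exact: cf.
rewrite h01 => s01; rewrite subr0 mulr1 rmorph0 mul0r addr0 rmorph1 mul1r.
rewrite [u + _]addrC subrK -ReN -ReD -mulrBr mulrC.
rewrite (_ : (f w - f u) * al = (cn (f w - f u) ^+ 2)%:C); last first.
  by rewrite /al -sqr_normc normrE rmorphXn.
rewrite /= => E.
have : cn (f w - f u) * cn (f w - f u) <= cn (f w - f u) * (M * cn (w - u)).
  rewrite -expr2 E; apply: le_trans (ler_norm _) _.
  apply: le_trans (Re_le_cn _) _; rewrite !cnM cn_conj mulrA.
  by rewrite ler_wpM2r ?cn_ge0 // ler_wpM2l ?cn_ge0 // hM.
(* If [f w = f u], the sign of [M] is read off the bound at the midpoint. *)
have [->|nz] := eqVneq (cn (f w - f u)) 0.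
  move=> _; apply: mulr_ge0; rewrite ?cn_ge0 //.
  apply: le_trans (cn_ge0 _) (hM (1 / 2) _); lra.
by rewrite ler_pM2l // lt_neqAle eq_sym nz cn_ge0.
Qed.
End ComplexNorm.

(** * Exceptional points and the maximum principle *)

Section ComplexAnalysis.
Variable R : realType.
Local Notation C := R[i].
Implicit Types (f g : C -> C) (u v w z : C).

(** The mean value inequality for [f v - l * v] bounds the error by [e] times the distance. This
    supplies derivatives at isolated exceptional points. *)
Lemma cder_limit f df u l (d : R) : 0 < d -> ccont f u ->
  (forall v, 0 < cn (v - u) < d -> cder f v (df v)) ->
  (forall e : R, 0 < e -> exists2 r : R, 0 < r &
     forall v, 0 < cn (v - u) < r -> cn (df v - l) <= e) ->
  cder f u l.
Proof.
move=> d0 cf hd hl; apply/cdercP => e /hl[r r0 hr].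
exists (Num.min d r); first by rewrite lt_min d0.
move=> v; rewrite lt_min => /andP[vd vr].
have [->|vu] := eqVneq v u; first by rewrite !subrr mulr0 subr0 cn0 mulr0.
have vu0 : 0 < cn (v - u) by rewrite cn_gt0 subr_eq0.
have pos (t : R) : 0 < t < 1 -> 0 < cn (u + t%:C * (v - u) - u) <= cn (v - u).
  move=> /andP[t0 t1]; rewrite addrAC subrr add0r cnM cnR gtr0_norm // mulr_gt0 //=.
  by rewrite ler_piMl ?cn_ge0 // ltW.
have key w : 0 < cn (w - u) < d -> cder (fun v => f v - l * v) w (df w - l).
  move=> /hd dw; apply: cderB => //.
  by apply: cder_eq (cderZ l (cder_id w)) _; rewrite mulr1.
have := @cmean_value _ (fun v => f v - l * v) (fun v => df v - l) u v e.
rewrite (_ : f v - l * v - (f u - l * u) = f v - f u - l * (v - u)); last by ring.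
apply.
- move=> t /andP[t0 t1]; have [->|tn0] := eqVneq t 0.
    rewrite rmorph0 mul0r addr0.
    exact: (ccontD cf (ccontN (ccontM (@ccont_cst _ l u) (@ccont_id _ u)))).
  apply: cder_ccont (key _ _); rewrite addrAC subrr add0r cnM cnR ger0_norm //.
  have tp : 0 < t by rewrite lt_neqAle eq_sym tn0.
  rewrite mulr_gt0 //=; apply: le_lt_trans vd.
  by rewrite ler_piMl ?cn_ge0.
- move=> t /pos/andP[p1 p2]; apply: key; rewrite p1; exact: le_lt_trans p2 vd.
- move=> t /pos/andP[p1 p2]; apply: hr; rewrite p1; exact: le_lt_trans p2 vr.
Qed.

Lemma cder0_segment f u w :
  (forall t : R, 0 <= t <= 1 -> cder f (u + t%:C * (w - u)) 0) -> f w = f u.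
Proof.
move=> h; apply/eqP; rewrite -subr_eq0 -cn_eq0 eq_le cn_ge0 andbT.
rewrite -[X in _ <= X](mul0r (cn (w - u))).
apply: (@cmean_value _ f (fun=> 0)) => t t01.
- exact: cder_ccont (h t t01).
- by apply: h; case/andP: t01 => /ltW-> /ltW->.
- by rewrite cn0.
Qed.

(** If [b] hit every real number, [[0, 1]] would be countable and hence null, but its measure is
    [1]. *)
Lemma exists_avoid (T : countType) (b : T -> R) : exists t, forall i, b i <> t.
Proof.
apply: contrapT => h.
have cT : countable [set: R].
  apply: sub_countable (countableP [set: T]).
  apply: card_le_trans (card_image_le b [set: T]).
  apply: subset_card_le => t _.
  apply: contrapT => ht; apply: h; exists t => i bi; apply: ht; by exists i.
have : lebesgue_measure (`[0, 1]%classic : set R) = 0%E.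
  by apply: countable_lebesgue_measure0; apply: sub_countable cT; exact: subset_card_le.
rewrite lebesgue_measure_itv /= lte_fin ltr01 oppr0 adde0 => /eqP.
by rewrite eqe oner_eq0.
Qed.

(* Two points outside a countable set are joined by two segments through a
   suitable point of their perpendicular bisector. *)
Lemma cder0_off_countable (T : countType) (D : T -> C) f u w :
  (forall v, (forall i, v <> D i) -> cder f v 0) ->
  (forall i, u <> D i) -> (forall i, w <> D i) -> f u = f w.
Proof.
move=> hd hu hw; have [->//|uw] := eqVneq u w.
have wu0 : w - u != 0 by rewrite subr_eq0 eq_sym.
(* [slope] recovers [t] from any point of a leg other than its start, so each [D i] forbids at most
   one [t] per leg. *)
pose slope (z : C) := Im z / (2 * Re z).
have leg (t s : R) (z : C) : z = s%:C * (1 / 2 +i* t) -> s != 0 -> slope z = t.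
  by move=> -> s0; rewrite /slope /=; field; rewrite s0.
pose b (i : T + T) : R := match i with
  | inl i => slope ((D i - u) / (w - u))
  | inr i => - slope ((D i - w) / (u - w)) end.
have [t ht] := exists_avoid b.
have half : (1 / 2 +i* t) + (1 / 2 +i* (- t)) = 1 :> C.
  by apply/eqP; rewrite eq_complex /=; apply/andP; split; apply/eqP; lra.
pose m := u + (1 / 2 +i* t) * (w - u).
have mE : m = w + (1 / 2 +i* (- t)) * (u - w).
  rewrite /m (_ : (_ +i* (- t)) = 1 - (1 / 2 +i* t)); first by ring.
  by apply/eqP; rewrite eq_sym subr_eq addrC half.
transitivity (f m); apply/esym; [apply: cder0_segment|apply/esym/cder0_segment].
- move=> s /andP[s0 s1]; apply: hd => i E.
  have [sz|sn] := eqVneq s 0; first by apply: (hu i); rewrite -E sz rmorph0 mul0r addr0.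
  apply: (ht (inl i)) => /=; apply: (leg _ s) => //.
  by rewrite -E /m; field.
- move=> s /andP[s0 s1]; apply: hd => i E.
  have [sz|sn] := eqVneq s 0; first by apply: (hw i); rewrite -E sz rmorph0 mul0r addr0.
  apply: (ht (inr i)) => /=; rewrite (leg (- t) s) ?opprK //.
  by rewrite -E mE; field; rewrite -opprB oppr_eq0.
Qed.

(** At an interior maximum [f1] vanishes; were [m] positive, [f1] would be positive just to the
    right of [x] and [f] would increase there. *)
Lemma second_deriv_max (f f1 : R -> R) (m x d : R) : 0 < d ->
  (forall s, `|s - x| < d -> is_derive s 1 f (f1 s)) -> is_derive x 1 f1 m ->
  (forall s, `|s - x| < d -> f s <= f x) -> m <= 0.
Proof.
move=> d0 hf /cder_isderive/cderP hm hmax.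
have inE s : (s \in `]x - d, x + d[%R) = (`|s - x| < d).
  by rewrite in_itv /= ltr_norml; apply/idP/idP => /andP[? ?]; apply/andP; split; lra.
have f1x : f1 x = 0.
  have xd : `|x - x| < d by rewrite subrr normr0.
  have [_ <-] := hf x xd.
  have [|s|||_ ->//] := @derive1_at_max R f (x - d) (x + d) x; first lra.
  - by rewrite inE => /hf[].
  - by rewrite inE.
  - by move=> s; rewrite inE; exact: hmax.
rewrite leNgt; apply/negP => m0.
have [r r0 hr] := hm (m / 2) (divr_gt0 m0 (ltr0n _ 2)).
pose h := Num.min d r / 2.
have mdr : 0 < Num.min d r by rewrite lt_min d0.
have h0 : 0 < h by rewrite divr_gt0.
have /andP[hd hr'] : (h < d) && (h < r) by rewrite -lt_min /h; lra.
have inh s : s \in `]x, (x + h)[%R -> [/\ x < s, `|s - x| < d & `|s - x| < r].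
  by rewrite in_itv /= => /andP[s1 s2]; rewrite ger0_norm; [split|]; lra.
have [|s /inh[_ /hf //]||s /inh[xs _ sr]] := @MVT R f f1 x (x + h); first lra.
- apply: continuous_in_subspaceT => s /set_mem; rewrite /= in_itv /= => /andP[s1 s2].
  have /hf/cder_isderive/cder_ccont // : `|s - x| < d by rewrite ger0_norm; lra.
- move=> E.
  have := hr s sr; rewrite f1x subr0 => /ler_normlP[hs _].
  have : f (x + h) <= f x by apply: hmax; rewrite addrAC subrr add0r gtr0_norm.
  rewrite -subr_le0 E addrAC subrr add0r pmulr_lle0 // => f1s.
  move: hs; rewrite gtr0_norm ?subr_gt0 //; nra.
Qed.

(** Rectangles are compact in [R * R], so continuity is transported there, with the quadratic
    perturbation of the maximum principle built in. *)
Lemma ccont_pair (k : C -> C) (p : R * R) (al : C) (e : R) : ccont k (p.1 +i* p.2) ->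
  {for p, continuous (fun q : R * R => Re (al * k (q.1 +i* q.2)) + e * q.1 ^+ 2)}.
Proof.
move=> ck; apply: continuousD; last first.
  apply: continuousM; first exact: cst_continuous.
  by apply: continuousM; exact: cvg_fst.
apply/cvgrPdist_lt => r r0.
have A0 : 0 < cn al + 1 by rewrite ltr_wpDl // cn_ge0.
have [d d0 hd] := (ccontcP _ _).1 ck (r / (cn al + 1)) (divr_gt0 r0 A0).
have d2 : 0 < d / 2 by rewrite divr_gt0.
exists (ball p.1 (d / 2), ball p.2 (d / 2)) => /=; first by split; exact: nbhsx_ballx.
move=> q [/= q1 q2]; rewrite distrC -ReN -ReD -mulrBr.
have /hd hh : cn ((q.1 +i* q.2) - (p.1 +i* p.2)) < d.
  apply: le_lt_trans (cn_le_ReIm _) _; rewrite /= (splitr d).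
  by apply: ltrD; rewrite distrC.
apply: le_lt_trans (Re_le_cn _) _; rewrite cnM.
apply: le_lt_trans (_ : _ <= (cn al + 1) * cn (k (q.1 +i* q.2) - k (p.1 +i* p.2))) _.
  by rewrite ler_wpM2r ?cn_ge0 // lerDl.
by rewrite mulrC -ltr_pdivlMr.
Qed.

Definition csquare (r : R) u := `|Re u| <= r /\ `|Im u| <= r.
Definition complement_open (D : set C) :=
  forall u, ~ D u -> exists2 d : R, 0 < d & forall v, cn (v - u) < d -> ~ D v.

Lemma cont_max (k : C -> C) (al : C) (e a b c d : R) :
  a <= b -> c <= d -> (forall u, ccont k u) ->
  exists2 p, a <= Re p <= b /\ c <= Im p <= d & forall u,
    a <= Re u <= b -> c <= Im u <= d ->
    Re (al * k u) + e * Re u ^+ 2 <= Re (al * k p) + e * Re p ^+ 2.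
Proof.
move=> ab cd ck.
pose f (q : R * R) : R := Re (al * k (q.1 +i* q.2)) + e * q.1 ^+ 2.
have [] := @compact_EVT_max _ R f (`[a, b]%classic `*` `[c, d]%classic).
- by exists (a, c); split; rewrite /= in_itv /= lexx.
- by apply: compact_setX; exact: segment_compact.
- by apply: continuous_subspaceT => p; exact: ccont_pair.
move=> p /set_mem[/=]; rewrite !in_itv /= => p1 p2 hp.
exists (p.1 +i* p.2) => // u u1 u2.
have := hp (Re u, Im u); rewrite /f /=; case: u u1 u2 => x y /= u1 u2; apply.
by apply: mem_set; split; rewrite /= in_itv.
Qed.

(* The summand [e * Re u ^+ 2] makes the Laplacian of a harmonic function
   positive, which an interior maximum forbids. *)
Lemma weak_max (D : set C) (k k1 k2 : C -> C) (al : C) (r m : R) :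
  0 <= r -> 0 <= m -> complement_open D -> (forall u, ccont k u) ->
  (forall u, D u -> k u = 0) ->
  (forall u, ~ D u -> cder k u (k1 u)) -> (forall u, ~ D u -> cder k1 u (k2 u)) ->
  (forall u, `|Re u| = r \/ `|Im u| = r -> csquare r u -> Re (al * k u) <= m) ->
  forall u, csquare r u -> Re (al * k u) <= m.
Proof.
move=> r0 m0 oD ck kD dk dk1 hm u [u1 u2].
suff H (e : R) : 0 < e -> Re (al * k u) <= m + e * r ^+ 2.
  apply/ler_addgt0Pr => e e0.
  have r1 : 0 < r ^+ 2 + 1 by rewrite ltr_wpDl // sqr_ge0.
  apply: le_trans (H (e / (r ^+ 2 + 1)) (divr_gt0 e0 r1)) _.
  by rewrite lerD2l mulrAC ler_pdivrMr // ler_pM2l // lerDl.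
move=> e0.
have rr : - r <= r by lra.
have [p [hp1 hp2] hmax] := @cont_max k al e _ _ _ _ rr rr ck.
have sq x : `|x| <= r -> e * x ^+ 2 <= e * r ^+ 2.
  move=> xr; rewrite ler_pM2l // -[x ^+ 2]real_normK ?num_real //.
  by rewrite ler_pXn2r // nnegrE.
have := hmax u; rewrite -!ler_norml => /(_ u1 u2) hu.
rewrite -!ler_norml in hp1 hp2.
suff pm : Re (al * k p) <= m.
  apply: le_trans (_ : _ <= Re (al * k u) + e * Re u ^+ 2) _.
    by rewrite lerDl mulr_ge0 ?sqr_ge0 // ltW.
  by apply: le_trans hu _; apply: lerD => //; exact: sq.
(* On [D], where [k] is only known to be continuous, the value [0] is already at most [m]. *)
have [Dp|nDp] := pselect (D p); first by rewrite kD // mulr0.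
have [b1|n1] := eqVneq `|Re p| r; first by apply: hm => //; left.
have [b2|n2] := eqVneq `|Im p| r; first by apply: hm => //; right.
exfalso.
have p1 : `|Re p| < r by rewrite lt_neqAle n1.
have p2 : `|Im p| < r by rewrite lt_neqAle n2.
have [d d0 hd] := oD p nDp.
pose d' := Num.min d (Num.min (r - `|Re p|) (r - `|Im p|)).
have d'0 : 0 < d' by rewrite !lt_min d0 !subr_gt0 p1.
have test (w : C) : cn w = 1 -> Re (al * k2 p * w * w) + 2 * e * Re w ^+ 2 <= 0.
  move=> w1.
  have loc s : `|s - 0| < d' -> [/\ ~ D (p + s%:C * w),
      `|Re (p + s%:C * w)| <= r & `|Im (p + s%:C * w)| <= r].
    rewrite subr0 !lt_min => /and3P[s1 s2 s3].
    have hs : cn (s%:C * w) = `|s| by rewrite cnM cnR w1 mulr1.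
    split; first by apply: hd; rewrite addrAC subrr add0r hs.
    - rewrite ReD; apply: le_trans (ler_normD _ _) _; rewrite -lerBrDl ltW //.
      by apply: le_lt_trans (Re_le_cn _) _; rewrite hs.
    - rewrite ImD; apply: le_trans (ler_normD _ _) _; rewrite -lerBrDl ltW //.
      by apply: le_lt_trans (Im_le_cn _) _; rewrite hs.
  have E s : Re (p + s%:C * w) = Re p + s * Re w by rewrite ReD ReZ.
  pose g s := Re (al * k (p + s%:C * w)) + e * Re (p + s%:C * w) ^+ 2.
  pose g1 s := Re (al * k1 (p + s%:C * w) * w) + e * (2 * (Re p + s * Re w) * Re w).
  apply: (@second_deriv_max g g1 _ 0 d') => //.
  - move=> s /loc[sD _ _]; rewrite /g /g1.
    apply/cder_isderive/cderD; first exact/cder_isderive/cder_line/dk.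
    apply: cderZ.
    have -> : (fun s => Re (p + s%:C * w) ^+ 2) =
        (fun s => (Re p + s * Re w) * (Re p + s * Re w)).
      by apply/funext => x; rewrite E expr2.
    have h : cder (fun s => Re p + s * Re w) s (Re w).
      apply: cder_eq (cderD (cder_cst _ _) (cderM (cder_id s) (cder_cst _ _))) _.
      by ring.
    by apply: cder_eq (cderM h h) _; ring.
  - apply/cder_isderive; rewrite /g1; apply: cderD; last first.
      have -> : 2 * e * Re w ^+ 2 = e * (2 * Re w * Re w) by ring.
      apply: cderZ.
      have h : cder (fun s => Re p + s * Re w) 0 (Re w).
        apply: cder_eq (cderD (cder_cst _ _) (cderM (cder_id (0 : R)) (cder_cst _ _))) _.
        by ring.
      by apply: cder_eq (cderM (cderM (cder_cst _ _) h) (cder_cst _ _)) _; ring.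
    have -> : (fun s : R => Re (al * k1 (p + s%:C * w) * w)) =
        (fun s : R => Re (al * w * k1 (p + s%:C * w))).
      by apply/funext => s; congr Re; ring.
    have -> : al * k2 p * w * w = al * w * k2 p * w by ring.
    apply/cder_isderive/cder_line; rewrite rmorph0 mul0r addr0; exact: dk1.
  - move=> s /loc[_ s1 s2]; rewrite /g rmorph0 mul0r addr0.
    by apply: hmax; rewrite -ler_norml.
(* The directions [1] and ['i] give opposite holomorphic terms, so the two tests add up to
   [2 * e <= 0]. *)
have ci : cn ('i%C : C) = 1 by rewrite /= expr0n expr1n add0r sqrtr1.
have := test _ ci; rewrite -mulrA -expr2 sqr_i mulrN1 ReN (_ : Re 'i%C = 0) //.
have := test 1 (cn1 R); rewrite !mulr1 (_ : Re 1 = 1) // expr1n mulr1.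
rewrite expr0n mulr0 addr0; lra.
Qed.

End ComplexAnalysis.

(** * Liouville's theorem on a complex torus *)

Section Torus.
Variables (R : realType) (tau : R[i]).
Hypothesis tau_gt0 : 0 < Im tau.
Local Notation C := R[i].
Local Notation L := (lattice 1 tau).
Implicit Types (f g : C -> C) (u v w p : C).

Lemma lattice0 : L 0.
Proof. by exists 0, 0; rewrite !mul0r addr0. Qed.
Lemma lattice1 : L 1.
Proof. by exists 1, 0; rewrite mul0r addr0 mulr1. Qed.
Lemma lattice_tau : L tau.
Proof. by exists 0, 1; rewrite mul0r add0r mul1r. Qed.
Lemma latticeD u v : L u -> L v -> L (u + v).
Proof.
move=> [m [n ->]] [m' [n' ->]]; exists (m + m'), (n + n').
by rewrite !rmorphD; ring.
Qed.
Lemma latticeN u : L u -> L (- u).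
Proof. by move=> [m [n ->]]; exists (- m), (- n); rewrite !rmorphN; ring. Qed.
Lemma latticeNE u : L (- u) <-> L u.
Proof. by split=> /latticeN //; rewrite opprK. Qed.
Lemma latticeDr u p : L p -> L (u + p) <-> L u.
Proof.
move=> Lp; split=> [h|h]; last exact: latticeD.
by rewrite -(addrK p u); apply: latticeD => //; exact: latticeN.
Qed.

Lemma lattice_ReIm (m n : int) :
  Re (m%:~R * 1 + n%:~R * tau) = m%:~R + n%:~R * Re tau /\
  Im (m%:~R * 1 + n%:~R * tau) = n%:~R * Im tau.
Proof.
rewrite -!(rmorph_int (real_complex R)) ReD ImD !ReZ !ImZ /=.
by rewrite mulr1 mulr0 add0r.
Qed.

(** Points with [n != 0] have height at least [Im tau] in absolute value; those with [n = 0] are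
    integers. *)
Lemma lattice_separated : exists2 r : R, 0 < r & forall p, L p -> p != 0 -> r <= cn p.
Proof.
exists (Num.min 1 (Im tau)); first by rewrite lt_min ltr01.
move=> _ [m [n ->]] nz; have [rE iE] := lattice_ReIm m n.
have int1 (k : int) : k != 0 -> 1 <= `|k%:~R : R|.
  move=> k0; rewrite -intr_norm -[1]/(1%:~R) ler_int.
  by rewrite -gtz0_ge1 normr_gt0.
have [n0|n0] := eqVneq n 0.
  rewrite ge_min; apply/orP; left; apply: le_trans (Re_le_cn _).
  rewrite rE n0 mul0r addr0; apply: int1.
  by apply: contraNneq nz => ->; rewrite n0 !mul0r addr0.
rewrite ge_min; apply/orP; right; apply: le_trans (Im_le_cn _).
by rewrite iE normrM (gtr0_norm tau_gt0) ler_pMl // int1.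
Qed.

(** Within half the separation of [u] there is at most one lattice point other than [u]; its
    distance, if it exists, is the radius. *)
Lemma lattice_discrete u :
  exists2 d : R, 0 < d & forall v, 0 < cn (v - u) < d -> ~ L v.
Proof.
have [r r0 hr] := lattice_separated.
have r2 : 0 < r / 2 by rewrite divr_gt0.
have [[p [Lp pu]]|no] := pselect (exists p, L p /\ 0 < cn (p - u) < r / 2); last first.
  by exists (r / 2) => // v vu Lv; apply: no; exists v.
have [p1 p2] := andP pu; exists (cn (p - u)) => // v /andP[v1 v2] Lv.
have [vp|vp] := eqVneq v p; first by move: v2; rewrite vp ltxx.
have := hr (v - p) (latticeD Lv (latticeN Lp)); rewrite subr_eq0 => /(_ vp).
rewrite leNgt => /negP; apply.
rewrite (_ : v - p = (v - u) - (p - u)); last by ring.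
apply: le_lt_trans (cnD _ _) _; rewrite cnN (splitr r); apply: ltrD => //.
exact: lt_trans p2.
Qed.

Lemma lattice_complement_open : complement_open L.
Proof.
move=> u Lu; have [d d0 hd] := lattice_discrete u; exists d => // v vu.
have [->//|nvu] := eqVneq v u.
by apply: hd; rewrite vu cn_gt0 subr_eq0 nvu.
Qed.

(** The fundamental domain is an upright rectangle instead of the period parallelogram, which is the
    shape that [cont_max] handles. *)
Lemma lattice_reduce u :
  exists2 p, L p & 0 <= Re (u - p) <= 1 /\ 0 <= Im (u - p) <= Im tau.
Proof.
pose n := Num.floor (Im u / Im tau); pose m := Num.floor (Re u - n%:~R * Re tau).
exists (m%:~R * 1 + n%:~R * tau); first by exists m, n.
have [rE iE] := lattice_ReIm m n; rewrite ReD ImD ReN ImN rE iE.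
have := floor_le (Re u - n%:~R * Re tau).
have := floorD1_gt (Re u - n%:~R * Re tau).
have := floor_le (Im u / Im tau); rewrite ler_pdivlMr // -/n.
have := floorD1_gt (Im u / Im tau); rewrite ltr_pdivrMr // -/n -/m.
rewrite !rmorphD /= mulrDl mul1r => h1 h2 h3 h4.
by split; apply/andP; split; lra.
Qed.

Lemma lattice_periodic (T : Type) (f : C -> T) :
  (forall u, ~ L u -> f (u + 1) = f u) -> (forall u, ~ L u -> f (u + tau) = f u) ->
  forall u p, ~ L u -> L p -> f (u + p) = f u.
Proof.
have gen (q : C) : L q -> (forall u, ~ L u -> f (u + q) = f u) ->
    forall (m : int) u, ~ L u -> f (u + m%:~R * q) = f u.
  move=> Lq fq.
  have Lm (n : nat) : L (n%:R * q).
    by elim: n => [|n IH]; rewrite ?mul0r ?mulrSr ?mulrDl ?mul1r;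
       [exact: lattice0|exact: latticeD].
  have nat_case (n : nat) u : ~ L u -> f (u + n%:R * q) = f u.
    elim: n u => [|n IH] u Lu; first by rewrite mul0r addr0.
    rewrite mulrSr mulrDl mul1r addrA fq ?IH //.
    by move/(latticeDr _ (Lm n)).
  move=> m u Lu; case: m => n; first exact: nat_case.
  rewrite NegzE rmorphN /= mulNr.
  rewrite -[LHS](nat_case n.+1) ?subrK //.
  by move/(latticeDr _ (latticeN (Lm n.+1))).
move=> f1 ft u _ Lu [m [n ->]]; rewrite addrA.
have L1 : L (m%:~R * 1) by exists m, 0; rewrite mul0r addr0.
rewrite (gen tau) //; [exact: gen lattice1 _ _ _ _|exact: lattice_tau|].
by move/(latticeDr _ L1).
Qed.

(* Since [h - h0] vanishes to second order on the lattice, [(h - h0) / u]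
   extends by zero across it; the maximum principle on squares of growing size
   [r] bounds this quotient by [O(1 / r)]. *)
Lemma torus_liouville (h h1 h2 : C -> C) (h0 : C) :
  (forall u p, ~ L u -> L p -> h (u + p) = h u) ->
  (forall u, ~ L u -> cder h u (h1 u)) -> (forall u, ~ L u -> cder h1 u (h2 u)) ->
  (forall e : R, 0 < e -> exists2 d : R, 0 < d &
     forall v, 0 < cn v < d -> cn (h v - h0) <= e * cn v) ->
  forall u, ~ L u -> h u = h0.
Proof.
move=> hper dh dh1 hlim.
pose H u := if `[< L u >] then 0 else h u - h0.
have HL u : L u -> H u = 0 by move=> Lu; rewrite /H asboolT.
have HnL u : ~ L u -> H u = h u - h0 by move=> Lu; rewrite /H asboolF.
have Hper u p : L p -> H (u + p) = H u.
  move=> Lp; have [Lu|Lu] := pselect (L u).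
    by rewrite !HL //; exact: latticeD.
  by rewrite !HnL ?hper // => /(latticeDr _ Lp).
have Hder u : ~ L u -> cder H u (h1 u).
  move=> Lu; have [d d0 hd] := lattice_complement_open Lu.
  apply: (@cder_nearc _ (fun v => h v - h0) _ _ _ d) => // [v /hd Lv|].
    by rewrite HnL.
  by apply: cder_eq (cderB (dh u Lu) (cder_cst _ _)) _; rewrite subr0.
have HderL p : L p -> cder H p 0.
  move=> Lp; apply/cdercP => e e0; have [d d0 hd] := hlim e e0; exists d => // v vp.
  rewrite (HL p) // mul0r !subr0; have [Lv|Lv] := pselect (L v).
    by rewrite HL // cn0 mulr_ge0 ?cn_ge0 // ltW.
  rewrite HnL // -[v in h v](subrK p) hper //; last first.
    by move/(latticeDr _ Lp); rewrite subrK.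
  apply: hd; rewrite vp cn_gt0 subr_eq0 andbT.
  by apply: contra_notN Lv => /eqP ->.
have Hcont u : ccont H u.
  by have [/HderL|/Hder] := pselect (L u); exact: cder_ccont.
have [M M0 HM] : exists2 M : R, 0 <= M & forall u, cn (H u) <= M.
  (* Used with [al] equal to [1], [-1], ['i] and [- 'i], this bounds the real and imaginary parts
     from both sides. *)
  have bnd (al : C) : exists M : R, forall u, Re (al * H u) <= M.
    have [p [_ _] hp] := @cont_max _ H al 0 0 1 0 (Im tau) ler01 (ltW tau_gt0) Hcont.
    exists (Re (al * H p)) => u; have [q Lq [q1 q2]] := lattice_reduce u.
    rewrite -(subrK q u) Hper //; have := hp (u - q) q1 q2.
    by rewrite !mul0r !addr0.
  have [a ha] := bnd 1; have [b hb] := bnd (-1).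
  have [c hc] := bnd 'i%C; have [d hd] := bnd (- 'i%C).
  have HM u : cn (H u) <= Num.max a b + Num.max c d.
    apply: le_trans (cn_le_ReIm _) _; apply: lerD; rewrite ler_norml lerNl !le_max.
    - have := ha u; have := hb u; rewrite mul1r mulN1r ReN => -> ->.
      by rewrite orbT.
    - have := hc u; have := hd u; rewrite mulNr ReN mulrC ReiNIm opprK => -> ->.
      by rewrite orbT.
  by exists (Num.max a b + Num.max c d) => //; apply: le_trans (HM 0); exact: cn_ge0.
pose k u := H u / u.
have kL u : L u -> k u = 0 by move=> Lu; rewrite /k HL // mul0r.
have nz u : ~ L u -> u != 0.
  by move=> Lu; apply: contra_notN Lu => /eqP ->; exact: lattice0.
have kcont u : ccont k u.
  have [->|u0] := eqVneq u 0; last first.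
    apply: ccontM => //; apply: (@ccontV _ id) => //; exact: ccont_id.
  have Hlim := (cdercP _ _ _).1 (HderL 0 lattice0).
  apply/ccontcP => e e0; have [d d0 hd] := Hlim (e / 2) (divr_gt0 e0 (ltr0n _ 2)).
  exists d => // v /hd; rewrite (kL 0 lattice0) (HL 0 lattice0) mul0r !subr0.
  have [->|v0] := eqVneq v 0; first by rewrite /k invr0 mulr0 cn0.
  rewrite -ler_pdivrMr ?cn_gt0 // -cnV -cnM => hh.
  by apply: le_lt_trans hh _; lra.
pose k1 u := (h1 u * u - H u) / u ^+ 2.
pose k2 u := ((h2 u * u + h1 u * 1 - h1 u) * u ^+ 2 -
              (h1 u * u - H u) * (1 * u + u * 1)) / (u ^+ 2) ^+ 2.
have dk u : ~ L u -> cder k u (k1 u).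
  move=> Lu; apply: cder_eq (cder_div (nz _ Lu) (Hder _ Lu) (cder_id u)) _.
  by rewrite mulr1.
have dk1 u : ~ L u -> cder k1 u (k2 u).
  move=> Lu; apply: cder_div; first by rewrite expf_neq0 ?nz.
    apply: cderB; [apply: cderM|exact: Hder]; [exact: dh1|exact: cder_id].
  have -> : (fun v : C => v ^+ 2) = (fun v => v * v) by [].
  by apply: cderM; exact: cder_id.
move=> u Lu; apply/eqP; rewrite -subr_eq0 -HnL //.
have -> : H u = k u * u by rewrite divfK ?nz.
rewrite mulf_eq0; apply/orP; left; rewrite -cn_eq0.
apply: contraT => ku; have ku0 : 0 < cn (k u) by rewrite lt_neqAle eq_sym ku cn_ge0.
(* Large enough for the square to contain [u] and for [M / r < cn (k u)], which the maximum
   principle refutes. *)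
pose r := `|Re u| + `|Im u| + M / cn (k u) + 1.
have Mk : 0 <= M / cn (k u) by rewrite divr_ge0 // ltW.
have r0 : 0 < r by rewrite /r; have := normr_ge0 (Re u); have := normr_ge0 (Im u); lra.
have := @weak_max _ L k k1 k2 (k u)^* r (cn (k u) * (M / r)) (ltW r0).
have Mr : 0 <= M / r by rewrite divr_ge0 // ltW.
move/(_ _ lattice_complement_open kcont kL dk dk1) => wm.
have := wm _ _ u; rewrite mulr_ge0 ?cn_ge0 // => {}wm.
have : Re ((k u)^* * k u) <= cn (k u) * (M / r).
  apply: wm => // [v bv _|]; last first.
    rewrite /csquare /r; have := normr_ge0 (Re u); have := normr_ge0 (Im u).
    by split; lra.
  apply: le_trans (ler_norm _) _; apply: le_trans (Re_le_cn _) _.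
  rewrite cnM cn_conj ler_wpM2l ?cn_ge0 // cnM cnV.
  have rv : r <= cn v.
    by case: bv => <-; [exact: Re_le_cn|exact: Im_le_cn].
  have v0 : 0 < cn v by exact: lt_le_trans rv.
  by apply: ler_pM; rewrite ?cn_ge0 ?invr_ge0 ?cn_ge0 // lef_pV2.
rewrite mulrC -sqr_normc normrE -rmorphXn /= expr2 ler_pM2l //.
rewrite ler_pdivlMr // mulrC -ler_pdivlMr //.
by rewrite /r; have := normr_ge0 (Re u); have := normr_ge0 (Im u); lra.
Qed.

End Torus.

(** * The exponential and Lambert series *)

Section Exponential.
Variable R : realType.
Local Notation C := R[i].
Implicit Types (u v w z : C).

Lemma cexpD z w : cexp (z + w) = cexp z * cexp w.
Proof.
case: z w => a b [c d]; apply/eqP; rewrite eq_complex /=.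
by rewrite expRD cosD sinD; apply/andP; split; apply/eqP; ring.
Qed.

Lemma cexp0 : cexp (0 : C) = 1.
Proof.
by rewrite (_ : 0 = 0 +i* 0) // /cexp expR0 cos0 sin0 mul1r.
Qed.

Lemma cn_cexp z : cn (cexp z) = expR (Re z).
Proof.
case: z => a b; rewrite /cexp cnM cnR gtr0_norm ?expR_gt0 //=.
by rewrite cos2Dsin2 sqrtr1 mulr1.
Qed.

Lemma cexp_neq0 z : cexp z != 0.
Proof. by rewrite -cn_eq0 cn_cexp expR_eq0. Qed.

Lemma cexpN z : cexp (- z) = (cexp z)^-1.
Proof.
apply: (mulIf (cexp_neq0 z)).
by rewrite -cexpD addNr cexp0 mulVf ?cexp_neq0.
Qed.

Lemma cder_cexp z : cder (@cexp R) z (cexp z).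
Proof.
suff cder0 : cder (@cexp R) 0 1.
  apply: (@cder_near _ (fun v => cexp z * cexp (v - z)) _ _ _ 1) => // [v _|].
    by rewrite -cexpD addrC subrK.
  rewrite -[X in cder _ _ X]mulr1; apply: cderZ; apply: cder_shift.
  by rewrite subrr.
have De := (cder_isderive _ _ _).2 (is_derive_expR (0 : R)).
have Dc := (cder_isderive _ _ _).2 (is_derive_cos (0 : R)).
have Ds := (cder_isderive _ _ _).2 (is_derive_sin (0 : R)).
rewrite expR0 in De; rewrite sin0 oppr0 in Dc; rewrite cos0 in Ds.
apply/cdercP => e e0.
(* The remainders below cost [h * r], [4 * h * r] and [h * r], hence the [6]. *)
pose h := Num.min (e / 6) 1.
have h0 : 0 < h by rewrite lt_min ltr01 divr_gt0.
have [d1 d10 H1] := (cderP _ _ _).1 De h h0.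
have [d2 d20 H2] := (cderP _ _ _).1 Dc h h0.
have [d3 d30 H3] := (cderP _ _ _).1 Ds h h0.
exists (Num.min (Num.min d1 d2) (Num.min d3 h)).
  by rewrite !lt_min d10 d20 d30 divr_gt0 ?ltr01.
move=> v; rewrite cexp0 !subr0 mul1r !lt_min => /andP[/andP[]] + + /andP[].
case: v => x y; set r := cn _ => v1 v2 v3 v46.
have v4 : r < h by rewrite lt_min.
have xr : `|x| <= r := Re_le_cn (x +i* y).
have yr : `|y| <= r := Im_le_cn (x +i* y).
have {H1} := H1 x; have {H2} := H2 y; have {H3} := H3 y.
rewrite !subr0 expR0 cos0 sin0 !mul1r mul0r !subr0.
move=> /(_ (le_lt_trans yr v3)) H3 /(_ (le_lt_trans yr v2)) H2.
move=> /(_ (le_lt_trans xr v1)) H1.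
pose c : C := cos y +i* sin y; pose d : C := (cos y - 1) +i* (sin y - y).
(* This splitting leaves only the real first-order remainders of [expR], [cos] and [sin] and a
   product [x * y]. *)
rewrite (_ : cexp _ - 1 - _ =
    (expR x - 1 - x)%:C * c + (1 + x)%:C * d + (x * y)%:C * 'i%C); last first.
  apply/eqP; rewrite eq_complex /=.
  by apply/andP; split; apply/eqP; ring.
have c1 : cn c = 1 by rewrite /= cos2Dsin2 sqrtr1.
have d1' : cn d <= h * r + h * r.
  apply: le_trans (cn_le_ReIm _) _; apply: lerD => /=.
  - by apply: le_trans H2 _; rewrite ler_pM2l.
  - by apply: le_trans H3 _; rewrite ler_pM2l.
have i1 : cn ('i%C : C) = 1 by rewrite /= expr0n expr1n add0r sqrtr1.
have hh1 : h <= 1 by rewrite ge_min lexx orbT.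
have he : h <= e / 6 by rewrite ge_min lexx.
have r0 : 0 <= r by exact: cn_ge0.
apply: le_trans (cnD _ _) _; rewrite [X in _ + X]cnM i1 mulr1 cnR normrM.
apply: le_trans (_ : _ <= (h * r + 2 * (h * r + h * r)) + h * r) _; last by nra.
apply: lerD; first last.
  by apply: ler_pM => //; apply: ltW; apply: le_lt_trans xr _.
apply: le_trans (cnD _ _) _; apply: lerD; rewrite cnM cnR.
  by rewrite c1 mulr1; apply: le_trans H1 _; rewrite ler_pM2l.
apply: ler_pM; rewrite ?cn_ge0 //.
apply: le_trans (ler_normD _ _) _; rewrite normr1.
have := ltW (le_lt_trans xr v4); lra.
Qed.

Definition tpi : C := 0 +i* (2 * pi).
Definition ez u := cexp (tpi * u).
(** Equal to [(i cot (pi u) - 1) / 2]; its imaginary part is the summand [D0] at [ez u]. *)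
Definition al u := ez u / (1 - ez u).

Lemma tpi_neq0 : tpi != 0.
Proof. by rewrite eq_complex /= negb_and orbC mulf_neq0 // gt_eqF ?pi_gt0. Qed.

Lemma ezD u v : ez (u + v) = ez u * ez v.
Proof. by rewrite /ez mulrDr cexpD. Qed.
Lemma ez0 : ez 0 = 1. Proof. by rewrite /ez mulr0 cexp0. Qed.
Lemma ezN u : ez (- u) = (ez u)^-1.
Proof. by rewrite /ez mulrN cexpN. Qed.
Lemma ez_neq0 u : ez u != 0. Proof. exact: cexp_neq0. Qed.
Lemma ez1 : ez 1 = 1.
Proof.
rewrite /ez mulr1 /tpi /cexp expR0 mulr_natl cos_mulr2n sin_mulr2n cospi sinpi.
apply/eqP; rewrite eq_complex /=; apply/andP; split; apply/eqP; ring.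
Qed.
Lemma ezX u n : ez (n%:R * u) = ez u ^+ n.
Proof.
by elim: n => [|n IH]; rewrite ?mul0r ?ez0 // mulrSr mulrDl mul1r ezD IH exprSr.
Qed.
Lemma ez_int (m : int) : ez m%:~R = 1.
Proof.
have nat_case (n : nat) : ez n%:R = 1 by rewrite -[n%:R]mulr1 ezX ez1 expr1n.
by case: m => n; rewrite ?NegzE ?rmorphN ?ezN /= nat_case ?invr1.
Qed.
Lemma cn_ez u : cn (ez u) = expR (- (2 * pi * Im u)).
Proof. by rewrite cn_cexp; case: u => a b /=; rewrite mul0r sub0r. Qed.
Lemma ezD1 u : ez (u + 1) = ez u. Proof. by rewrite ezD ez1 mulr1. Qed.

(** The modulus forces [u] to be real. Its fractional part [t] satisfies [cos (2 pi t) = 1], which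
    is impossible for [0 < t < 1] because [sin (pi t) > 0]. *)
Lemma ez_eq1 u : ez u = 1 -> exists m : int, u = m%:~R.
Proof.
move=> E; have := cn_ez u; rewrite E cn1 -expR0 => /expR_inj/esym/eqP.
rewrite oppr_eq0 mulf_eq0 gt_eqF ?mulr_gt0 ?pi_gt0 //= => /eqP Iu.
pose m := Num.floor (Re u); exists m.
have : ez (u - m%:~R) = 1 by rewrite ezD ezN ez_int E invr1 mulr1.
have uE : u - m%:~R = (Re u - m%:~R)%:C.
  rewrite rmorphB rmorph_int; congr (_ - _).
  by apply/eqP; rewrite eq_complex /= Iu !eqxx.
have t0 := floor_le (Re u); have t1 := floorD1_gt (Re u).
rewrite -/m rmorphD /= in t0 t1.
move=> E1; apply/eqP; rewrite -subr_eq0 uE; move: E1; rewrite uE.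
set t := Re u - m%:~R; have : 0 <= t < 1 by rewrite /t; lra.
move=> /andP[]; rewrite le_eqVlt => /orP[/eqP <-//|tp tl] E1.
exfalso; have : cos (2 * pi * t) = 1.
  have tt : tpi * t%:C = 0 +i* (2 * pi * t).
    by apply/eqP; rewrite eq_complex /=; apply/andP; split; apply/eqP; ring.
  by move: E1; rewrite /ez tt /cexp expR0 mul1r => -[].
have sp : 0 < sin (pi * t).
  by rewrite sin_gt0_pi // mulr_gt0 ?pi_gt0 //= gtr_pMr // pi_gt0.
rewrite -mulrA mulr_natl cos_mulr2n => c1.
have := cos2Dsin2 (pi * t); nra.
Qed.

Lemma cder_ez u : cder ez u (tpi * ez u).
Proof.
rewrite mulrC; apply: (@cder_comp _ (fun v => tpi * v)); last exact: cder_cexp.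
by apply: cder_eq (cderZ tpi (cder_id u)) _; rewrite mulr1.
Qed.

Lemma cder_al u : ez u <> 1 -> cder al u (tpi * (al u + al u ^+ 2)).
Proof.
move=> /eqP E; have n0 : 1 - ez u != 0 by rewrite subr_eq0 eq_sym.
have dd := cderB (cder_cst 1 u) (cder_ez u).
apply: cder_eq (@cder_div _ ez (fun v => 1 - ez v) _ _ _ n0 (cder_ez u) dd) _.
by rewrite /al; field.
Qed.

Lemma al_opp u : ez u <> 1 -> al (- u) = - 1 - al u.
Proof.
move=> /eqP E; have n0 : 1 - ez u != 0 by rewrite subr_eq0 eq_sym.
rewrite /al ezN; field; rewrite ez_neq0 n0 /=.
by rewrite subr_eq0.
Qed.

Lemma alD1 u : al (u + 1) = al u. Proof. by rewrite /al ezD1. Qed.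

Lemma cn_al_le u : cn (ez u) <= 1 / 2 -> cn (al u) <= 2 * cn (ez u).
Proof.
move=> h; have n1 : 1 / 2 <= cn (1 - ez u).
  by have := cn_triB 1 (ez u); rewrite cn1; lra.
rewrite /al cnM cnV ler_pdivrMr; last by lra.
have := cn_ge0 (ez u); nra.
Qed.

Lemma ez_neq1_near u : ez u <> 1 ->
  exists2 d : R, 0 < d & forall v, cn (v - u) < d -> ez v <> 1.
Proof.
move=> /eqP E; have n0 : 0 < cn (ez u - 1) by rewrite cn_gt0 subr_eq0.
have [d d0 hd] := (ccontcP _ _).1 (cder_ccont (cder_ez u)) _ n0.
exists d => // v /hd; rewrite cnB => h Ev.
by move: h; rewrite Ev ltxx.
Qed.

End Exponential.

(** * Complex series as limits of partial sums *)

Section ComplexSeries.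
Variable R : realType.
Local Notation C := R[i].
Implicit Types (f g : nat -> C) (s : C).

Definition has_csum f s := forall e : R, 0 < e -> exists N : nat,
  forall n, (N <= n)%N -> cn (\sum_(k < n) f k - s) < e.

Lemma has_csum_unique f s s' : has_csum f s -> has_csum f s' -> s = s'.
Proof.
move=> h h'; apply/eqP; rewrite -subr_eq0 -cn_eq0; apply: contraT => ne.
have e0 : 0 < cn (s - s') / 2 by rewrite divr_gt0 // lt_neqAle eq_sym ne cn_ge0.
have [N hN] := h _ e0; have [N' hN'] := h' _ e0.
have := hN _ (leq_maxl N N'); have := hN' _ (leq_maxr N N').
set t := \sum_(k < _) _ => h2 h1; have tE := cnB t s.
have : cn (s - s') <= cn (s - t) + cn (t - s').
  by rewrite (_ : s - s' = (s - t) + (t - s')); [exact: cnD|ring].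
by move=> h3; exfalso; lra.
Qed.

Lemma has_csumD f g s t : has_csum f s -> has_csum g t ->
  has_csum (fun k => f k + g k) (s + t).
Proof.
move=> h h' e e0; have e2 : 0 < e / 2 by rewrite divr_gt0.
have [N hN] := h _ e2; have [N' hN'] := h' _ e2.
exists (maxn N N') => n; rewrite geq_max => /andP[/hN h1 /hN' h2].
rewrite big_split /= (_ : _ - _ = (\sum_(k < n) f k - s) + (\sum_(k < n) g k - t)).
  by apply: le_lt_trans (cnD _ _) _; lra.
by ring.
Qed.

Lemma has_csumZ f s (a : C) : has_csum f s -> has_csum (fun k => a * f k) (a * s).
Proof.
move=> h e e0; have A0 : 0 < cn a + 1 by rewrite ltr_wpDl // cn_ge0.
have [N hN] := h _ (divr_gt0 e0 A0); exists N => n /hN.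
rewrite -mulr_sumr -mulrBr cnM ltr_pdivlMr // => h1.
by have := cn_ge0 (\sum_(k < n) f k - s); have := cn_ge0 a; nra.
Qed.

Lemma has_csum_shift f s : has_csum f s -> has_csum (fun k => f k.+1) (s - f 0%N).
Proof.
move=> h e /h[N hN]; exists N => n nN.
have := hN n.+1 (leqW nN); rewrite big_ord_recl /=.
by congr (cn _ < e); rewrite /bump /=; ring.
Qed.

Lemma has_csum_le f s (B : R) : has_csum f s ->
  (forall n, \sum_(k < n) cn (f k) <= B) -> cn s <= B.
Proof.
move=> h hB; apply/ler_addgt0Pr => e /h[N /(_ N (leqnn N))].
rewrite cnB => hN.
have := cnD (s - \sum_(k < N) f k) (\sum_(k < N) f k); rewrite subrK.
by have := cn_sum N f; have := hB N; lra.
Qed.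

(** Links complex sums to the real limits in terms of which [D0q] is defined. *)
Lemma has_csum_Im f s : has_csum f s ->
  limn (series (fun k => complex.Im (f k))) = Im s.
Proof.
move=> h; apply: cvg_lim => //; apply/cvgrPdist_lt => e /h[N hN].
near=> n; have /hN : (N <= n)%N by near: n; exact: nbhs_infty_ge.
apply: le_lt_trans; rewrite distrC /series /= big_mkord -Im_sum -ImN -ImD.
exact: Im_le_cn.
Unshelve. all: by end_near. Qed.

Lemma geom_sum_le (K r : R) n : 0 <= K -> 0 <= r < 1 ->
  \sum_(k < n) K * r ^+ k <= K / (1 - r).
Proof.
move=> K0 /andP[r0 r1]; have d0 : 0 < 1 - r by rewrite subr_gt0.
rewrite -mulr_sumr ler_wpM2l // -div1r ler_pdivlMr // mulrC.
rewrite -opprB mulNr -subrX1 opprB gerBl exprn_ge0 //.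
Qed.

Lemma has_csum_geom f (K r : R) : 0 <= r < 1 ->
  (forall k, cn (f k) <= K * r ^+ k) -> exists s, has_csum f s.
Proof.
move=> /andP[r0 r1] hf.
have cv (g : nat -> R) : (forall k, `|g k| <= K * r ^+ k) -> cvgn (series g).
  move=> hg; apply: normed_cvg.
  apply: (@series_le_cvg _ _ (geometric K r)) => [k|k|k|] /=;
    [by []|exact: le_trans (hg k)|exact: hg|].
  by apply: is_cvg_geometric_series; rewrite ger0_norm.
have cR : cvgn (series (fun k => complex.Re (f k))).
  by apply: cv => k; apply: le_trans (hf k); exact: Re_le_cn.
have cI : cvgn (series (fun k => complex.Im (f k))).
  by apply: cv => k; apply: le_trans (hf k); exact: Im_le_cn.
exists (limn (series (fun k => complex.Re (f k))) +i*
        limn (series (fun k => complex.Im (f k)))) => e e0.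
have e2 : 0 < e / 2 by rewrite divr_gt0.
have [N1 _ H1] := (@cvgrPdist_lt _ _ _ _ _ _ _).1 cR _ e2.
have [N2 _ H2] := (@cvgrPdist_lt _ _ _ _ _ _ _).1 cI _ e2.
exists (maxn N1 N2) => n; rewrite geq_max => /andP[/H1 h1 /H2 h2].
move: h1 h2; rewrite /= /series /= !big_mkord -Re_sum -Im_sum.
move=> h1 h2; rewrite distrC in h1; rewrite distrC in h2.
apply: le_lt_trans (cn_le_ReIm _) _; rewrite ReD ImD ReN ImN /=; lra.
Qed.

End ComplexSeries.

(** * Polynomial functions: derivative and boundedness on discs *)

Section PolynomialBounds.
Variable R : realType.
Local Notation C := R[i].

Lemma cder_horner (G : {poly C}) a : cder (horner G) a (G^`().[a]).
Proof.
elim/poly_ind: G => [|G c IH].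
  rewrite deriv0 horner0 (_ : horner 0 = fun=> 0); first exact: cder_cst.
  by apply/funext => x; exact: horner0.
rewrite derivMXaddC (_ : horner _ = fun x => G.[x] * x + c); last first.
  by apply/funext => x; rewrite hornerMXaddC.
apply: cder_eq (cderD (cderM IH (cder_id a)) (cder_cst c a)) _.
by rewrite hornerD hornerMX addr0 mulr1 addrC.
Qed.

Lemma horner_bound (G : {poly C}) (K : R) : 0 <= K ->
  exists2 B : R, 0 <= B & forall a, cn a <= K -> cn G.[a] <= B.
Proof.
move=> K0; elim/poly_ind: G => [|G c [B B0 hB]].
  by exists 0 => // a _; rewrite horner0 cn0.
exists (B * K + cn c) => [|a ha]; first by rewrite addr_ge0 ?mulr_ge0 ?cn_ge0.
rewrite hornerMXaddC; apply: le_trans (cnD _ _) _; rewrite lerD2r cnM.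
by apply: ler_pM; rewrite ?cn_ge0 // hB.
Qed.

End PolynomialBounds.

(** * One-sided Lambert series and their termwise differentiation *)

Section LambertSeries.
Variables (R : realType) (tau : R[i]).
Hypothesis tau_gt0 : 0 < Im tau.
Local Notation C := R[i].
Implicit Types (G : {poly C}) (u v w : C).

Let rho : R := expR (- (2 * pi * Im tau)).

Let rho_gt0 : 0 < rho. Proof. exact: expR_gt0. Qed.

Let rho01 : 0 <= rho < 1.
Proof.
by rewrite ltW //= -expR0 ltr_expR oppr_lt0 !mulr_gt0 // pi_gt0.
Qed.

Lemma cn_ez_tau u (n : nat) : cn (ez (u + n%:R * tau)) = cn (ez u) * rho ^+ n.
Proof. by rewrite ezD cnM ezX cnX (cn_ez tau). Qed.

(** The series over [n >= 0] has its poles on the half of the lattice formed by [m - n * tau]; these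
    are the points excluded. *)
Definition regular u := forall n : nat, ez (u + n%:R * tau) <> 1.

(** From some index [n0] on, [cn (ez _) <= 1 / 2] near [u] and [cn_al_le] gives geometric decay; the
    finitely many earlier terms are bounded by continuity. *)
Lemma al_bound u : regular u -> exists K r : R, [/\ 0 < K, 0 < r &
  forall (n : nat) v, cn (v - u) < r -> ez (v + n%:R * tau) <> 1 /\
     cn (al (v + n%:R * tau)) <= K * rho ^+ n].
Proof.
move=> hu; have /andP[_ rho1] := rho01.
have [r0 r00 hr0] := (ccontcP _ _).1 (cder_ccont (cder_ez u)) 1 ltr01.
pose A := cn (ez u) + 1.
have A0 : 0 < A by rewrite ltr_wpDl // cn_ge0.
have hA v : cn (v - u) < r0 -> cn (ez v) <= A.
  move=> /hr0 h; have := cnD (ez v - ez u) (ez u); rewrite subrK /A; lra.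
have [n0 hn0] : exists n0 : nat, A * rho ^+ n0 <= 1 / 2.
  have e0 : 0 < 1 / 2 / A by rewrite !divr_gt0.
  have : (fun n : nat => rho ^+ n) @ \oo --> (0 : R).
    by apply: cvg_expr; rewrite gtr0_norm.
  move=> /cvgrPdist_lt/(_ _ e0)[N _ /(_ N (leqnn N))]; rewrite /= sub0r normrN => h.
  exists N; rewrite mulrC -ler_pdivlMr //; apply: ltW.
  by apply: le_lt_trans (ler_norm _) h.
have tail (n : nat) v : (n0 <= n)%N -> cn (v - u) < r0 ->
    cn (ez (v + n%:R * tau)) <= 1 / 2 /\ cn (al (v + n%:R * tau)) <= 2 * A * rho ^+ n.
  move=> nn /hA hv.
  have E : cn (ez (v + n%:R * tau)) <= A * rho ^+ n.
    by rewrite cn_ez_tau ler_wpM2r ?exprn_ge0 // ltW.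
  have E2 : A * rho ^+ n <= 1 / 2.
    apply: le_trans hn0; rewrite ler_wpM2l ?(ltW A0) //.
    by rewrite ler_wiXn2l // ltW.
  have E3 := le_trans E E2; split=> //.
  by apply: le_trans (cn_al_le E3) _; rewrite -mulrA ler_pM2l.
have head (m : nat) : exists K r : R, [/\ 0 < K, 0 < r &
  forall (n : nat) v, (n < m)%N -> cn (v - u) < r -> ez (v + n%:R * tau) <> 1 /\
     cn (al (v + n%:R * tau)) <= K * rho ^+ n].
  elim: m => [|m [K [r [K0 r_0 IH]]]]; first by exists 1, 1; split.
  have [d d0 hd] := ez_neq1_near (hu m).
  have ca := cder_ccont (cder_al (hu m)).
  have [d' d'0 hd'] := (ccontcP _ _).1 ca 1 ltr01.
  pose B := cn (al (u + m%:R * tau)) + 1.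
  have B0 : 0 < B by rewrite ltr_wpDl // cn_ge0.
  have rm : 0 < rho ^+ m by rewrite exprn_gt0.
  (* Dividing by [rho ^+ m] makes the bound at index [m] at least [B]. *)
  exists (K + B / rho ^+ m), (Num.min r (Num.min d d')); split.
  - by rewrite addr_gt0 // divr_gt0.
  - by rewrite !lt_min r_0 d0.
  move=> n v; rewrite ltnS leq_eqVlt => /orP[/eqP ->|nm];
    rewrite !lt_min => /and3P[v1 v2 v3].
    have E : v + m%:R * tau - (u + m%:R * tau) = v - u by ring.
    split; first by apply: hd; rewrite E.
    rewrite mulrDl divfK ?gt_eqF //.
    have := hd' (v + m%:R * tau); rewrite E => /(_ v3) h.
    have := cnD (al (v + m%:R * tau) - al (u + m%:R * tau)) (al (u + m%:R * tau)).
    have Kr : 0 <= K * rho ^+ m by rewrite mulr_ge0 // ltW.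
    by rewrite subrK /B; lra.
  have [h1 h2] := IH n v nm v1; split=> //; apply: le_trans h2 _.
  by rewrite ler_pM2r ?exprn_gt0 // lerDl divr_ge0 // ltW.
have [K [r [K0 r_0 hK]]] := head n0.
exists (K + 2 * A), (Num.min r r0); split.
- by rewrite addr_gt0 // mulr_gt0.
- by rewrite lt_min r_0.
move=> n v; rewrite lt_min => /andP[v1 v2].
have rn : 0 < rho ^+ n by rewrite exprn_gt0.
have [nn|nn] := leqP n0 n.
  have [h1 h2] := tail n v nn v2; split.
    by move=> E; move: h1; rewrite E cn1; lra.
  by apply: le_trans h2 _; rewrite ler_pM2r // lerDr ltW.
have [h1 h2] := hK n v nn v1; split=> //; apply: le_trans h2 _.
by rewrite ler_pM2r // lerDl mulr_ge0 // ltW.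
Qed.

(** Polynomials in [al] without constant term: the factor [al] provides geometric decay, and the
    class is stable under differentiation, so one convergence proof covers all derivatives. *)
Definition tm G v := al v * G.[al v].
(* [tm G] differentiates to [tm (pD G)], because [al' = tpi (al + al ^ 2)]. *)
Definition pD G : {poly C} := (tpi R)%:P * (1 + 'X) * (G + 'X * G^`()).

Lemma cder_tm G u : ez u <> 1 -> cder (tm G) u (tm (pD G) u).
Proof.
move=> hu; have da := cder_al hu.
apply: cder_eq (cderM da (cder_comp da (cder_horner G _))) _.
by rewrite /tm /pD !(hornerM, hornerD, hornerX, hornerC); ring.
Qed.

(** The default value is [0] where the series does not converge. *)
Definition lam G u : C := xget 0 (has_csum (fun n : nat => tm G (u + n%:R * tau))).

Lemma tm_bound G (K : R) : 0 <= K -> exists2 B : R, 0 <= B &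
  forall (n : nat) v, cn (al (v + n%:R * tau)) <= K * rho ^+ n ->
    cn (tm G (v + n%:R * tau)) <= B * rho ^+ n.
Proof.
move=> K0; have [B B0 hB] := horner_bound G K0.
have /andP[r0 r1] := rho01.
exists (K * B) => [|n v h]; first exact: mulr_ge0.
rewrite /tm cnM mulrAC; apply: ler_pM; rewrite ?cn_ge0 //; apply: hB.
by apply: le_trans h _; rewrite ler_piMr // exprn_ile1 // ltW.
Qed.

Lemma lamP G u : regular u ->
  has_csum (fun n : nat => tm G (u + n%:R * tau)) (lam G u).
Proof.
move=> /al_bound[K [r [K0 r0 hK]]].
have [B B0 hB] := tm_bound G (ltW K0).
have [s hs] : exists s, has_csum (fun n : nat => tm G (u + n%:R * tau)) s.
  apply: (@has_csum_geom _ _ B rho) => // n; apply: hB.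
  by have [] := hK n u _; rewrite ?subrr ?cn0.
by rewrite /lam; case: xgetP => [_ -> //|/(_ s)].
Qed.

(** Two applications of the mean value inequality bound the first-order remainder of the [k]-th term
    by [B * rho ^+ k * cn (v - u) ^+ 2]; these bounds sum to a quadratic remainder for the
    series. *)
Lemma cder_lam G u : regular u -> cder (lam G) u (lam (pD G) u).
Proof.
move=> hu; have [K [r [K0 r0 hK]]] := al_bound hu.
have [B B0 hB] := tm_bound (pD (pD G)) (ltW K0).
have /andP[rho0 rho1] := rho01.
have hreg v : cn (v - u) < r -> regular v.
  by move=> vr n; have [] := hK n v vr.
pose D := B / (1 - rho).
have D0 : 0 <= D by rewrite divr_ge0 // subr_ge0 ltW.
have main v : cn (v - u) < r ->
    cn (lam G v - lam G u - lam (pD G) u * (v - u)) <= D * cn (v - u) ^+ 2.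
  move=> vr.
  have S1 := lamP G (hreg v vr); have S2 := lamP G hu; have S3 := lamP (pD G) hu.
  have S := has_csumD (has_csumD S1 (has_csumZ (-1) S2)) (has_csumZ (- (v - u)) S3).
  rewrite (_ : _ - _ - _ = lam G v + -1 * lam G u + - (v - u) * lam (pD G) u); last by ring.
  apply: (has_csum_le S) => n.
  apply: le_trans (_ : _ <= \sum_(k < n) (B * cn (v - u) ^+ 2) * rho ^+ k) _; last first.
    rewrite /D mulrAC; apply: geom_sum_le => //.
    by rewrite mulr_ge0 // exprn_ge0 // cn_ge0.
  apply: ler_sum => k _; have k0 : 0 <= rho ^+ k by rewrite exprn_ge0.
  have seg (w : C) (t : R) : cn (w - u) <= cn (v - u) -> 0 <= t <= 1 ->
      cn (u + t%:C * (w - u) - u) <= cn (v - u).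
    move=> hw /andP[t0 t1]; rewrite addrAC subrr add0r cnM cnR ger0_norm //.
    by apply: le_trans hw; rewrite ler_piMl ?cn_ge0.
  pose f G' w := tm G' (w + k%:R * tau).
  have df G' w : cn (w - u) <= cn (v - u) -> cder (f G') w (f (pD G') w).
    move=> wv; apply: (@cder_shift _ (tm G')); apply: cder_tm.
    by have [] := hK k w (le_lt_trans wv vr).
  have step1 w : cn (w - u) <= cn (v - u) ->
      cn (f (pD G) w - f (pD G) u) <= B * rho ^+ k * cn (v - u).
    move=> wv; apply: le_trans (_ : _ <= B * rho ^+ k * cn (w - u)) _; last first.
      by rewrite ler_wpM2l // mulr_ge0.
    apply: (@cmean_value _ _ (f (pD (pD G)))) => t.
    - by move=> t01; apply: cder_ccont (df _ _ _); exact: seg.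
    - by case/andP=> /ltW t0 /ltW t1; apply: df; apply: seg; rewrite ?t0.
    - case/andP=> /ltW t0 /ltW t1; apply: hB.
      have h : cn (u + t%:C * (w - u) - u) <= cn (v - u) by apply: seg; rewrite ?t0.
      by have [] := hK k _ (le_lt_trans h vr).
  have := @cmean_value _ (fun w => f G w - f (pD G) u * w)
     (fun w => f (pD G) w - f (pD G) u) u v (B * rho ^+ k * cn (v - u)).
  have dg w : cn (w - u) <= cn (v - u) ->
      cder (fun w => f G w - f (pD G) u * w) w (f (pD G) w - f (pD G) u).
    move=> wv; apply: cderB; first exact: df.
    by apply: cder_eq (cderZ _ (cder_id w)) _; rewrite mulr1.
  rewrite (_ : B * rho ^+ k * cn (v - u) * cn (v - u) =
    B * cn (v - u) ^+ 2 * rho ^+ k); last by ring.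
  rewrite (_ : f G v - _ - _ = tm G (v + k%:R * tau) + -1 * tm G (u + k%:R * tau) +
    - (v - u) * tm (pD G) (u + k%:R * tau)); last by rewrite /f; ring.
  apply=> t.
  - by move=> t01; apply: cder_ccont (dg _ _); exact: seg.
  - by case/andP=> /ltW t0 /ltW t1; apply: dg; apply: seg; rewrite ?t0.
  - by case/andP=> /ltW t0 /ltW t1; apply: step1; apply: seg; rewrite ?t0.
have D1 : 0 < D + 1 by rewrite ltr_wpDl.
apply/cdercP => e e0; exists (Num.min r (e / (D + 1))).
  by rewrite lt_min r0 divr_gt0.
move=> v; rewrite lt_min => /andP[v1 v2]; apply: le_trans (main v v1) _.
rewrite expr2 mulrA ler_wpM2r ?cn_ge0 //.
move: v2; rewrite ltr_pdivlMr // => v2; have := cn_ge0 (v - u); lra.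
Qed.

(** Adding [tau] shifts the index by one and loses the term [n = 0]; the behaviour of [xi] and [wp]
    under [tau] comes from this. *)
Lemma lam_shift G u : regular u -> lam G (u + tau) = lam G u - tm G u.
Proof.
move=> hu.
have hu' : regular (u + tau).
  move=> n; rewrite (_ : u + tau + n%:R * tau = u + n.+1%:R * tau); first exact: hu.
  by rewrite mulrSr; ring.
apply: has_csum_unique (lamP G hu') _.
have := has_csum_shift (lamP G hu); rewrite mul0r addr0.
rewrite (_ : (fun k => tm G (u + k.+1%:R * tau)) =
  (fun k : nat => tm G (u + tau + k%:R * tau))) //.
by apply/funext => n; congr tm; rewrite mulrSr; ring.
Qed.

Lemma lamD1 G u : lam G (u + 1) = lam G u.
Proof.
rewrite /lam; congr xget; congr has_csum; apply/funext => n.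
by rewrite /tm addrAC alD1.
Qed.

Lemma regular_lattice u : ~ lattice 1 tau u -> regular u.
Proof.
move=> Lu n /ez_eq1[m E]; apply: Lu; exists m, (- n%:Z).
by rewrite mulr1 rmorphN /= mulNr -E addrK.
Qed.

Lemma regular_Im u : 0 < Im u -> regular u.
Proof.
move=> u0 n /(congr1 (fun z => cn z)); rewrite cn1 cn_ez => /eqP.
rewrite -expR0 => /eqP/expR_inj/eqP; rewrite oppr_eq0 mulf_eq0 gt_eqF ?mulr_gt0 ?pi_gt0 //=.
rewrite ImD -(rmorph_nat (real_complex R)) ImZ gt_eqF // ltr_wpDr // mulr_ge0 //.
exact: ltW.
Qed.

End LambertSeries.

(** * Zeta and Weierstrass functions as Lambert series *)

Section DoublePole.
Variable R : realType.
Local Notation C := R[i].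
Implicit Types (u v w : C).

(* The local parameter [t = -2 X / Y] satisfies [t' = 1 + O(1 / X^2)], hence
   [t = v + O(v^5)], while [X = 1 / t^2 + O(1 / X)]. *)
Lemma pole_expansion (X Y : C -> C) (g2 g3 : C) (d : R) : 0 < d ->
  (forall v, 0 < cn v < d -> [/\ cder X v (Y v), cder Y v (6 * X v ^+ 2 - g2 / 2)
     & Y v ^+ 2 = 4 * X v ^+ 3 - g2 * X v - g3]) ->
  (forall M : R, exists2 r : R, 0 < r & forall v, 0 < cn v < r -> M <= cn (X v)) ->
  exists B r : R, 0 < r /\
    forall v, 0 < cn v < r -> cn (X v - v ^- 2) <= B * cn v ^+ 2.
Proof.
move=> d0 hd hM.
pose g := cn g2 + cn g3; have g0 : 0 <= g by rewrite addr_ge0 ?cn_ge0.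
(* Beyond this threshold the cube dominates the terms in [g2] and [g3], so that
   [3 * cn (X v) ^+ 3 <= cn (Y v) ^+ 2]. *)
have [r1 r10 hr1] := hM (2 * g + 1).
pose r := Num.min d r1; have r0 : 0 < r by rewrite lt_min d0.
pose t v := if v == 0 then 0 else - 2 * X v / Y v.
(* By the cubic equation this is exactly [t' - 1]. *)
pose rem v := (2 * g2 * X v + 3 * g3) / Y v ^+ 2.
have basic v : 0 < cn v < r -> [/\ 1 <= cn (X v), 2 * g + 1 <= cn (X v),
    3 * cn (X v) ^+ 3 <= cn (Y v) ^+ 2, cn (g2 * X v + g3) <= g * cn (X v)
    & cn (Y v) ^+ 2 <= 4 * cn (X v) ^+ 3 + g * cn (X v) /\
      cn (2 * g2 * X v + 3 * g3) <= 3 * g * cn (X v)].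
  move=> /andP[v0]; rewrite lt_min => /andP[vd vr].
  have hX : 2 * g + 1 <= cn (X v) by apply: hr1; rewrite v0.
  have X1 : 1 <= cn (X v) by lra.
  have [_ _ E] : [/\ cder X v (Y v), cder Y v (6 * X v ^+ 2 - g2 / 2)
     & Y v ^+ 2 = 4 * X v ^+ 3 - g2 * X v - g3] by apply: hd; rewrite v0.
  have b3 : cn g3 <= cn g3 * cn (X v) by rewrite ler_peMr ?cn_ge0.
  have hl : cn (g2 * X v + g3) <= g * cn (X v).
    by apply: le_trans (cnD _ _) _; rewrite cnM /g mulrDl lerD2l.
  have hl2 : cn (2 * g2 * X v + 3 * g3) <= 3 * g * cn (X v).
    apply: le_trans (cnD _ _) _; rewrite !cnM !cn_nat /g.
    have := mulr_ge0 (cn_ge0 g2) (cn_ge0 (X v)); lra.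
  have eY : cn (Y v) ^+ 2 = cn (4 * X v ^+ 3 - (g2 * X v + g3)).
    by rewrite -cnX E; congr cn; ring.
  have e4 : cn (4 * X v ^+ 3) = 4 * cn (X v) ^+ 3 by rewrite cnM cn_nat cnX.
  split=> //.
  - rewrite eY; apply: le_trans (cn_triB _ _); rewrite e4.
    set m := cn (X v) in X1 hX hl *; have : g * m <= m ^+ 3.
      by rewrite exprSr ler_wpM2r //; [lra|nra].
    lra.
  - split=> //; rewrite eY; apply: le_trans (cnD _ _) _; by rewrite cnN e4; lra.
have tn0 v : 0 < cn v -> t v = - 2 * X v / Y v.
  by rewrite cn_gt0 /t => /negPf ->.
have Yn0 v : 0 < cn v < r -> Y v != 0 /\ X v != 0.
  move=> /basic[X1 _ hY _ _]; split; last by rewrite -cn_gt0; lra.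
  apply: contraTneq hY => ->; rewrite cn0 expr0n /= -ltNge mulr_gt0 // exprn_gt0 //.
  lra.
have dt v : 0 < cn v < r -> cder t v (1 + rem v).
  move=> vr; have [Y0 X0] := Yn0 v vr; have [v0 vr'] := andP vr.
  have [dX dY E] : [/\ cder X v (Y v), cder Y v (6 * X v ^+ 2 - g2 / 2)
     & Y v ^+ 2 = 4 * X v ^+ 3 - g2 * X v - g3].
    by apply: hd; rewrite v0 (lt_le_trans vr') // ge_min lexx.
  have D := cder_div Y0 (cderZ (- 2) dX) dY.
  apply: (@cder_nearc _ _ _ _ _ (cn v)) (cder_eq D _) => // [w wv|].
    rewrite tn0 // cn_gt0; apply: contraTneq wv => ->.
    by rewrite sub0r cnN ltxx.
  rewrite /rem -[1](mulfV (_ : Y v ^+ 2 != 0)) ?expf_neq0 // -mulrDl; congr (_ / _).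
  apply/eqP; rewrite -subr_eq0; apply/eqP.
  transitivity (3 * ((4 * X v ^+ 3 - g2 * X v - g3) - Y v ^+ 2)); first by field.
  by rewrite -E subrr mulr0.
have t2 v : 0 < cn v < r -> cn (t v) ^+ 2 <= 2 / cn (X v).
  move=> vr; have [X1 _ hY _ _] := basic v vr; have [Y0 X0] := Yn0 v vr.
  rewrite tn0 //; last by case/andP: vr.
  rewrite !cnM cnV cnN cn_nat !exprMn exprVn ler_pdivrMr; last first.
    by rewrite exprn_gt0 // cn_gt0.
  set m := cn (X v) in X1 hY *; have m0 : 0 < m by lra.
  apply: le_trans (_ : _ <= 2 / m * (3 * m ^+ 3)) _; last by rewrite ler_pM2l // divr_gt0.
  rewrite (_ : 2 / m * (3 * m ^+ 3) = 6 * m ^+ 2); last by field; rewrite gt_eqF.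
  by have := sqr_ge0 m; lra.
have ct0 : ccont t 0.
  apply/ccontcP => e e0; have [r2 r20 hr2] := hM (4 / e ^+ 2).
  exists (Num.min r r2); first by rewrite lt_min r0.
  move=> v; rewrite subr0 lt_min => /andP[vr vr2].
  have -> : t 0 = 0 by rewrite /t eqxx.
  rewrite subr0; have [->|v0] := eqVneq v 0; first by rewrite /t eqxx cn0.
  have vp : 0 < cn v by rewrite cn_gt0.
  have vr' : 0 < cn v < r by rewrite vp.
  have [X1 _ _ _ _] := basic v vr'.
  have h := hr2 v; rewrite vp vr2 in h; have {}h := h isT.
  rewrite -(@ltr_pXn2r _ 2) ?nnegrE ?cn_ge0 ?ltW //.
  apply: le_lt_trans (t2 v vr') _.
  have X0 : 0 < cn (X v) by lra.
  rewrite ltr_pdivrMr // mulrC -ltr_pdivrMr ?exprn_gt0 //.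
  apply: lt_le_trans h; rewrite ltr_pM2r ?invr_gt0 ?exprn_gt0 //; lra.
have mv v (S : R) : 0 < cn v < r ->
    (forall w, 0 < cn w <= cn v -> cn (rem w) <= S) -> cn (t v - v) <= S * cn v.
  move=> /andP[v0 vr] hS.
  have := @cmean_value _ (fun w => t w - w) rem 0 v S.
  rewrite (_ : t 0 = 0) ?subr0; last by rewrite /t eqxx.
  apply.
  - move=> s /andP[s0 s1]; rewrite add0r; have [->|sn0] := eqVneq s 0.
      rewrite rmorph0 mul0r; exact: (ccontD ct0 (ccontN (@ccont_id _ 0))).
    apply: ccontD; last by apply: ccontN; exact: ccont_id.
    apply: cder_ccont (dt _ _); rewrite cnM cnR ger0_norm //.
    rewrite mulr_gt0 //=; last by rewrite lt_neqAle eq_sym sn0.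
    by apply: le_lt_trans vr; rewrite ler_piMl ?cn_ge0.
  - move=> s /andP[s0 s1]; rewrite add0r.
    apply: cder_eq (cderB (dt _ _) (cder_id _)) _; last by ring.
    rewrite cnM cnR gtr0_norm // mulr_gt0 //=.
    by apply: le_lt_trans vr; rewrite ler_piMl ?cn_ge0 // ltW.
  - move=> s /andP[s0 s1]; rewrite add0r; apply: hS.
    by rewrite cnM cnR gtr0_norm // mulr_gt0 //= ler_piMl ?cn_ge0 // ltW.
have hrem v : 0 < cn v < r -> cn (rem v) <= g / cn (X v) ^+ 2.
  move=> vr; have [X1 _ hY _ [_ h]] := basic v vr; have [Y0 X0] := Yn0 v vr.
  have m0 : 0 < cn (X v) by lra.
  have m2 : 0 < cn (X v) ^+ 2 by rewrite exprn_gt0.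
  rewrite /rem cnM cnV cnX ler_pdivrMr; last by rewrite exprn_gt0 // cn_gt0.
  apply: le_trans h _.
  apply: le_trans (_ : _ <= g / cn (X v) ^+ 2 * (3 * cn (X v) ^+ 3)) _.
    rewrite [X in _ <= X](_ : _ = 3 * g * cn (X v)) //.
    by field; rewrite gt_eqF.
  by rewrite ler_wpM2l // divr_ge0 // ltW.
have smaller v w : 0 < cn v < r -> 0 < cn w <= cn v -> 0 < cn w < r.
  by move=> /andP[_ vr] /andP[-> wv]; exact: le_lt_trans vr.
(* Bootstrap: this crude bound makes [t v] and [v] comparable, hence [1 / X = O(v ^ 2)] and
   [rem = O(v ^ 4)], which yields the bound [fine]. *)
have half v : 0 < cn v < r -> cn (t v - v) <= 1 / 2 * cn v.
  move=> vr; apply: mv => // w /(smaller v w vr) wr.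
  apply: le_trans (hrem w wr) _; have [X1 hX _ _ _] := basic w wr.
  set m := cn (X w) in X1 hX *; rewrite ler_pdivrMr; last by rewrite exprn_gt0 //; lra.
  by nra.
have tv v : 0 < cn v < r -> 1 / 2 * cn v <= cn (t v) <= 3 / 2 * cn v.
  move=> /half h; have := cnD (t v - v) v; rewrite subrK.
  by have := cn_triB v (t v); rewrite cnB; lra.
have Xbig v : 0 < cn v < r -> 1 / cn (X v) <= 9 / 2 * cn v ^+ 2.
  move=> vr; have [X1 hX _ _ [hY _]] := basic v vr; have [Y0 X0] := Yn0 v vr.
  have v0 : 0 < cn v by case/andP: vr.
  have /andP[_ tle] := tv v vr.
  have t9 : cn (t v) ^+ 2 <= 9 / 4 * cn v ^+ 2.
    rewrite (_ : 9 / 4 * _ = (3 / 2 * cn v) ^+ 2); last by field.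
    by rewrite ler_pXn2r // nnegrE ?cn_ge0 // mulr_ge0 // ltW.
  have Ey : cn (t v) ^+ 2 * cn (Y v) ^+ 2 = 4 * cn (X v) ^+ 2.
    rewrite tn0 // !cnM cnV cnN cn_nat !exprMn exprVn divfK; first by ring.
    by rewrite expf_neq0 // cn_eq0.
  set m := cn (X v) in X1 hX hY Ey *; set k := cn v ^+ 2 in t9 *.
  set T := cn (t v) ^+ 2 in t9 Ey; have T0 : 0 <= T by rewrite exprn_ge0 ?cn_ge0.
  have m0 : 0 < m by lra.
  rewrite ler_pdivrMr // -(ler_pM2r (exprn_gt0 2 m0)).
  have : 4 * m ^+ 2 <= T * (4 * m ^+ 3 + g * m) by rewrite -Ey ler_wpM2l.
  have : g * m <= m ^+ 3 by rewrite exprSr ler_wpM2r //; [lra|nra].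
  move=> h1 h2.
  have h3 : 4 * m ^+ 2 <= T * (5 * m ^+ 3).
    by apply: le_trans h2 _; rewrite ler_wpM2l //; lra.
  have h4 : T * (5 * m ^+ 3) <= 9 / 4 * k * (5 * m ^+ 3).
    by rewrite ler_wpM2r // mulr_ge0 // exprn_ge0 // ltW.
  have := le_trans h3 h4.
  rewrite (_ : 9 / 2 * k * m * m ^+ 2 = 9 / 2 * k * m ^+ 3); last by ring.
  have m3 : 0 < m ^+ 3 by rewrite exprn_gt0.
  have : 0 <= k * m ^+ 3 by rewrite mulr_ge0 // ?exprn_ge0 ?cn_ge0 // ltW.
  move=> ? ?; nra.
(* The two pieces [p1] and [p2] cost [500 * g] and [2 * g]; the constant is generous. *)
exists (1000 * g), r; split=> // v vr.
have [X1 hX _ hl [hY _]] := basic v vr; have [Y0 X0] := Yn0 v vr.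
have v0 : 0 < cn v by case/andP: vr.
have vn : v != 0 by rewrite -cn_gt0.
have /andP[tl th] := tv v vr.
have t0 : 0 < cn (t v) by lra.
have tn : t v != 0 by rewrite -cn_gt0.
set k := cn v in v0 tl th *.
have fine : cn (t v - v) <= (81 / 4 * g * k ^+ 4) * k.
  apply: mv => // w wv; have wr := smaller v w vr wv.
  apply: le_trans (hrem w wr) _.
  have := Xbig w wr; have [X1w _ _ _ _] := basic w wr => hw.
  rewrite (_ : g / cn (X w) ^+ 2 = g * (1 / cn (X w)) ^+ 2); last by field; rewrite gt_eqF; lra.
  rewrite (_ : 81 / 4 * g * k ^+ 4 = g * (9 / 2 * k ^+ 2) ^+ 2); last by field.
  rewrite ler_wpM2l //.
  have h1 : 0 <= 1 / cn (X w) by rewrite divr_ge0 // cn_ge0.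
  have h2 : cn w ^+ 2 <= k ^+ 2 by rewrite ler_pXn2r // ?nnegrE ?cn_ge0 //; case/andP: wv.
  have h3 : 1 / cn (X w) <= 9 / 2 * k ^+ 2 by lra.
  by rewrite ler_pXn2r // nnegrE mulr_ge0 // exprn_ge0 // ltW.
have p1 : cn ((t v) ^- 2 - v ^- 2) <= 500 * g * k ^+ 2.
  rewrite (_ : (t v) ^- 2 - v ^- 2 =
    - ((t v - v) * (v + t v)) / ((t v) ^+ 2 * v ^+ 2)); last first.
    by field; rewrite vn tn.
  rewrite cnM cnV cnN !cnM -/k -!expr2 ler_pdivrMr; last by rewrite mulr_gt0 // exprn_gt0.
  have h5 : cn (v + t v) <= 5 / 2 * k by apply: le_trans (cnD _ _) _; rewrite -/k; lra.
  apply: le_trans (_ : _ <= (81 / 4 * g * k ^+ 4 * k) * (5 / 2 * k)) _.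
    by apply: ler_pM; rewrite ?cn_ge0.
  apply: le_trans (_ : _ <= 500 * g * k ^+ 2 * ((1 / 2 * k) ^+ 2 * k ^+ 2)) _.
    have : 0 <= g * k ^+ 6 by rewrite mulr_ge0 // exprn_ge0 // ltW.
    lra.
  apply: ler_wpM2l; first by have := mulr_ge0 g0 (sqr_ge0 k); lra.
  by rewrite ler_pM2r ?exprn_gt0 // ler_pXn2r // nnegrE ?cn_ge0 // mulr_ge0 // ltW.
have p2 : cn (X v - (t v) ^- 2) <= 2 * g * k ^+ 2.
  have [_ _ E] : [/\ cder X v (Y v), cder Y v (6 * X v ^+ 2 - g2 / 2)
     & Y v ^+ 2 = 4 * X v ^+ 3 - g2 * X v - g3].
    apply: hd; rewrite -/k v0 (lt_le_trans (andP vr).2) // ge_min lexx //.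
  rewrite (_ : X v - _ = (g2 * X v + g3) / (4 * X v ^+ 2)); last first.
    rewrite tn0 // (_ : (- 2 * X v / Y v) ^- 2 = Y v ^+ 2 / (4 * X v ^+ 2)).
      by rewrite E; field; rewrite X0.
    by field; rewrite X0 Y0.
  have m0 : 0 < cn (X v) by lra.
  rewrite cnM cnV cnM cn_nat cnX ler_pdivrMr; last by rewrite mulr_gt0 // exprn_gt0.
  apply: le_trans hl _.
  have := Xbig v vr; rewrite -/k ler_pdivrMr // => hk.
  set m := cn (X v) in m0 hk *.
  rewrite (_ : 2 * g * k ^+ 2 * (4 * m ^+ 2) = g * m * (8 * k ^+ 2 * m)); last by ring.
  rewrite ler_peMr //; first by rewrite mulr_ge0 // ltW.
  by have := sqr_ge0 k; have := mulr_ge0 (sqr_ge0 k) (ltW m0); lra.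
rewrite (_ : X v - v ^- 2 = (X v - (t v) ^- 2) + ((t v) ^- 2 - v ^- 2)); last by ring.
apply: le_trans (cnD _ _) _.
have : 0 <= g * k ^+ 2 by rewrite mulr_ge0 // sqr_ge0.
lra.
Qed.

End DoublePole.

(** * The function [xi], its derivatives and its quasi-periods *)

Section Zeta.
Variables (R : realType) (tau : R[i]).
Hypothesis tau_gt0 : 0 < Im tau.
Local Notation C := R[i].
Local Notation L := (lattice 1 tau).
Local Notation tpi := (tpi R).
Local Notation lam := (lam tau).
Implicit Types (G : {poly C}) (u v w p : C).

Let p1 : {poly C} := pD 1.
Let p2 := pD p1.
Let p3 := pD p2.

(* [xi] differs from the Weierstrass zeta function of [L] by a multiple of [u];
   this makes it 1-periodic, and [wp] differs from the Weierstrass function by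
   a constant. *)
Definition xi u : C := - tpi * (lam 1 u - lam 1 (tau - u) + 1 / 2).
Definition wp u : C := tpi * (lam p1 u + lam p1 (tau - u)).
Definition wp' u : C := tpi * (lam p2 u - lam p2 (tau - u)).
Definition wp'' u : C := tpi * (lam p3 u + lam p3 (tau - u)).

Lemma tm1 u : tm 1 u = al u.
Proof. by rewrite /tm hornerC mulr1. Qed.
Lemma tm_p1 u : tm p1 u = tpi * (al u + al u ^+ 2).
Proof.
by rewrite /tm /p1 /pD !(hornerM, hornerD, hornerX, hornerC) derivC hornerC; ring.
Qed.

Lemma nlattice_regular u : ~ L u -> [/\ ez u <> 1, regular tau u & regular tau (tau - u)].
Proof.
move=> Lu; have ru := regular_lattice Lu; split=> //.
  by have := ru 0%N; rewrite mul0r addr0.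
apply: regular_lattice => h; apply: Lu.
by rewrite -[u](subKr tau); apply: latticeD (lattice_tau _) (latticeN h).
Qed.

Lemma cder_xi u : ~ L u -> cder xi u (- wp u).
Proof.
move=> /nlattice_regular[_ r1 r2].
have D1 := cder_lam tau_gt0 1 r1; have D2 := cder_rev (cder_lam tau_gt0 1 r2).
apply: cder_eq (cderZ _ (cderD (cderB D1 D2) (cder_cst (1 / 2) u))) _.
by rewrite /wp /p1; ring.
Qed.

Lemma cder_wp u : ~ L u -> cder wp u (wp' u).
Proof.
move=> /nlattice_regular[_ r1 r2].
have D1 := cder_lam tau_gt0 p1 r1; have D2 := cder_rev (cder_lam tau_gt0 p1 r2).
by apply: cder_eq (cderZ _ (cderD D1 D2)) _; rewrite /wp' /p2; ring.
Qed.

Lemma cder_wp' u : ~ L u -> cder wp' u (wp'' u).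
Proof.
move=> /nlattice_regular[_ r1 r2].
have D1 := cder_lam tau_gt0 p2 r1; have D2 := cder_rev (cder_lam tau_gt0 p2 r2).
by apply: cder_eq (cderZ _ (cderB D1 D2)) _; rewrite /wp'' /p3; ring.
Qed.

Lemma lam_opp G u : ~ L u -> lam G (- u) = lam G (tau - u) + tm G (- u).
Proof.
move=> Lu; have [|_ r1 _] := @nlattice_regular (- u); first by move/latticeNE.
by rewrite [tau - u]addrC (lam_shift tau_gt0 G r1) subrK.
Qed.

Lemma xi_opp u : ~ L u -> xi (- u) = - xi u.
Proof.
move=> Lu; have [e1 r1 r2] := nlattice_regular Lu.
rewrite /xi lam_opp // opprK [tau + u]addrC lam_shift // !tm1 al_opp //.
by field.
Qed.

Lemma xiD1 u : xi (u + 1) = xi u.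
Proof.
rewrite /xi lamD1; congr (_ * (_ - _ + _)).
by rewrite -(lamD1 _ _ (tau - (u + 1))); congr lam; ring.
Qed.

Lemma xiDtau u : ~ L u -> xi (u + tau) = xi u - tpi.
Proof.
move=> Lu; have [e1 r1 r2] := nlattice_regular Lu.
have -> : xi (u + tau) = - tpi * (lam 1 (u + tau) - lam 1 (- u) + 1 / 2).
  by rewrite /xi; congr (_ * (_ - lam _ _ + _)); ring.
rewrite lam_opp // lam_shift // !tm1 al_opp // /xi.
by field.
Qed.

Lemma xiD_lattice u (m n : int) : ~ L u ->
  xi (u + (m%:~R * 1 + n%:~R * tau)) = xi u - n%:~R * tpi.
Proof.
move=> Lu.
have L1 (k : int) : L (k%:~R * 1) by exists k, 0; rewrite mul0r addr0.
have Lt (k : int) : L (k%:~R * tau) by exists 0, k; rewrite mul0r add0r.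
have n1 (k : nat) v : xi (v + k%:R) = xi v.
  by elim: k v => [|k IH] v; rewrite ?addr0 // mulrSr addrA xiD1.
have z1 (k : int) v : xi (v + k%:~R) = xi v.
  case: k => k; first exact: n1.
  by rewrite NegzE rmorphN /= -[LHS](n1 k.+1) subrK.
have nt (k : nat) v : ~ L v -> xi (v + k%:R * tau) = xi v - k%:R * tpi.
  elim: k v => [|k IH] v Lv; first by rewrite !mul0r addr0 subr0.
  rewrite mulrSr mulrDl mul1r addrA xiDtau ?IH //; first by ring.
  by move/(latticeDr _ (Lt k)).
have zt (k : int) v : ~ L v -> xi (v + k%:~R * tau) = xi v - k%:~R * tpi.
  case: k => k Lv; first exact: nt.
  rewrite NegzE rmorphN /= !mulNr opprK.
  have := nt k.+1 (v - k.+1%:R * tau); rewrite subrK => -> //.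
    by rewrite subrK.
  by move/(latticeDr _ (latticeN (Lt k.+1))).
rewrite addrCA addrC mulr1 z1 zt //.
Qed.

Lemma tm_p1_opp u : ez u <> 1 -> tm p1 (- u) = tm p1 u.
Proof. by move=> eu; rewrite !tm_p1 al_opp //; ring. Qed.

Lemma wpD1 u : wp (u + 1) = wp u.
Proof.
rewrite /wp lamD1; congr (_ * (_ + _)).
by rewrite -(lamD1 _ _ (tau - (u + 1))); congr lam; ring.
Qed.

Lemma wpDtau u : ~ L u -> wp (u + tau) = wp u.
Proof.
move=> Lu; have [e1 r1 r2] := nlattice_regular Lu.
have -> : wp (u + tau) = tpi * (lam p1 (u + tau) + lam p1 (- u)).
  by rewrite /wp; congr (_ * (_ + lam _ _)); ring.
rewrite lam_opp // lam_shift // tm_p1_opp // /wp.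
by ring.
Qed.

(** The term [n = 0] of [wp], which is [pi ^ 2 / sin (pi u) ^ 2]. *)
Definition wp_pole u : C := tpi ^+ 2 * (al u + al u ^+ 2).

(* The regular part of [wp] at 0 is even, so its derivative vanishes there. *)
Lemma wp_sub_pole : exists k : C, forall e : R, 0 < e ->
  exists2 d : R, 0 < d & forall v, 0 < cn v < d ->
    cn (wp v - wp_pole v - k) <= e * cn v.
Proof.
(* Shifting the first series by [tau] drops its term [n = 0], the only one with a pole at [0]. *)
pose reg u := tpi * (lam p1 (u + tau) + lam p1 (tau - u)).
exists (reg 0).
have rt : regular tau tau by exact: regular_Im.
have dreg : cder reg 0 0.
  have D1 : cder (fun u => lam p1 (u + tau)) 0 (lam p2 tau).
    by apply: cder_shift; rewrite add0r; exact: cder_lam.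
  have D2 : cder (fun u => lam p1 (tau - u)) 0 (- lam p2 tau).
    by apply: cder_rev; rewrite subr0; exact: cder_lam.
  by apply: cder_eq (cderZ _ (cderD D1 D2)) _; rewrite subrr mulr0.
move=> e e0; have [d d0 hd] := (cdercP _ _ _).1 dreg e e0.
have [d' d'0 hd'] := lattice_discrete tau_gt0 0.
exists (Num.min d d'); first by rewrite lt_min d0.
move=> v; rewrite lt_min => /and3P[v0 v1 v2].
have Lv : ~ L v by apply: hd'; rewrite subr0 v0.
have [e1 r1 r2] := nlattice_regular Lv.
have := hd v; rewrite mul0r !subr0 => /(_ v1).
by rewrite /reg lam_shift // tm_p1 /wp /wp_pole; congr (cn _ <= _); ring.
Qed.

(** After the shift by [tpi ^+ 2 / 12], the function [pi ^ 2 / sin (pi u) ^ 2] satisfies a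
    Weierstrass equation with vanishing discriminant (a nodal cubic), so [pole_expansion] applies to
    it as it does to the curve. *)
Lemma wp_pole_expansion : exists B r : R, 0 < r /\ forall v, 0 < cn v < r ->
  cn (wp_pole v + tpi ^+ 2 / 12 - v ^- 2) <= B * cn v ^+ 2.
Proof.
have [d d0 hd] := lattice_discrete tau_gt0 0.
pose X u : C := wp_pole u + tpi ^+ 2 / 12.
pose Y u : C := tpi ^+ 3 * (1 + 2 * al u) * (al u + al u ^+ 2).
apply: (@pole_expansion _ X Y (tpi ^+ 4 / 12) (- tpi ^+ 6 / 216) d d0) => [v|M].
  move=> /andP[v0 vd].
  have Lv : ~ L v by apply: hd; rewrite subr0 v0.
  have [e1 _ _] := nlattice_regular Lv.
  have da := cder_al e1.
  have da2 : cder (fun u => al u + al u ^+ 2) v (tpi * ((1 + 2 * al v) * (al v + al v ^+ 2))).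
    have -> : (fun u : C => al u + al u ^+ 2) = (fun u => al u + al u * al u) by [].
    by apply: cder_eq (cderD da (cderM da da)) _; ring.
  have d12 : cder (fun u => tpi ^+ 3 * (1 + 2 * al u)) v
      (tpi ^+ 3 * (2 * (tpi * (al v + al v ^+ 2)))).
    by apply: cder_eq (cderZ _ (cderD (cder_cst 1 v) (cderZ 2 da))) _; ring.
  split.
  - by apply: cder_eq (cderD (cderZ _ da2) (cder_cst _ v)) _; rewrite /Y; ring.
  - by apply: cder_eq (cderM d12 da2) _; rewrite /X /wp_pole; field.
  - by rewrite /X /Y /wp_pole; field.
pose K := cn (tpi ^+ 2); have K0 : 0 < K by rewrite cn_gt0 expf_neq0 ?tpi_neq0.
pose M' := `|M| + cn (tpi ^+ 2 / 12) + 1.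
have M0 : 0 < M' by rewrite /M'; have := normr_ge0 M; have := cn_ge0 (tpi ^+ 2 / 12); lra.
pose e := Num.min (1 / 2) (K / (8 * M')).
have e0 : 0 < e by rewrite lt_min !divr_gt0 // mulr_gt0.
have [r r0 hr] := (ccontcP _ _).1 (cder_ccont (cder_ez (0 : C))) e e0.
exists (Num.min r d); first by rewrite lt_min r0.
move=> v; rewrite lt_min => /and3P[v0 v1 v2].
have Lv : ~ L v by apply: hd; rewrite subr0 v0.
have [/eqP e1 _ _] := nlattice_regular Lv.
have := hr v; rewrite subr0 ez0 => /(_ v1) hz.
have n0 : 1 - ez v != 0 by rewrite subr_eq0 eq_sym.
have E : al v + al v ^+ 2 = ez v / (1 - ez v) ^+ 2 by rewrite /al; field.
have z1 : 1 / 2 <= cn (ez v).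
  have := cn_triB 1 (ez v); rewrite cn1 cnB.
  have : e <= 1 / 2 by rewrite ge_min lexx.
  lra.
have big : M' <= cn (wp_pole v).
  rewrite /wp_pole E cnM -/K [cn (ez v / _)]cnM cnV cnX mulrA.
  rewrite ler_pdivlMr; last by rewrite exprn_gt0 // cn_gt0.
  rewrite cnB; set t := cn (ez v - 1) in hz *.
  have t0 : 0 <= t by exact: cn_ge0.
  have te : t ^+ 2 <= e ^+ 2 by rewrite ler_pXn2r ?nnegrE // ltW.
  have e2 : e ^+ 2 <= 1 * (K / (8 * M')).
    rewrite expr2; apply: ler_pM; rewrite ?(ltW e0) //.
      by rewrite ge_min; apply/orP; left; lra.
    by rewrite ge_min lexx orbT.
  have : M' * t ^+ 2 <= M' * (K / (8 * M')).
    by rewrite ler_pM2l //; lra.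
  rewrite (_ : M' * (K / (8 * M')) = K / 8); last by field; rewrite gt_eqF.
  have : K * (1 / 2) <= K * cn (ez v) by rewrite ler_pM2l.
  lra.
have := cn_triB (wp_pole v) (- (tpi ^+ 2 / 12)); rewrite cnN opprK.
have := ler_norm M; rewrite /M' in big; rewrite /X; lra.
Qed.

End Zeta.

(** * Comparison with a uniformized Weierstrass curve *)

(** Isolates the [l] of [ecadd], so that the analytic and the algebraic parts of the argument speak
    of the same quantity. *)
Definition slope (K : numFieldType) (E : weierstrass K) (P Q : ecpoint K) : K :=
  match P, Q with
  | Some (x1, y1), Some (x2, y2) =>
    if x1 == x2 then
      (3 * x1 ^+ 2 + 2 * wa2 E * x1 + wa4 E - wa1 E * y1)
      / (2 * y1 + wa1 E * x1 + wa3 E)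
    else (y2 - y1) / (x2 - x1)
  | _, _ => 0
  end.

Lemma ccont_eq_punctured (R : realType) (f g : R[i] -> R[i]) u (d : R) : 0 < d ->
  ccont f u -> ccont g u -> (forall v, 0 < cn (v - u) < d -> f v = g v) -> f u = g u.
Proof.
move=> d0 cf cg fg; apply/eqP; rewrite -subr_eq0 -cn_eq0; apply: contraT => ne.
have e0 : 0 < cn (f u - g u) by rewrite lt_neqAle eq_sym ne cn_ge0.
have ch := ccontD cf (ccontN cg).
have [r r0 hr] := (ccontcP _ _).1 ch _ e0.
pose t := Num.min d r / 2; have m0 : 0 < Num.min d r by rewrite lt_min d0.
have t0 : 0 < t by rewrite divr_gt0.
have tm : t < Num.min d r by rewrite /t; lra.
move: tm; rewrite lt_min => /andP[td tr].
have ct : cn (u + t%:C - u) = t by rewrite addrAC subrr add0r cnR gtr0_norm.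
have := hr (u + t%:C); rewrite ct => /(_ tr).
by rewrite fg ?ct ?t0 // subrr sub0r cnN ltxx.
Qed.

Section Uniformization.
Variables (R : realType) (tau : R[i]).
Hypothesis tau_gt0 : 0 < Im tau.
Local Notation C := R[i].
Local Notation L := (lattice 1 tau).
Variables (E : weierstrass C) (c : C) (phi : C -> ecpoint C).
Hypothesis c_neq0 : c != 0.
Hypothesis phiU : uniformizes E c 1 tau phi.
Implicit Types (u v w p : C).

Local Notation a1 := (wa1 E).
Local Notation a2 := (wa2 E).
Local Notation a3 := (wa3 E).
Local Notation a4 := (wa4 E).
Local Notation a6 := (wa6 E).
Local Notation x u := (xcoord (phi u)).
Local Notation y u := (ycoord (phi u)).
Local Notation eta u := (2 * y u + a1 * x u + a3).
Local Notation num u := (3 * x u ^+ 2 + 2 * a2 * x u + a4 - a1 * y u).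

Lemma phiD u v : phi (u + v) = ecadd E (phi u) (phi v).
Proof. by case: phiU. Qed.

Lemma phi_None u : phi u = None <-> L u.
Proof. by case: phiU => _ _ _ h _; exact: h. Qed.

Lemma phi_Some u : ~ L u -> phi u = Some (x u, y u).
Proof. by case E1 : (phi u) => [[a b]|] Lu //=; case: Lu; apply/phi_None. Qed.

Lemma phi_curve u : ~ L u ->
  y u ^+ 2 + a1 * x u * y u + a3 * y u = x u ^+ 3 + a2 * x u ^+ 2 + a4 * x u + a6.
Proof. by move=> /phi_Some Pu; case: phiU => /(_ u) + _ _ _ _; rewrite {1}Pu. Qed.

Lemma phi_periodic u p : L p -> phi (u + p) = phi u.
Proof. by move=> /phi_None Pp; rewrite phiD Pp; case: (phi u) => [[]|]. Qed.

Lemma phi_opp u : ~ L u -> x (- u) = x u /\ y (- u) = - y u - a1 * x u - a3.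
Proof.
move=> Lu; have Lu' : ~ L (- u) by move/latticeNE.
have := phiD u (- u); rewrite subrr (phi_Some Lu) (phi_Some Lu').
rewrite (phi_None 0).2 /=; last exact: lattice0.
case: ifP => // /andP[/eqP -> /eqP h] _; split=> //.
apply/eqP; rewrite -subr_eq0; apply/eqP; rewrite -h; ring.
Qed.

(** Subtracting the curve equations at [u] and [v] factors into two conditions on the ordinates; by
    the group law one says [phi (u - v) = None], the other [phi (u + v) = None]. *)
Lemma x_eqP u v : ~ L u -> ~ L v -> x u = x v -> L (u - v) \/ L (u + v).
Proof.
move=> Lu Lv xuv.
have : (y u - y v) * (y u + y v + a1 * x v + a3) = 0.
  have h1 := phi_curve Lu; have h2 := phi_curve Lv; rewrite xuv in h1.
  rewrite [LHS](_ : _ = (y u ^+ 2 + a1 * x v * y u + a3 * y u) -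
     (y v ^+ 2 + a1 * x v * y v + a3 * y v)); last by ring.
  by rewrite h1 h2 subrr.
move/eqP; rewrite mulf_eq0 => /orP[|] /eqP h; [left|right]; apply/phi_None.
- have Lv' : ~ L (- v) by move/latticeNE.
  rewrite phiD (phi_Some Lu) (phi_Some Lv') /=; have [-> ->] := phi_opp Lv.
  rewrite xuv eqxx /= ifT //; apply/eqP; rewrite -[RHS]h; ring.
- by rewrite phiD (phi_Some Lu) (phi_Some Lv) /= xuv eqxx h eqxx.
Qed.

Lemma eta_neq0 u : ~ L u -> ~ L (u + u) -> eta u != 0.
Proof.
move=> Lu L2; apply/eqP => h; apply: L2; apply/phi_None.
rewrite phiD (phi_Some Lu) /= eqxx /= ifT //; apply/eqP; rewrite -[RHS]h; ring.
Qed.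

Lemma cder_of_holo (f : C -> C) u : holo_at f u -> cder f u (cderive f u).
Proof. by move=> df; apply/cder_isderive; split. Qed.

Lemma cder_x u : ~ L u -> cder (fun v => x v) u (eta u / c).
Proof.
move=> Lu; case: phiU => _ _ _ _ /(_ u Lu)[hx _ h].
by apply: cder_eq (cder_of_holo hx) _; rewrite -h mulrC mulKf.
Qed.

Lemma cder_y_exists u : ~ L u -> exists l, cder (fun v => y v) u l.
Proof.
move=> Lu; case: phiU => _ _ _ _ /(_ u Lu)[_ hy _].
by exists (cderive (fun v => y v) u); exact: cder_of_holo.
Qed.

(** Differentiate the curve equation along [phi] and cancel [eta u]. *)
Lemma cder_y_generic u : ~ L u -> eta u != 0 -> cder (fun v => y v) u (num u / c).
Proof.
move=> Lu eu; have [l dy] := cder_y_exists Lu; have dx := cder_x Lu.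
suff <- : l = num u / c by [].
pose F v := y v * y v + a1 * (x v * y v) + a3 * y v.
pose G v := x v * (x v * x v) + a2 * (x v * x v) + a4 * x v + a6.
have dF : cder F u ((l * y u + y u * l) + a1 * (eta u / c * y u + x u * l) + a3 * l).
  exact: cderD (cderD (cderM dy dy) (cderZ a1 (cderM dx dy))) (cderZ a3 dy).
have dG : cder G u (eta u / c * (x u * x u) + x u * (eta u / c * x u + x u * (eta u / c))
    + a2 * (eta u / c * x u + x u * (eta u / c)) + a4 * (eta u / c) + 0).
  exact: cderD (cderD (cderD (cderM dx (cderM dx dx)) (cderZ a2 (cderM dx dx)))
    (cderZ a4 dx)) (cder_cst a6 u).
have [d d0 hd] := lattice_complement_open tau_gt0 Lu.
have FG v : cn (v - u) < d -> F v = G v.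
  move=> /hd /phi_curve h; rewrite /F /G.
  rewrite [LHS](_ : _ = y v ^+ 2 + a1 * x v * y v + a3 * y v); last by ring.
  by rewrite h; ring.
have := cder_unique (cder_nearc d0 FG dF) dG => h.
apply: (mulfI eu); apply/eqP; rewrite -subr_eq0; apply/eqP.
rewrite [LHS](_ : _ = (l * y u + y u * l + a1 * (eta u / c * y u + x u * l) + a3 * l) -
   (eta u / c * (x u * x u) + x u * (eta u / c * x u + x u * (eta u / c))
    + a2 * (eta u / c * x u + x u * (eta u / c)) + a4 * (eta u / c) + 0)).
  by rewrite h subrr.
by field.
Qed.

(** At 2-torsion points [eta] vanishes and implicit differentiation fails; these points are
    isolated, so the formula extends by continuity of [num]. *)
Lemma cder_y u : ~ L u -> cder (fun v => y v) u (num u / c).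
Proof.
move=> Lu; have [d d0 hd] := lattice_discrete tau_gt0 (u + u).
have [d' d'0 hd'] := lattice_complement_open tau_gt0 Lu.
have cx := cder_ccont (cder_x Lu).
have [l /cder_ccont cy] := cder_y_exists Lu.
(* The radius is [d / 2] because doubling [v - u] must stay within [d]. *)
apply: (@cder_limit _ _ (fun v => num v / c) _ _ (Num.min (d / 2) d')) => //.
- by rewrite lt_min d'0 divr_gt0.
- move=> v; rewrite lt_min => /and3P[v0 v1 v2].
  have Lv := hd' v v2; apply: cder_y_generic => //; apply: eta_neq0 => //.
  apply: hd; rewrite (_ : v + v - (u + u) = 2 * (v - u)); last by ring.
  by rewrite cnM cn_nat mulr_gt0 //=; lra.
- move=> e e0; have : ccont (fun v => num v / c) u.
    have -> : (fun v => num v / c) =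
        (fun v => (3 * (x v * x v) + 2 * a2 * x v + a4 - a1 * y v) / c) by [].
    have c3 := ccontM (@ccont_cst _ 3 u) (ccontM cx cx).
    have c2 := ccontM (@ccont_cst _ (2 * a2) u) cx.
    have c1 := ccontN (ccontM (@ccont_cst _ a1 u) cy).
    have c4 := ccontD (ccontD (ccontD c3 c2) (@ccont_cst _ a4 u)) c1.
    exact: (ccontM c4 (@ccont_cst _ c^-1 u)).
  move=> /ccontcP/(_ e e0)[r r0 hr]; exists r => // v /andP[_ vr].
  exact: ltW (hr v vr).
Qed.

(** Completing the cube by [s] and scaling by powers of [c] turns the curve into
    [Y ^ 2 = 4 X ^ 3 - g2 X - g3] with [X' = Y]. *)
Let s : C := wb2 E / 12.
Definition wW u : C := (x u + s) / c ^+ 2.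
Definition wW' u : C := eta u / c ^+ 3.
Let g2 : C := (12 * s ^+ 2 - 2 * wb4 E) / c ^+ 4.
Let g3 : C := - (8 * s ^+ 3 - 2 * wb4 E * s + wb6 E) / c ^+ 6.

Lemma cder_wW u : ~ L u -> cder wW u (wW' u).
Proof.
move=> Lu; apply: cder_eq (cderM (cderD (cder_x Lu) (cder_cst s u)) (cder_cst _ u)) _.
by rewrite /wW'; field.
Qed.

Lemma cder_wW' u : ~ L u -> cder wW' u (6 * wW u ^+ 2 - g2 / 2).
Proof.
move=> Lu.
have dx := cder_x Lu; have dy := cder_y Lu.
have D := cderM (cderD (cderD (cderZ 2 dy) (cderZ a1 dx)) (cder_cst a3 u))
  (cder_cst (c ^- 3) u).
apply: cder_eq D _; rewrite /wW /g2 /s /wb2 /wb4; field.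
exact: c_neq0.
Qed.

Lemma wW_cubic u : ~ L u -> wW' u ^+ 2 = 4 * wW u ^+ 3 - g2 * wW u - g3.
Proof.
move=> Lu; have h := phi_curve Lu.
apply/eqP; rewrite -subr_eq0; apply/eqP.
rewrite [LHS](_ : _ = 4 / c ^+ 6 *
  ((y u ^+ 2 + a1 * x u * y u + a3 * y u) - (x u ^+ 3 + a2 * x u ^+ 2 + a4 * x u + a6))).
  by rewrite h subrr mulr0.
by rewrite /wW' /wW /g2 /g3 /s /wb2 /wb4 /wb6; field.
Qed.

Lemma half_notin_lattice : ~ L (1 / 2).
Proof.
move=> [m [n h]]; have [rE iE] := lattice_ReIm tau m n; rewrite -h in rE iE.
have half : (1 / 2 : C) = (1 / 2 : R)%:C by rewrite rmorphM fmorphV rmorph1 rmorph_nat.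
rewrite half /= in rE iE.
have n0 : n%:~R = 0 :> R.
  by apply/eqP; move/esym/eqP: iE; rewrite mulf_eq0 (gt_eqF tau_gt0) orbF.
rewrite n0 mul0r addr0 in rE.
have : (m * 2)%:~R = 1%:~R :> R by rewrite intrM -rE; field.
by move/eqP; rewrite eqr_int => /eqP; case: (m) => k; lia.
Qed.

(* [phi u = phi (u + w) - phi w] with [w] away from the 2-torsion exhibits the
   abscissa of [phi u] as a secant slope squared that blows up when [u -> 0]. *)
Lemma wW_infty (M : R) : exists2 r : R, 0 < r & forall v, 0 < cn v < r -> M <= cn (wW v).
Proof.
(* Chosen so that [w + w = 1 / 2] is not a period, hence [eta w != 0]. *)
pose w : C := 1 / 4.
have w2 : w + w = 1 / 2 by rewrite /w; field.
have L2w : ~ L (w + w) by rewrite w2; exact: half_notin_lattice.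
have Lw : ~ L w by move=> h; apply: L2w; exact: latticeD.
have Lw' : ~ L (- w) by move/latticeNE.
have e0 := eta_neq0 Lw L2w; set e := eta w in e0.
have en : 0 < cn e by rewrite cn_gt0.
have [xw yw] := phi_opp Lw.
pose K := `|M| * cn (c ^+ 2) + cn s + cn a2 + 2 * cn (x w) + 1.
(* If [cn l >= La] then [cn l * (cn l - cn a1) >= K + 1], and [K] pays for all remaining terms of
   the addition formula. *)
pose La := cn a1 + K + 1.
have K0 : 0 <= K.
  have := mulr_ge0 (normr_ge0 M) (cn_ge0 (c ^+ 2)).
  by have := cn_ge0 s; have := cn_ge0 a2; have := cn_ge0 (x w); rewrite /K; lra.
have La0 : 0 < La by rewrite /La; have := cn_ge0 a1; lra.
have e2 : 0 < cn e / 2 by rewrite divr_gt0.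
have [d1 d10 h1] := lattice_complement_open tau_gt0 Lw.
have [d2 d20 h2] := (ccontcP _ _).1 (cder_ccont (cder_y Lw)) _ e2.
have m0 : 0 < Num.min 1 (cn e / 2 / La) by rewrite lt_min ltr01 divr_gt0.
have [d3 d30 h3] := (ccontcP _ _).1 (cder_ccont (cder_x Lw)) _ m0.
have [d4 d40 h4] := lattice_discrete tau_gt0 0.
exists (Num.min (Num.min d1 d2) (Num.min d3 d4)); first by rewrite !lt_min d10 d20 d30.
move=> v; rewrite !lt_min => /and3P[v0 /andP[v1 v2] /andP[v3 v4]].
have vw : v + w - w = v by ring.
have Lvw : ~ L (v + w) by apply: h1; rewrite vw.
have {h2} h2 : cn (y (v + w) - y w) < cn e / 2 by apply: h2; rewrite vw.
have /andP[h31 h32] : (cn (x (v + w) - x w) < 1) && (cn (x (v + w) - x w) < cn e / 2 / La).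
  by rewrite -lt_min; apply: h3; rewrite vw.
have Lv : ~ L v by apply: h4; rewrite subr0 v0.
have yy : y (- w) - y w = - e by rewrite yw /e; ring.
have ne : x (v + w) != x w.
  apply/eqP => /(x_eqP Lvw Lw)[|]; rewrite ?vw // => Lvww.
  have xv : phi (v + w) = phi (- w).
    by rewrite -(phi_periodic (- w) Lvww); congr phi; ring.
  by move: h2; rewrite xv yy cnN; lra.
pose l := (y (- w) - y (v + w)) / (x w - x (v + w)).
have xE : x v = l ^+ 2 + a1 * l - a2 - x (v + w) - x w.
  have := phiD (v + w) (- w); rewrite vw (phi_Some Lvw) (phi_Some Lw') /= xw.
  by rewrite (negPf ne) /= => ->.
have lbig : La <= cn l.
  rewrite /l cnM cnV ler_pdivlMr; last by rewrite cn_gt0 subr_eq0 eq_sym.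
  have n1 : cn e / 2 <= cn (y (- w) - y (v + w)).
    have := cn_triB (y (- w) - y w) (y (v + w) - y w).
    rewrite (_ : y (- w) - y w - _ = y (- w) - y (v + w)); last by ring.
    rewrite yy cnN; lra.
  apply: le_trans n1; rewrite cnB mulrC -ler_pdivlMr //; exact: ltW.
have xbig : `|M| * cn (c ^+ 2) + cn s <= cn (x v).
  have p1 : cn (x (v + w)) <= cn (x w) + 1.
    have := cnD (x (v + w) - x w) (x w); rewrite subrK; lra.
  have p2 : cn l * cn l - cn a1 * cn l <= cn (l ^+ 2 + a1 * l).
    have := cn_triB (l ^+ 2) (- (a1 * l)); rewrite opprK cnN cnX cnM expr2.
    by apply: le_trans.
  have p3 : cn (l ^+ 2 + a1 * l) <= cn (x v) + (cn a2 + cn (x (v + w)) + cn (x w)).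
    rewrite (_ : l ^+ 2 + a1 * l = x v + (a2 + x (v + w) + x w)); last by rewrite xE; ring.
    apply: le_trans (cnD _ _) _; rewrite lerD2l.
    by apply: le_trans (cnD _ _) _; rewrite lerD2r; exact: cnD.
  have p4 : K + 1 <= cn l * (cn l - cn a1).
    have q1 : K + 1 <= cn l - cn a1 by move: lbig; rewrite /La; lra.
    have q2 : 1 <= cn l by have := cn_ge0 a1; lra.
    by rewrite -[K + 1]mul1r; apply: ler_pM => //; lra.
  rewrite mulrBr in p4; move: p4; rewrite /K; lra.
rewrite /wW cnM cnV ler_pdivlMr; last by rewrite cn_gt0 expf_neq0.
apply: le_trans (_ : _ <= `|M| * cn (c ^+ 2)) _.
  by rewrite ler_wpM2r ?cn_ge0 // ler_norm.
have := cn_triB (x v) (- s); rewrite opprK cnN; lra.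
Qed.

Lemma wW_wp : exists h0 : C, forall u, ~ L u -> wp tau u = wW u - h0.
Proof.
have [d d0 hd] := lattice_discrete tau_gt0 0.
have [||B1 [r1 [r10 H1]]] := @pole_expansion _ wW wW' g2 g3 d d0.
- move=> v vd; have Lv : ~ L v by apply: hd; rewrite subr0.
  by split; [exact: cder_wW|exact: cder_wW'|exact: wW_cubic].
- exact: wW_infty.
have [B2 [r2 [r20 H2]]] := wp_pole_expansion tau_gt0.
have [k hk] := wp_sub_pole tau_gt0.
(* The limit of [wW - wp] at [0]: [wW] has constant term [0], and [wp] has constant term
   [k - tpi ^ 2 / 12]. *)
pose h0 := tpi R ^+ 2 / 12 - k; exists h0.
suff H u : ~ L u -> wW u - wp tau u = h0 by move=> u /H <-; ring.
apply: (@torus_liouville _ _ tau_gt0 (fun v => wW v - wp tau v) (fun v => wW' v - wp' tau v)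
   (fun v => 6 * wW v ^+ 2 - g2 / 2 - wp'' tau v)).
- apply: lattice_periodic => v Lv.
    by rewrite wpD1 /wW phi_periodic //; exact: lattice1.
  by rewrite wpDtau // /wW phi_periodic //; exact: lattice_tau.
- by move=> v Lv; apply: cderB; [exact: cder_wW|exact: cder_wp].
- by move=> v Lv; apply: cderB; [exact: cder_wW'|exact: cder_wp'].
move=> e e0; have e2 : 0 < e / 2 by rewrite divr_gt0.
have [r3 r30 H3] := hk _ e2.
pose B := `|B1| + `|B2| + 1; have B0 : 0 < B.
  by rewrite /B; have := normr_ge0 B1; have := normr_ge0 B2; lra.
exists (Num.min (Num.min r1 r2) (Num.min r3 (e / 2 / B))).
  by rewrite !lt_min r10 r20 r30 divr_gt0.
move=> v; rewrite !lt_min => /and3P[v0 /andP[v1 v2] /andP[v3 v4]].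
have {H1} := H1 v; rewrite v0 v1 => /(_ isT) H1.
have {H2} := H2 v; rewrite v0 v2 => /(_ isT) H2.
have {H3} := H3 v; rewrite v0 v3 => /(_ isT) H3.
rewrite (_ : _ - _ - h0 = (wW v - v ^- 2) - (wp_pole v + tpi R ^+ 2 / 12 - v ^- 2)
  - (wp tau v - wp_pole v - k)); last by rewrite /h0; ring.
apply: le_trans (cnD _ _) _; rewrite cnN.
have := cnD (wW v - v ^- 2) (- (wp_pole v + tpi R ^+ 2 / 12 - v ^- 2)); rewrite cnN.
have : B * cn v ^+ 2 <= e / 2 * cn v.
  rewrite expr2 mulrA ler_pM2r // mulrC -ler_pdivlMr //; exact: ltW.
have : 0 <= cn v ^+ 2 by rewrite sqr_ge0.
set t := cn v ^+ 2 in H1 H2 * => t0.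
have : B1 * t <= `|B1| * t by rewrite ler_wpM2r // ler_norm.
have : B2 * t <= `|B2| * t by rewrite ler_wpM2r // ler_norm.
rewrite /B !mulrDl mul1r; lra.
Qed.


Local Notation xi := (xi tau).
Local Notation xi_slope u v :=
  (xi (u + v) - xi u - xi v - (slope E (phi u) (phi v) + a1 / 2) / c).

(** The derivative of [xi (u + v) - xi u] is [(x u - x (u + v)) / c ^ 2], the constant [h0]
    cancelling. Insert the addition law for [x (u + v)]: what remains is a multiple of the
    difference of the curve equations at [u] and [v]. *)
Lemma cder_xi_slope u v : ~ L u -> ~ L v -> ~ L (u + v) -> ~ L (u - v) ->
  cder (fun z => xi_slope z v) u 0.
Proof.
move=> Lu Lv Lp Lm; have [h0 hW] := wW_wp.
have nx z : ~ L z -> ~ L (z + v) -> ~ L (z - v) -> x z != x v.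
  by move=> Lz Lzp Lzm; apply/eqP => /(x_eqP Lz Lv)[].
have sE z : ~ L z -> ~ L (z + v) -> ~ L (z - v) ->
    slope E (phi z) (phi v) = (y v - y z) / (x v - x z).
  move=> Lz Lzp Lzm; rewrite (phi_Some Lz) (phi_Some Lv) /=.
  by rewrite (negPf (nx _ Lz Lzp Lzm)).
have [d1 d10 h1] := lattice_complement_open tau_gt0 Lu.
have [d2 d20 h2] := lattice_complement_open tau_gt0 Lp.
have [d3 d30 h3] := lattice_complement_open tau_gt0 Lm.
have n0 : x v - x u != 0 by rewrite subr_eq0 eq_sym nx.
have dx := cderB (cder_cst (x v) u) (cder_x Lu).
have dy := cderB (cder_cst (y v) u) (cder_y Lu).
have dq := @cder_div _ (fun z => y v - y z) (fun z => x v - x z) _ _ _ n0 dy dx.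
have ds := cderM (cderD dq (cder_cst (a1 / 2) u)) (cder_cst c^-1 u).
have dxi := cderB (cderB (cder_shift (cder_xi tau_gt0 Lp)) (cder_xi tau_gt0 Lu))
  (cder_cst (xi v) u).
apply: (@cder_nearc _ _ _ _ _ (Num.min d1 (Num.min d2 d3))) (cder_eq (cderB dxi ds) _).
- by rewrite !lt_min d10 d20.
- move=> z; rewrite !lt_min => /and3P[z1 z2 z3]; rewrite sE //; first exact: h1.
    by apply: h2; rewrite (_ : z + v - (u + v) = z - u) //; ring.
  by apply: h3; rewrite (_ : z - v - (u - v) = z - u) //; ring.
rewrite !hW // /wW.
have -> : x (u + v) = ((y v - y u) / (x v - x u)) ^+ 2 + a1 * ((y v - y u) / (x v - x u))
    - a2 - x u - x v.
  by rewrite phiD (phi_Some Lu) (phi_Some Lv) /= (negPf (nx _ Lu Lp Lm)) /=.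
have F1 := phi_curve Lu; have F2 := phi_curve Lv.
apply/eqP; rewrite -subr_eq0; apply/eqP.
rewrite [LHS](_ : _ = - (c ^- 2 / (x v - x u) ^+ 2) *
  (((y v ^+ 2 + a1 * x v * y v + a3 * y v) - (x v ^+ 3 + a2 * x v ^+ 2 + a4 * x v + a6))
  - ((y u ^+ 2 + a1 * x u * y u + a3 * y u) - (x u ^+ 3 + a2 * x u ^+ 2 + a4 * x u + a6)))).
  by rewrite F1 F2 !subrr mulr0.
by field; rewrite c_neq0 n0.
Qed.

(** Negation is the affine map [y -> - y - a1 x - a3], which carries a line of slope [l] to one of
    slope [- l - a1]. *)
Lemma slope_opp u v : ~ L u -> ~ L v -> ~ L (u + v) -> ~ L (u - v) ->
  slope E (phi (- u)) (phi (- v)) = - slope E (phi u) (phi v) - a1.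
Proof.
move=> Lu Lv Lp Lm.
have Lu' : ~ L (- u) by move/latticeNE.
have Lv' : ~ L (- v) by move/latticeNE.
have ne : x u != x v by apply/eqP => /(x_eqP Lu Lv)[].
rewrite (phi_Some Lu) (phi_Some Lv) (phi_Some Lu') (phi_Some Lv') /=.
have [-> ->] := phi_opp Lu; have [-> ->] := phi_opp Lv.
rewrite (negPf ne); field.
by rewrite subr_eq0 eq_sym.
Qed.

Lemma slopeC u v : ~ L u -> ~ L v -> ~ L (u + v) -> ~ L (u - v) ->
  slope E (phi u) (phi v) = slope E (phi v) (phi u).
Proof.
move=> Lu Lv Lp Lm; have ne : x u != x v by apply/eqP => /(x_eqP Lu Lv)[].
rewrite (phi_Some Lu) (phi_Some Lv) /= [x v == _]eq_sym (negPf ne).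
have n1 : x u - x v != 0 by rewrite subr_eq0.
have n2 : x v - x u != 0 by rewrite subr_eq0 eq_sym.
by field; rewrite n1 n2.
Qed.

(* [xi_slope] is locally constant in each variable off a countable set,
   symmetric, and odd under [(u, v) -> (- u, - v)]. *)
Lemma xi_add_generic u v : ~ L u -> ~ L v -> ~ L (u + v) -> ~ L (u - v) ->
  xi (u + v) = xi u + xi v + (slope E (phi u) (phi v) + a1 / 2) / c.
Proof.
move=> Lu Lv Lp Lm.
have cst z z' w : ~ L z -> ~ L w -> ~ L (z + w) -> ~ L (z - w) ->
    ~ L z' -> ~ L (z' + w) -> ~ L (z' - w) -> xi_slope z w = xi_slope z' w.
  move=> Lz Lw Lzp Lzm Lz' Lzp' Lzm'.
  (* Enumerates the three cosets [L], [w + L] and [- w + L], where the derivative of [xi_slope] in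
     its first variable is not controlled. *)
  pose D (k : (int * int) * 'I_3) : C := k.1.1%:~R * 1 + k.1.2%:~R * tau +
    (if k.2 == 0 :> nat then 0 else if k.2 == 1%N :> nat then w else - w).
  have DP t : ~ L t -> ~ L (t + w) -> ~ L (t - w) -> forall k, t <> D k.
    move=> Lt Ltp Ltm [[m n] [i hi]] tE; rewrite /D /= in tE.
    have Lmn : L (m%:~R * 1 + n%:~R * tau) by exists m, n.
    move: hi tE; case: i => [|[|[|//]]] _ /= tE.
    - by apply: Lt; rewrite tE addr0.
    - by apply: Ltm; rewrite tE addrK.
    - by apply: Ltp; rewrite tE subrK.
  apply: (@cder0_off_countable R _ D (fun z => xi_slope z w)); try exact: DP.
  move=> t ht.
  have Lt : ~ L t.
    move=> [m [n tE]]; apply: (ht ((m, n), ord0)).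
    by rewrite /D /= addr0.
  have Ltm : ~ L (t - w).
    move=> [m [n tE]]; apply: (ht ((m, n), inord 1)).
    by rewrite /D /= inordK //= -tE subrK.
  have Ltp : ~ L (t + w).
    move=> [m [n tE]]; apply: (ht ((m, n), inord 2)).
    by rewrite /D /= inordK //= -tE addrK.
  exact: cder_xi_slope.
have LN z : ~ L z -> ~ L (- z) by move=> Lz /latticeNE.
have L3 : ~ L (v - u) by rewrite -opprB; exact: LN.
have L1 : ~ L (- u + v) by rewrite addrC.
have L2 : ~ L (- u - v) by rewrite -opprD; exact: LN.
have L4 : ~ L (- v - u) by rewrite addrC.
have L5 : ~ L (- u - - v) by rewrite opprK.
have L6 : ~ L (v - - u) by rewrite opprK addrC.
have L7 : ~ L (- v - - u) by rewrite opprK addrC.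
have L8 : ~ L (- u + - v) by [].
have sym z w : ~ L z -> ~ L w -> ~ L (z + w) -> ~ L (z - w) -> xi_slope z w = xi_slope w z.
  move=> Lz Lw Lzp Lzm; rewrite (slopeC Lz Lw) // [z + w]addrC; ring.
have E1 : xi_slope u v = xi_slope (- u) v by apply: cst => //; exact: LN.
have E2 : xi_slope (- u) v = xi_slope v (- u) by apply: sym => //; exact: LN.
have E3 : xi_slope v (- u) = xi_slope (- v) (- u) by apply: cst => //; exact: LN.
have E4 : xi_slope (- v) (- u) = xi_slope (- u) (- v) by apply: sym => //; exact: LN.
have E5 : xi_slope (- u) (- v) = - xi_slope u v.
  rewrite slope_opp // -opprD !xi_opp //; by field.
have ES : xi_slope u v = - xi_slope u v by rewrite {1}E1 E2 E3 E4 E5.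
have h : xi_slope u v = 0.
  move: ES; set S := xi_slope u v => ES; apply/eqP.
  have : 2 * S == 0 by rewrite (_ : 2 * S = S + S); [rewrite {1}ES addNr|ring].
  by rewrite mulf_eq0 pnatr_eq0.
by apply/eqP; rewrite -subr_eq0 -h; apply/eqP; ring.
Qed.

(** Let [v] tend to [u] in the generic formula. With the Caratheodory quotients [X] and [Y] of [x]
    and [y], the chord slope is exactly [Y v / X v], continuous at [v = u] with the tangent slope as
    value. *)
Lemma xi_double u : ~ L u -> ~ L (u + u) ->
  xi (u + u) = xi u + xi u + (slope E (phi u) (phi u) + a1 / 2) / c.
Proof.
move=> Lu L2.
have [X [hX cX X0]] := cder_x Lu; have [Y [hY cY Y0]] := cder_y Lu.
have e0 := eta_neq0 Lu L2.
have Xn : X u != 0 by rewrite X0 mulf_neq0 ?invr_eq0.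
have sE : slope E (phi u) (phi u) = Y u / X u.
  by rewrite (phi_Some Lu) /= eqxx X0 Y0; field; rewrite e0 c_neq0.
rewrite sE.
have [d1 d10 h1] := lattice_discrete tau_gt0 0.
have [d2 d20 h2] := lattice_complement_open tau_gt0 Lu.
have [d3 d30 h3] := lattice_complement_open tau_gt0 L2.
apply: (@ccont_eq_punctured _ (fun v => xi (u + v))
   (fun v => xi u + xi v + (Y v / X v + a1 / 2) / c) u (Num.min d1 (Num.min d2 d3))).
- by rewrite !lt_min d10 d20.
- apply: (@cder_ccont _ _ _ (- wp tau (u + u))).
  rewrite (_ : (fun v => xi (u + v)) = fun v => xi (v + u)).
    exact: cder_shift (cder_xi tau_gt0 L2).
  by apply/funext => v; rewrite addrC.
- have c1 := ccontD (@ccont_cst _ (xi u) u) (cder_ccont (cder_xi tau_gt0 Lu)).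
  have c2 := ccontD (ccontM cY (ccontV Xn cX)) (@ccont_cst _ (a1 / 2) u).
  exact: (ccontD c1 (ccontM c2 (@ccont_cst _ c^-1 u))).
- move=> v; rewrite !lt_min => /and4P[v0 v1 v2 v3].
  have Lv : ~ L v by exact: h2.
  have Luv : ~ L (u + v) by apply: h3; rewrite (_ : u + v - (u + u) = v - u) //; ring.
  have Lm : ~ L (v - u) by apply: h1; rewrite subr0 v0.
  have Lm' : ~ L (u - v) by rewrite -opprB => /latticeNE.
  rewrite xi_add_generic // (phi_Some Lu) (phi_Some Lv) /=.
  have ne : x u != x v by apply/eqP => /(x_eqP Lu Lv)[].
  rewrite (negPf ne) (hX v) (hY v).
  have vu : v - u != 0 by rewrite -cn_gt0.
  have Xv : X v != 0.
    move: ne; rewrite (hX v) -subr_eq0 opprD addrA subrr sub0r oppr_eq0.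
    by rewrite mulf_eq0 negb_or => /andP[].
  have -> : y u + Y v * (v - u) - y u = Y v * (v - u) by ring.
  have -> : x u + X v * (v - u) - x u = X v * (v - u) by ring.
  by rewrite -mulf_div (divff vu) mulr1.
Qed.

(** The remaining case is [u] congruent to [v], where both sides of the doubling formula change by
    the same quasi-period. *)
Lemma xi_add u v : ~ L u -> ~ L v -> ~ L (u + v) ->
  xi (u + v) = xi u + xi v + (slope E (phi u) (phi v) + a1 / 2) / c.
Proof.
move=> Lu Lv Lp; have [Lm|Lm] := pselect (L (u - v)); last exact: xi_add_generic.
have uE : u = v + (u - v) by rewrite addrC subrK.
have Pu : phi u = phi v by rewrite uE phi_periodic.
have L2 : ~ L (v + v).
  by move=> h; apply: Lp; rewrite uE addrAC; exact: latticeD.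
move: Lm => [m [n mn]]; rewrite Pu uE addrAC mn.
rewrite !xiD_lattice // xi_double //; ring.
Qed.

Lemma xi_torsion (N : nat) u : (1 < N)%N -> L (N%:R * u) ->
  (forall k, (0 < k < N)%N -> ~ L (k%:R * u)) ->
  exists n : int, - (N%:R * xi u) = n%:~R * tpi R +
    \sum_(1 <= k < N.-1) (slope E (phi u) (phi (k%:R * u)) + a1 / 2) / c.
Proof.
move=> N1 [m [n mn]] Lk.
have Lu : ~ L u by have := Lk 1%N; rewrite mul1r; apply; rewrite N1.
have step k : (0 < k < N)%N -> xi (k%:R * u) = k%:R * xi u +
    \sum_(1 <= j < k) (slope E (phi u) (phi (j%:R * u)) + a1 / 2) / c.
  elim: k => [//|[|k] IH] kN; first by rewrite !mul1r big_geq // addr0.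
  have kN' : (0 < k.+1 < N)%N by case/andP: kN => _ /ltnW.
  have kE : k.+2%:R * u = u + k.+1%:R * u by rewrite [k.+2%:R]mulrSr; ring.
  rewrite kE xi_add //; [|exact: Lk|by rewrite -kE; exact: Lk].
  pose F j := (slope E (phi u) (phi (j%:R * u)) + a1 / 2) / c.
  have -> : \sum_(1 <= j < k.+2) F j = \sum_(1 <= j < k.+1) F j + F k.+1.
    by rewrite big_nat_recr.
  by rewrite IH // -/(F _) (mulrSr 1 k.+1); ring.
have N0 : (0 < N)%N by exact: ltnW.
have := step N.-1; rewrite -ltnS !prednK // N1 leqnn => /(_ isT).
have -> : N.-1%:R * u = - u + (m%:~R * 1 + n%:~R * tau).
  by rewrite -mn -{2}(prednK N0) mulrSr; ring.
rewrite xiD_lattice //; last by move/latticeNE.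
rewrite xi_opp // => h; exists n.
have NE : N%:R = N.-1%:R + 1 :> C by rewrite -{1}(prednK N0) mulrSr.
apply/eqP; rewrite -subr_eq0; apply/eqP.
transitivity ((- xi u - n%:~R * tpi R) - (N.-1%:R * xi u +
  \sum_(1 <= k < N.-1) (slope E (phi u) (phi (k%:R * u)) + a1 / 2) / c)).
  by rewrite NE; ring.
by rewrite h subrr.
Qed.

End Uniformization.

(** * From [xi] to [D_{0,q}] at torsion points *)

Section Dilogarithm.
Variable R : realType.
Local Notation C := R[i].
Implicit Types (u v w : C).

(** For [n < 0] the reflection [al (- w) = - 1 - al w] turns the terms into those of [lam] at
    [tau - u]. The constants [- 1] would make the sum diverge, but they are real and [Im] discards
    them. *)
Lemma D0q_xi (tau u : C) : 0 < Im tau -> ~ lattice 1 tau u ->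
  Re (xi tau u) = 2 * pi * D0q (ez tau) (ez u).
Proof.
move=> tau0 Lu; have [e1 r1 r2] := nlattice_regular Lu.
have D0E v : ez v <> 1 -> D0 (ez v) = Im (al v).
  by move=> /eqP/negPf ev; rewrite /D0 ev.
have -> : D0q (ez tau) (ez u) = Im (lam tau 1 u) + Im (-1 * lam tau 1 (tau - u)).
  rewrite /D0q -(has_csum_Im (lamP tau0 1 r1)).
  rewrite -(has_csum_Im (has_csumZ (-1) (lamP tau0 1 r2))).
  congr (limn (series _) + limn (series _)); apply/funext => n; rewrite tm1.
    by rewrite -ezX -ezD D0E.
  rewrite -ezX -ezN -ezD.
  have E : u - n.+1%:R * tau = - (tau - u + n%:R * tau).
    by rewrite (mulrSr 1 n); ring.
  rewrite E D0E; last by rewrite ezN => /(congr1 (@GRing.inv C)); rewrite invrK invr1; exact: r2.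
  by rewrite al_opp; [rewrite ImD mulN1r (_ : Im (-1) = 0) ?add0r //= oppr0|exact: r2].
have ReM (a : C) : Re (- tpi R * a) = 2 * pi * Im a.
  by case: a => a b /=; rewrite oppr0 mul0r sub0r mulNr opprK.
rewrite /xi ReM !ImD mulN1r (_ : Im (1 / 2) = 0) ?addr0 //.
by rewrite (_ : 1 / 2 = (1 / 2 : R)%:C) // rmorphM fmorphV rmorph1 rmorph_nat.
Qed.

(** The substitution [u = v1 * w] normalises the first period to [1]; by the chain rule the
    differential is divided by [v1]. *)
Lemma uniformizes_scale (E : weierstrass C) (c v1 v2 : C) phi : v1 != 0 ->
  uniformizes E c v1 v2 phi -> uniformizes E (c / v1) 1 (v2 / v1) (fun w => phi (v1 * w)).
Proof.
move=> v0 [h1 h2 h3 h4 h5].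
have LE w : lattice v1 v2 (v1 * w) <-> lattice 1 (v2 / v1) w.
  split=> -[m [n E1]]; exists m, n.
    by apply: (mulfI v0); rewrite E1; field.
  by rewrite E1; field.
split=> //.
- by move=> Q /h2[u <-]; exists (u / v1); rewrite mulrC divfK.
- by move=> u u'; rewrite mulrDr h3.
- by move=> u; rewrite h4; exact: LE.
move=> u nu; have nu' : ~ lattice v1 v2 (v1 * u) by move/LE.
have [hx hy hxy] := h5 _ nu'.
have dl : cder (fun w => v1 * w) u v1.
  by apply: cder_eq (cderZ v1 (cder_id u)) _; rewrite mulr1.
have dx := cder_comp dl (cder_of_holo hx).
have dy := cder_comp dl (cder_of_holo hy).
have ix := (cder_isderive _ _ _).1 dx; have iy := (cder_isderive _ _ _).1 dy.
split; [by case: ix|by case: iy|].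
have -> : cderive (fun w => xcoord (phi (v1 * w))) u =
    cderive (fun w => xcoord (phi w)) (v1 * u) * v1 by case: ix.
by rewrite -hxy; field.
Qed.

Lemma ecmul_phi (E : weierstrass C) (c v1 v2 : C) phi k u :
  uniformizes E c v1 v2 phi -> phi (k%:R * u) = ecmul E k (phi u).
Proof.
move=> [_ _ hD h0 _]; elim: k => [|k IH].
  by rewrite mul0r; apply/h0; exists 0, 0; rewrite !mul0r addr0.
by rewrite mulrSr mulrDl mul1r addrC hD IH.
Qed.

Lemma ecmul1 (K : numFieldType) (E : weierstrass K) P : ecmul E 1 P = P.
Proof. by case: P => [[]|]. Qed.

(** Real parts in [xi_torsion] eliminate [n * tpi], which is purely imaginary. That [v1] is real
    lets the period come out of [Re]. *)
Lemma D0q_torsion (E : weierstrass C) (c v2 : C) (v1 : R) phi u (N : nat) :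
  c != 0 -> 0 < Im (v2 / v1%:C) -> uniformizes E c v1%:C v2 phi ->
  (1 < N)%N -> ecmul E N (phi u) = None ->
  (forall k, (0 < k < N)%N -> ecmul E k (phi u) <> None) ->
  2 * pi * D0q (ez (v2 / v1%:C)) (ez (u / v1%:C)) / v1 = - (N%:R^-1 *
    Re (\sum_(1 <= k < N.-1) (slope E (phi u) (ecmul E k (phi u)) + wa1 E / 2) / c)).
Proof.
move=> c0 tau0 hU N1 hN hk.
have v0 : v1%:C != 0 by apply: contraTneq tau0 => ->; rewrite invr0 mulr0 ltxx.
have v10 : v1 != 0 by apply: contraNneq v0 => ->.
set tau := v2 / v1%:C in tau0 *; set w := u / v1%:C.
have hV := uniformizes_scale v0 hU; rewrite -/tau in hV.
pose psi z := phi (v1%:C * z); rewrite -/psi in hV.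
have pw : psi w = phi u by rewrite /psi /w mulrC divfK.
have LE z : psi z = None <-> lattice 1 tau z by case: hV.
have pk k : psi (k%:R * w) = ecmul E k (phi u) by rewrite (ecmul_phi k w hV) pw.
have Lk k : (0 < k < N)%N -> ~ lattice 1 tau (k%:R * w).
  by move=> /hk h /LE; rewrite pk.
have LN : lattice 1 tau (N%:R * w) by apply/LE; rewrite pk.
have Lw : ~ lattice 1 tau w by have := Lk 1%N; rewrite mul1r; apply; rewrite N1.
have cv0 : c / v1%:C != 0 by rewrite mulf_neq0 ?invr_eq0.
have [n h] := xi_torsion tau0 cv0 hV N1 LN Lk.
have N0 : (N%:R : R) != 0 by rewrite pnatr_eq0 -lt0n ltnW.
have := congr1 (@complex.Re R) h.
rewrite ReN ReD -(rmorph_nat (real_complex R)) ReZ D0q_xi //.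
rewrite -(rmorph_int (real_complex R)) ReZ (_ : Re (tpi R) = 0) // mulr0 add0r.
have -> : \sum_(1 <= k < N.-1) (slope E (psi w) (psi (k%:R * w)) + wa1 E / 2) / (c / v1%:C) =
    v1%:C * \sum_(1 <= k < N.-1) (slope E (phi u) (ecmul E k (phi u)) + wa1 E / 2) / c.
  rewrite mulr_sumr; apply: eq_bigr => k _; rewrite pw pk.
  by field; rewrite c0 v0.
rewrite ReZ => hh; set S := Re _ in hh *; set D := D0q _ _ in hh *.
have -> : S = - (N%:R * (2 * pi * D)) / v1 by rewrite hh mulrC mulKf.
by field; rewrite v10 N0.
Qed.

Lemma cexp_conj (z : C) : cexp z^* = (cexp z)^*.
Proof.
case: z => a b; apply/eqP; rewrite eq_complex /= cosN sinN.
by apply/andP; split; apply/eqP; ring.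
Qed.

Lemma ez_conj u : (ez u)^* = ez (- u^*).
Proof.
rewrite /ez -cexp_conj; congr cexp; case: u => a b.
by apply/eqP; rewrite eq_complex /=; apply/andP; split; apply/eqP; ring.
Qed.

Lemma D0_real (z : C) : z^* = z -> D0 z = 0.
Proof.
move=> zz; rewrite /D0; case: eqVneq => // _.
have : (z / (1 - z))^* = z / (1 - z).
  by rewrite rmorphM fmorphV rmorphB rmorph1 /= zz.
case: (z / (1 - z)) => a b [] /eqP; rewrite eq_sym -addr_eq0 -mulr2n mulrn_eq0.
by move=> /eqP.
Qed.

(** If the conjugate of [tau] is a period, [tau] plus its conjugate is an integer and [ez tau] is
    real. At a lattice point [ez u] is a power of it, so every argument of [D0] is real and every
    term is [0]. *)
Lemma D0q_lattice (tau u : C) : 0 < Im tau -> lattice 1 tau tau^* ->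
  lattice 1 tau u -> D0q (ez tau) (ez u) = 0.
Proof.
move=> tau0 [m [n hc]] [a [b ->]].
have n1 : n = -1.
  have [_ iE] := lattice_ReIm tau m n; rewrite -hc in iE.
  have : (n + 1)%:~R * Im tau = 0.
    by rewrite intrD mulrDl -iE mul1r; case: (tau) => x y /=; rewrite addNr.
  move/eqP; rewrite mulf_eq0 (gt_eqF tau0) orbF intr_eq0 => /eqP h.
  by rewrite -[n](addrK 1) h sub0r.
have qr : (ez tau)^* = ez tau.
  transitivity (ez (- (m%:~R * 1 + n%:~R * tau))); first by rewrite ez_conj -hc.
  by rewrite n1 mulr1 rmorphN1 mulN1r opprB ezD ezN ez_int invr1 mulr1.
have zr : (ez (a%:~R * 1 + b%:~R * tau))^* = ez (a%:~R * 1 + b%:~R * tau).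
  rewrite ezD mulr1 ez_int mul1r.
  case: b => b; first by rewrite ezX rmorphXn /= qr.
  by rewrite NegzE rmorphN /= mulNr ezN ezX fmorphV rmorphXn /= qr.
have s0 (f : nat -> C) : (forall k, (f k)^* = f k) -> series (fun k => D0 (f k)) = fun=> 0.
  move=> hf; apply/funext => k; rewrite /series /= big1 // => i _; exact: D0_real.
rewrite /D0q !s0 ?lim_cst ?addr0 //.
- by move=> k; rewrite rmorphM fmorphV rmorphXn /= qr zr.
- by move=> k; rewrite rmorphM rmorphXn /= qr zr.
Qed.

End Dilogarithm.

(** * Rational functions over Q and multiples of the universal point *)

Section Evaluation.
Variables (K : numFieldType) (n : nat) (v : 'I_n -> K).
Implicit Types p q : mpoly n rat.

Lemma evalQD p q : evalQ (p + q) v = evalQ p v + evalQ q v.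
Proof. by rewrite /evalQ rmorphD mevalD. Qed.
Lemma evalQB p q : evalQ (p - q) v = evalQ p v - evalQ q v.
Proof. by rewrite /evalQ rmorphB mevalB. Qed.
Lemma evalQM p q : evalQ (p * q) v = evalQ p v * evalQ q v.
Proof. by rewrite /evalQ rmorphM mevalM. Qed.
Lemma evalQ1 : evalQ 1 v = 1.
Proof. by rewrite /evalQ rmorph1 meval1. Qed.
Lemma evalQC (a : rat) : evalQ (mpolyC n a) v = ratr a.
Proof. by rewrite /evalQ map_mpolyC mevalC. Qed.
Lemma evalQ_sum p : evalQ p v =
  \sum_(m <- msupp p) ratr (mcoeff m p) * \prod_(i < n) v i ^+ m i.
Proof.
rewrite /evalQ /map_mpoly /mmap raddf_sum /=; apply: eq_bigr => m _.
rewrite mevalM mevalC; congr (_ * _).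
by rewrite /mmap1 rmorph_prod; apply: eq_bigr => i _; rewrite rmorphXn /= mevalXU.
Qed.

End Evaluation.

Lemma evalQ_real (R : realType) n (p : mpoly n rat) (s : 'I_n -> R) :
  evalQ p (fun i => (s i)%:C) = (evalQ p s)%:C.
Proof.
rewrite !evalQ_sum rmorph_sum /=; apply: eq_bigr => m _.
rewrite rmorphM fmorph_rat rmorph_prod /=; congr (_ * _).
by apply: eq_bigr => i _; rewrite rmorphXn.
Qed.

Section RationalFunctions.
Variables (R : realType) (n : nat) (X : qvariety n).
Hypothesis X_irr : geom_irreducible R X.
Implicit Types (f g : ratfun R X) (p q : mpoly n.+1 rat) (s : 'I_n.+1 -> R).

(** Geometric irreducibility, applied to rational polynomials, makes their vanishing ideal prime;
    this keeps products of denominators admissible. *)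
Lemma vanishes_onM p q : vanishes_on R X (p * q) -> vanishes_on R X p \/ vanishes_on R X q.
Proof. by move=> h; apply: X_irr => v /h; rewrite evalQM. Qed.

Lemma one_nvanish f : ~ vanishes_on R X 1.
Proof.
move=> h; apply: (rden_neq0 (r := f)) => v vX.
by have := h v vX; rewrite evalQ1 => /eqP; rewrite oner_eq0.
Qed.

Lemma kpoint_real s : kpoint X s -> kpoint X (fun i => (s i)%:C).
Proof.
move=> [[i si] hX]; split; last by move=> p /hX h; rewrite evalQ_real h rmorph0.
by exists i; rewrite -(rmorph0 (real_complex R)) (inj_eq (@complexI R)).
Qed.

Lemma nvanish_real p s : kpoint X s -> evalQ p s != 0 -> ~ vanishes_on R X p.
Proof.
move=> /kpoint_real sX ps /(_ _ sX); rewrite evalQ_real => h.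
by move: ps; rewrite (complexI h : evalQ p s = 0) eqxx.
Qed.

Lemma homogeneousM d e p q : homogeneous d p -> homogeneous e q -> homogeneous (d + e) (p * q).
Proof. exact: dhomogM. Qed.

Lemma rden_neq0M f g : ~ vanishes_on R X (rden f * rden g).
Proof. by case/vanishes_onM; exact: rden_neq0. Qed.

Lemma radd_homogeneous f g :
  homogeneous (rdeg f + rdeg g) (rnum f * rden g + rnum g * rden f).
Proof.
apply: rpredD; first exact: homogeneousM (rnum_homogeneous f) (rden_homogeneous g).
by rewrite addnC; exact: homogeneousM (rnum_homogeneous g) (rden_homogeneous f).
Qed.

Definition radd f g : ratfun R X :=
  RatFun (radd_homogeneous f g)
    (homogeneousM (rden_homogeneous f) (rden_homogeneous g)) (@rden_neq0M f g).

Definition rmul f g : ratfun R X :=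
  RatFun (homogeneousM (rnum_homogeneous f) (rnum_homogeneous g))
    (homogeneousM (rden_homogeneous f) (rden_homogeneous g)) (@rden_neq0M f g).

Lemma mpolyC_homogeneous (a : rat) : homogeneous 0 (mpolyC n.+1 a).
Proof. by rewrite -[mpolyC _ a]mulr1 mul_mpolyC; apply: rpredZ; exact: dhomog1. Qed.

(* [f] only witnesses that [X] has a point, so that [1] does not vanish on it. *)
Definition rconst f (a : rat) : ratfun R X :=
  RatFun (mpolyC_homogeneous a) (mpolyC_homogeneous 1) (@one_nvanish f).

(* Junk value [f] when [f] is zero in the function field. *)
Definition rinv f : ratfun R X :=
  match pselect (vanishes_on R X (rnum f)) with
  | left _ => f
  | right h => RatFun (rden_homogeneous f) (rnum_homogeneous f) h
  end.

Lemma ratfun_at_add f g s r r' :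
  ratfun_at f s r -> ratfun_at g s r' -> ratfun_at (radd f g) s (r + r').
Proof.
move=> [f' [ef df ->]] [g' [eg dg ->]]; exists (radd f' g'); split.
- move=> v vX; have := ef v vX; have := eg v vX.
  rewrite /= !(evalQB, evalQM, evalQD) => /eqP; rewrite subr_eq0 => /eqP h1 /eqP.
  rewrite subr_eq0 => /eqP h2; apply/eqP; rewrite subr_eq0; apply/eqP.
  move: h1 h2.
  move: (evalQ (rnum f) v) (evalQ (rden f) v) (evalQ (rnum f') v) (evalQ (rden f') v).
  move: (evalQ (rnum g) v) (evalQ (rden g) v) (evalQ (rnum g') v) (evalQ (rden g') v).
  move=> e d e' d' a b a' b' h1 h2.
  rewrite [LHS](_ : _ = (a * b') * (d * d') + (e * d') * (b * b')); last by ring.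
  by rewrite h1 h2; ring.
- rewrite /= evalQM; exact: mulf_neq0 df dg.
- rewrite /= !(evalQM, evalQD); exact: addf_div df dg.
Qed.

Lemma ratfun_at_mul f g s r r' :
  ratfun_at f s r -> ratfun_at g s r' -> ratfun_at (rmul f g) s (r * r').
Proof.
move=> [f' [ef df ->]] [g' [eg dg ->]]; exists (rmul f' g'); split.
- move=> v vX; have := ef v vX; have := eg v vX.
  rewrite /= !(evalQB, evalQM) => /eqP; rewrite subr_eq0 => /eqP h1 /eqP.
  rewrite subr_eq0 => /eqP h2; apply/eqP; rewrite subr_eq0; apply/eqP.
  move: h1 h2.
  move: (evalQ (rnum f) v) (evalQ (rden f) v) (evalQ (rnum f') v) (evalQ (rden f') v).
  move: (evalQ (rnum g) v) (evalQ (rden g) v) (evalQ (rnum g') v) (evalQ (rden g') v).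
  move=> e d e' d' a b a' b' h1 h2.
  by rewrite mulrACA h1 h2 mulrACA.
- rewrite /= evalQM; exact: mulf_neq0 df dg.
- rewrite /= !evalQM; exact: mulf_div.
Qed.

Lemma ratfun_at_const f (a : rat) s : ratfun_at (rconst f a) s (ratr a).
Proof.
exists (rconst f a); split; first by move=> v _; rewrite evalQB subrr.
- by rewrite /= evalQ1 oner_eq0.
- by rewrite /= evalQ1 divr1 evalQC.
Qed.

(** A real point is also a complex point, so a nonzero value at [s] shows that [f] is nonzero in the
    function field, and [rinv f] is not the junk value. *)
Lemma ratfun_at_inv f s r : kpoint X s -> r != 0 ->
  ratfun_at f s r -> ratfun_at (rinv f) s r^-1.
Proof.
move=> sX r0 [f' [ef df rE]].
have nf' : evalQ (rnum f') s != 0 by apply: contraNneq r0; rewrite rE => ->; rewrite mul0r.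
have vf' := nvanish_real sX nf'.
have vf : ~ vanishes_on R X (rnum f).
  move=> h; have : vanishes_on R X (rnum f' * rden f).
    move=> v vX; have := ef v vX; rewrite evalQB !evalQM (h v vX) mul0r sub0r.
    move/eqP; rewrite oppr_eq0 => /eqP e0; exact: e0.
  by case/vanishes_onM => [/vf'|/(rden_neq0 (r := f))].
rewrite /rinv; case: pselect => [h|vf2]; first by case: (vf h).
exists (RatFun (rden_homogeneous f') (rnum_homogeneous f') vf').
split; [|exact: nf'|by rewrite rE; exact: invf_div].
move=> v vX; have := ef v vX; rewrite /= !(evalQB, evalQM).
move: (evalQ (rnum f) v) (evalQ (rden f) v) (evalQ (rnum f') v) (evalQ (rden f') v).
by move=> a b a' b' h; rewrite -[RHS]oppr0 -h; ring.
Qed.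

Lemma ratfun_at_nat f (k : nat) s : ratfun_at (rconst f k%:R) s k%:R.
Proof. by have := ratfun_at_const f k%:R s; rewrite ratr_nat. Qed.

Lemma ratfun_at_opp f g s r : ratfun_at g s r -> ratfun_at (rmul (rconst f (-1)) g) s (- r).
Proof.
by move=> h; have := ratfun_at_mul (ratfun_at_const f (-1) s) h; rewrite rmorphN1 mulN1r.
Qed.

End RationalFunctions.

(** * Multiples of a point on a Weierstrass curve *)

Section Multiples.
Variables (K : numFieldType) (E : weierstrass K).
Implicit Types (P Q : ecpoint K).

Lemma ecadd_SomeE x1 y1 x2 y2 x3 y3 : let P := Some (x1, y1) in let Q := Some (x2, y2) in
  ecadd E P Q = Some (x3, y3) ->
  [/\ ~~ ((x1 == x2) && (y1 + y2 + wa1 E * x2 + wa3 E == 0)),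
      x3 = slope E P Q ^+ 2 + wa1 E * slope E P Q - wa2 E - x1 - x2
    & y3 = - (slope E P Q + wa1 E) * x3 - (y1 - slope E P Q * x1) - wa3 E].
Proof. by rewrite /=; case: ifP => // _ [<- <-]. Qed.

Lemma ecadd_Some x1 y1 x2 y2 :
  ecadd E (Some (x1, y1)) (Some (x2, y2)) <> None ->
  exists x3 y3, ecadd E (Some (x1, y1)) (Some (x2, y2)) = Some (x3, y3).
Proof. by case: ecadd => [[x3 y3]|//] _; exists x3, y3. Qed.

Lemma same_x x1 y1 y2 : on_curve E (Some (x1, y1)) -> on_curve E (Some (x1, y2)) ->
  y1 = y2 \/ y1 + y2 + wa1 E * x1 + wa3 E = 0.
Proof.
rewrite /= => h1 h2.
have : (y1 - y2) * (y1 + y2 + wa1 E * x1 + wa3 E) == 0.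
  rewrite [X in X == 0](_ : _ = (y1 ^+ 2 + wa1 E * x1 * y1 + wa3 E * y1) -
     (y2 ^+ 2 + wa1 E * x1 * y2 + wa3 E * y2)); last by ring.
  by rewrite h1 h2 subrr.
by rewrite mulf_eq0 subr_eq0 => /orP[/eqP|/eqP]; [left|right].
Qed.

(* The cubic [x^3 + ...] cut out by the line through two points has [x3] as its
   third root; the quotient by [x - x1] is recognised from its value at [x2]. *)
Lemma ecadd_on_curve P Q : on_curve E P -> on_curve E Q -> on_curve E (ecadd E P Q).
Proof.
case: P => [[x1 y1]|] //; case: Q => [[x2 y2]|] // h1 h2.
case E3 : (ecadd _ _ _) => [[x3 y3]|//].
have [nz x3E y3E] := ecadd_SomeE E3.
set l := slope _ _ _ in x3E y3E.
pose nu := y1 - l * x1.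
pose b := wa2 E - l ^+ 2 - wa1 E * l.
pose d := wa4 E - 2 * l * nu - wa1 E * nu - wa3 E * l.
pose g x := x ^+ 3 + b * x ^+ 2 + d * x + (wa6 E - nu ^+ 2 - wa3 E * nu).
have gE x : g x = (x ^+ 3 + wa2 E * x ^+ 2 + wa4 E * x + wa6 E) -
    ((l * x + nu) ^+ 2 + wa1 E * x * (l * x + nu) + wa3 E * (l * x + nu)).
  by rewrite /g /b /d; ring.
have y1E : l * x1 + nu = y1 by rewrite /nu addrC subrK.
have g1 : g x1 = 0 by rewrite gE y1E h1 subrr.
have b3 : b = - (x1 + x2 + x3) by rewrite x3E /b; ring.
have q0 : x1 ^+ 2 + x1 * x2 + x2 ^+ 2 + b * (x1 + x2) + d = 0.
  have [e|ne] := eqVneq x1 x2.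
    have h2' : on_curve E (Some (x1, y2)) by rewrite e.
    have [h|/eqP] := same_x h1 h2'.
      have n2 : 2 * y1 + wa1 E * x1 + wa3 E != 0.
        apply: contra nz => /eqP h0; rewrite e eqxx /= -h -e.
        by apply/eqP; rewrite -[RHS]h0; ring.
      have lE : l * (2 * y1 + wa1 E * x1 + wa3 E) =
          3 * x1 ^+ 2 + 2 * wa2 E * x1 + wa4 E - wa1 E * y1.
        by rewrite /l /slope e eqxx -e divfK.
      rewrite -e /d /b /nu.
      rewrite [LHS](_ : _ = (3 * x1 ^+ 2 + 2 * wa2 E * x1 + wa4 E - wa1 E * y1) -
         l * (2 * y1 + wa1 E * x1 + wa3 E)); last by ring.
      by rewrite lE subrr.
    by move=> h; case/negP: nz; rewrite e eqxx /= -e.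
  have y2E : l * x2 + nu = y2.
    rewrite /nu /l /slope (negPf ne); field.
    by rewrite subr_eq0 eq_sym.
  have g2 : g x2 = 0 by rewrite gE y2E h2 subrr.
  have : (x1 - x2) * (x1 ^+ 2 + x1 * x2 + x2 ^+ 2 + b * (x1 + x2) + d) == 0.
    rewrite [X in X == 0](_ : _ = g x1 - g x2); last by rewrite /g; ring.
    by rewrite g1 g2 subrr.
  by rewrite mulf_eq0 subr_eq0 (negPf ne) => /eqP.
have g3 : g x3 = 0.
  rewrite [LHS](_ : _ = g x1 + (x3 - x1) * (x1 ^+ 2 + x1 * x2 + x2 ^+ 2 + b * (x1 + x2) + d)).
    by rewrite g1 q0 mulr0 addr0.
  by rewrite /g b3; ring.
have y3' : y3 = - (l * x3 + nu) - wa1 E * x3 - wa3 E by rewrite y3E /nu; ring.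
move/eqP: g3; rewrite gE subr_eq0 => /eqP /= ->.
by rewrite y3'; ring.
Qed.

Lemma ecmul_on_curve k P : on_curve E P -> on_curve E (ecmul E k P).
Proof. by move=> hP; elim: k => [//|k IH]; exact: ecadd_on_curve. Qed.

(** Equal abscissas mean [k P = - P] or [k P = P]. The first gives [(k + 1) P = 0]. In the second,
    [- P] lies on the line through [P] and [(k - 1) P], whose only point of abscissa [x0] is [P], so
    [2 P = 0]. Neither case appeals to associativity. *)
Lemma ecmul_x_neq N k x0 y0 x y : has_order E N (Some (x0, y0)) ->
  (1 < k)%N -> (k.+1 < N)%N -> ecmul E k (Some (x0, y0)) = Some (x, y) -> x <> x0.
Proof.
move=> [hP hN hk] k1 kN hx xx0; rewrite xx0 in hx.
have hQ := ecmul_on_curve k hP; rewrite hx in hQ.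
have [yy|h] := same_x hP hQ; last first.
  apply: (hk k.+1); first by [].
  by rewrite /ecmul iterS -/(ecmul _ _ _) hx /= eqxx h eqxx.
case: k k1 kN hx {hQ} => [//|k] k1 kN hx.
have kk : (0 < k < N)%N by rewrite -ltnS k1 /= (ltn_trans _ kN).
case E1 : (ecmul E k (Some (x0, y0))) (hk k kk) => [[x' y']|//] _.
have := hx; rewrite /ecmul iterS -/(ecmul _ _ _) E1 => /ecadd_SomeE[_ _ y0E].
rewrite -yy in y0E.
apply: (hk 2%N); first by rewrite /= (leq_ltn_trans _ kN).
rewrite /ecmul iterS -/(ecmul _ _ _) ecmul1 /= eqxx /=.
rewrite ifT //; apply/eqP; move/eqP: y0E; rewrite -subr_eq0 => /eqP h.
by rewrite -[RHS]h; ring.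
Qed.

End Multiples.

(** * From real points to complex points *)

Section Transfer.
Variable R : realType.
Local Notation toC := (fun x : R => x%:C).
Variable E : weierstrass R.
Implicit Types (P Q : ecpoint R).

Lemma eqC (x y : R) : (x%:C == y%:C) = (x == y).
Proof. exact: (inj_eq (@complexI R)). Qed.

Lemma slope_toC P Q : slope (wmap toC E) (ecpoint_map toC P) (ecpoint_map toC Q) =
  (slope E P Q)%:C.
Proof.
case: P => [[x1 y1]|]; case: Q => [[x2 y2]|] //=.
rewrite eqC; case: ifP => _; rewrite fmorph_div ?rmorphB //; congr (_ / _).
- by rewrite !(rmorphD, rmorphN, rmorphM, rmorphXn, rmorph_nat).
- by rewrite !(rmorphD, rmorphN, rmorphM, rmorphXn, rmorph_nat).
Qed.

Lemma ecadd_toC P Q : ecadd (wmap toC E) (ecpoint_map toC P) (ecpoint_map toC Q) =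
  ecpoint_map toC (ecadd E P Q).
Proof.
case: P => [[x1 y1]|]; case: Q => [[x2 y2]|] //.
have := slope_toC (Some (x1, y1)) (Some (x2, y2)).
rewrite /ecpoint_map /=; set l := if _ == _ :> R[i] then _ else _ => lE.
have -> : (x1%:C == x2%:C) && (y1%:C + y2%:C + (wa1 E)%:C * x2%:C + (wa3 E)%:C == 0) =
    (x1 == x2) && (y1 + y2 + wa1 E * x2 + wa3 E == 0).
  by rewrite eqC -rmorphM -!rmorphD -(rmorph0 (real_complex R)) eqC.
case: ifP => _ //=; rewrite lE.
by congr (Some (_, _)); rewrite !(rmorphD, rmorphN, rmorphM, rmorphXn).
Qed.

Lemma ecmul_toC k P : ecmul (wmap toC E) k (ecpoint_map toC P) = ecpoint_map toC (ecmul E k P).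
Proof.
elim: k => [//|k IH].
by rewrite /ecmul !iterS -!/(ecmul _ _ _) IH ecadd_toC.
Qed.

Lemma ecpoint_map_None P : ecpoint_map toC P = None <-> P = None.
Proof. by case: P. Qed.

End Transfer.

(** * Multiples of the universal point as rational functions *)

Section MultiplesOverFunctionField.
Variables (R : realType) (n : nat) (X : qvariety n) (N : nat).
Hypothesis X_irr : geom_irreducible R X.
Variables (F : triple (ratfun R X)) (fx fy : ratfun R X).
Hypothesis F_point : tpoint F = Some (fx, fy).

Local Notation "f +r g" := (radd X_irr f g) (at level 50, left associativity).
Local Notation "f *r g" := (rmul X_irr f g) (at level 40, left associativity).
Local Notation cst q := (rconst fx q).
Local Notation "-r f" := (cst (-1) *r f) (at level 35).
Local Notation fa1 := (wa1 (tcurve F)).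
Local Notation fa2 := (wa2 (tcurve F)).
Local Notation fa3 := (wa3 (tcurve F)).
Local Notation fa4 := (wa4 (tcurve F)).

Local Notation add := (ratfun_at_add X_irr).
Local Notation mul := (ratfun_at_mul X_irr).
Local Notation opp := (ratfun_at_opp X_irr fx).
Local Notation nat_ := (ratfun_at_nat fx).

Definition rtangent : ratfun R X :=
  (cst 3%:R *r (fx *r fx) +r cst 2%:R *r fa2 *r fx +r fa4 +r -r (fa1 *r fy))
  *r rinv (cst 2%:R *r fy +r fa1 *r fx +r fa3).

Definition rchord (gx gy : ratfun R X) : ratfun R X :=
  (gy +r -r fy) *r rinv (gx +r -r fx).

Lemma ratfun_at_eq (f : ratfun R X) (s : 'I_n.+1 -> R) (r r' : R) :
  ratfun_at f s r -> r = r' -> ratfun_at f s r'.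
Proof. by move=> h <-. Qed.

(** The rational functions are fixed before [s]: the choice between tangent and chord depends on [k]
    alone, by [ecmul_x_neq] in each fibre. The coordinates [gx], [gy] drive the induction, and [gs]
    accumulates the slopes. *)
Lemma multiple_ratfun k : (0 < k < N)%N -> exists gx gy gs : ratfun R X,
  forall (s : 'I_n.+1 -> R) (t : triple R), kpoint X s -> fibre N F s t ->
  exists x y : R,
    [/\ ecmul (tcurve t) k (tpoint t) = Some (x, y), ratfun_at gx s x, ratfun_at gy s y
      & ratfun_at gs s (\sum_(1 <= j < k)
          (slope (tcurve t) (tpoint t) (ecmul (tcurve t) j (tpoint t))
           + wa1 (tcurve t) / 2))].
Proof.
elim: k => [//|[|k] IH] kN.
  exists fx, fy, (cst 0); move=> s t _ [_ _ + _]; rewrite F_point.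
  case: (tpoint t) => [[x y]|//] [hx hy]; exists x, y; split=> //.
  rewrite big_geq //; apply: ratfun_at_eq (ratfun_at_const fx 0 s) _.
  by rewrite rmorph0.
have kN' : (0 < k.+1 < N)%N by case/andP: kN => _ /ltnW.
have {IH} [gx [gy [gs IH]]] := IH kN'.
(* The multiple at hand is [k.+1], so [k == 0] is the addition [P + P]. *)
pose gl := if k == 0 then rtangent else rchord gx gy.
pose x3 := gl *r gl +r fa1 *r gl +r -r fa2 +r -r fx +r -r gx.
pose y3 := -r ((gl +r fa1) *r x3) +r -r (fy +r -r (gl *r fx)) +r -r fa3.
exists x3, y3, (gs +r (gl +r fa1 *r cst (2%:R^-1))).
move=> s t sX ht; have {IH} [x [y [kE hx hy hs]]] := IH s t sX ht.
have [[ha1 ha2 ha3 ha4 _] _ + [_ _ hO]] := ht; rewrite F_point.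
case Pt : (tpoint t) => [[x0 y0]|//] [hx0 hy0].
rewrite Pt in kE hO hs; have [hP _ hk] := hO.
have h3 := hk k.+2 kN; rewrite /ecmul iterS -/(ecmul _ _ _) kE in h3.
have [X3 [Y3 E3]] := ecadd_Some h3; have [nz X3E Y3E] := ecadd_SomeE E3.
set E := tcurve t in X3E Y3E nz kE E3 hs *; set P := Some (x0, y0) in kE E3 hs *.
have hl : ratfun_at gl s (slope E P (Some (x, y))).
  rewrite /gl; case: eqVneq => [k0|k0].
    have [xE yE] : x = x0 /\ y = y0.
      by move: kE; rewrite k0 ecmul1 => -[-> ->].
    have dn : 2 * y0 + wa1 E * x0 + wa3 E != 0.
      apply: contra nz => /eqP h; rewrite xE yE eqxx /=.
      by apply/eqP; rewrite -[RHS]h; ring.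
    have hd := add (add (mul (nat_ 2%N s) hy0) (mul ha1 hx0)) ha3.
    have hn := add (add (add (mul (nat_ 3%N s) (mul hx0 hx0))
      (mul (mul (nat_ 2%N s) ha2) hx0)) ha4) (opp (mul ha1 hy0)).
    apply: ratfun_at_eq (mul hn (ratfun_at_inv X_irr sX dn hd)) _.
    by rewrite /slope /= xE yE eqxx.
  have xn : x <> x0.
    by apply: (ecmul_x_neq hO _ _ kE); case/andP: kN => // _; case: (k) k0.
  have dn : x + - x0 != 0 by rewrite subr_eq0; apply/eqP.
  have hd := add hx (opp hx0).
  have hn := add hy (opp hy0).
  apply: ratfun_at_eq (mul hn (ratfun_at_inv X_irr sX dn hd)) _.
  by rewrite /slope /= eq_sym; have /eqP/negPf -> := xn.
set l := slope E P (Some (x, y)) in hl X3E Y3E.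
have hX : ratfun_at x3 s X3.
  apply: ratfun_at_eq (add (add (add (add (mul hl hl)
    (mul ha1 hl)) (opp ha2)) (opp hx0)) (opp hx)) _.
  by rewrite X3E -expr2.
exists X3, Y3; split=> //.
- by rewrite /ecmul iterS -/(ecmul _ _ _) kE E3.
- have hY := (add (add (opp (mul (add hl ha1) hX))
    (opp (add hy0 (opp (mul hl hx0))))) (opp ha3)).
  apply: ratfun_at_eq hY _.
  by rewrite Y3E mulNr.
- have h2 := ratfun_at_const fx (2%:R^-1) s; rewrite fmorphV rmorph_nat in h2.
  apply: ratfun_at_eq (add hs (add hl (mul ha1 h2))) _.
  by rewrite [RHS]big_nat_recr // kE.
Qed.

End MultiplesOverFunctionField.

Theorem theorem1p2 (R : realType) (N : nat) (N_gt0 : (0 < N)%N)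
  (X : modular_curve R N) (F : triple (ratfun R (mvar X)))
  (F_univ : universal_family F) :
  exists f : ratfun R (mvar X),
  forall s : 'I_(mdim X).+1 -> R,
    kpoint (mvar X) s -> noncuspidal X (fun i => (s i)%:C) ->
  forall t : triple R, fibre N F s t ->
  exists r : R, ratfun_at f s r /\
    let Omega := real_period (tcurve t) (tdiff t) in
    forall (v1 v2 : R[i]) (phi : R[i] -> ecpoint R[i]) (u : R[i]),
      uniformizes (wmap (fun x => x%:C) (tcurve t)) (tdiff t)%:C v1 v2 phi ->
      (forall w, phi (conjc w) = ecpoint_map conjc (phi w)) ->
      v1 = Omega%:C ->
      0 < complex.Im (v2 / v1) ->
      phi u = ecpoint_map (fun x => x%:C) (tpoint t) ->
      let q := cexp ((0 +i* (2 * pi)) * (v2 / v1)) in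
      let z := cexp ((0 +i* (2 * pi)) * u / v1) in
      r = 2 * pi * D0q q z / Omega.
Proof.
have irr := @mvar_irreducible R N X.
(* For [N = 1] the point is at infinity and both sides are [0]. *)
have [N1|N1] := leqP N 1.
  have {N_gt0} N1 : N = 1%N by apply/eqP; rewrite eqn_leq N1.
  exists (rconst (tdiff F) 0) => s sX _ t ht; exists 0; split.
    by apply: ratfun_at_eq (ratfun_at_const _ 0 s) _; rewrite rmorph0.
  move=> Omega v1 v2 phi u hU hc v1E tau0 pu q z.
  have v10 : v1 != 0 by apply: contraTneq tau0 => ->; rewrite invr0 mulr0 ltxx.
  have hV := uniformizes_scale v10 hU.
  have LE w : phi (v1 * w) = None <-> lattice 1 (v2 / v1) w by case: hV.
  have [_ _ _ [_ _ [_ hO _]]] := ht.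
  have Pt : tpoint t = None by move: hO; rewrite [in ecmul _ _ _]N1 ecmul1.
  have zE : z = ez (u / v1) by rewrite /z /ez mulrA.
  have Lu : lattice 1 (v2 / v1) (u / v1).
    by apply/LE; rewrite mulrC divfK // pu Pt.
  (* Since [phi] commutes with conjugation, it sends the conjugate of the period [v2] to infinity,
     so that conjugate is a period too. *)
  have Lt : lattice 1 (v2 / v1) (v2 / v1)^*.
    apply/LE; have -> : v1 * (v2 / v1)^* = v2^*.
      have cv : v1^* = v1 by rewrite v1E; exact: conjc_real.
      rewrite rmorphM fmorphV -[RHS](divfK v10) mulrC; congr (_ / _ * _).
      exact: cv.
    rewrite hc; have [_ _ _ h _] := hU.
    by have /h -> : lattice v1 v2 v2 by exists 0, 1; rewrite mul0r add0r mul1r.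
  by rewrite zE (D0q_lattice tau0 Lt Lu) mulr0 mul0r.
(* A universal point at infinity has no fibre of order [N > 1], so any rational function will do. *)
case FP : (tpoint F) => [[fx fy]|]; last first.
  exists (tdiff F) => s _ _ t [_ _ + [_ _ [_ _ hk]]]; rewrite FP.
  by case Pt : (tpoint t) => [[]|] // _; case: (hk 1%N); rewrite ?N1 // Pt.
have N1' : (0 < N.-1 < N)%N by rewrite -ltnS prednK // N1 leqnn.
have [gx [gy [gs hg]]] := multiple_ratfun irr FP N1'.
exists (rmul irr (rconst fx (- N%:R^-1)) (rmul irr gs (rinv (tdiff F)))).
move=> s sX _ t ht; have [x [y [_ _ _ hs]]] := hg s t sX ht.
have [_ hd _ [_ c0 [_ hN hk]]] := ht.
set E := tcurve t in hs hN hk *; set c := tdiff t in hd c0 *.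
set P := tpoint t in hs hN hk *.
set S := \sum_(_ <= _ < _) _ in hs.
exists (- N%:R^-1 * (S * c^-1)); split.
  apply: ratfun_at_mul; last by apply: ratfun_at_mul hs (ratfun_at_inv irr sX c0 hd).
  apply: ratfun_at_eq (ratfun_at_const _ _ s) _.
  by rewrite rmorphN fmorphV rmorph_nat.
move=> Omega v1 v2 phi u hU _ v1E tau0 pu q z.
have zE : z = ez (u / Omega%:C) by rewrite /z v1E /ez mulrA.
have qE : q = ez (v2 / Omega%:C) by rewrite /q v1E.
rewrite v1E in hU tau0; rewrite zE qE.
have cC : c%:C != 0 by rewrite -(rmorph0 (real_complex R)) eqC.
rewrite (D0q_torsion cC tau0 hU N1); last 2 first.
- by rewrite pu ecmul_toC hN.
- by move=> k /hk h; rewrite pu ecmul_toC => /ecpoint_map_None.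
rewrite mulNr; congr (- (_ * _)).
(* All summands come from the real curve and the real point, so the complex sum is real and [Re]
   returns it. *)
rewrite /S mulr_suml (_ : \sum_(_ <= _ < _) _ = (\sum_(1 <= k < N.-1)
  (slope E P (ecmul E k P) + wa1 E / 2) / c)%:C) //.
rewrite rmorph_sum /=; apply: eq_bigr => k _; rewrite pu ecmul_toC slope_toC.
by rewrite rmorphM fmorphV rmorphD fmorph_div rmorph_nat.
Qed.
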